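(* Consider two samples $X_i(t)=\mu(t)+\varepsilon_i(t)$, $1\le i\le N$, and $X^*_j(t)=\mu^*(t)+\varepsilon^*_j(t)$, $1\le j\le M$, $t\in[0,1]$, with $\mu,\mu^*\in L^2([0,1])$. Suppose $(\varepsilon_i)$ satisfies: $\varepsilon_i=f(\delta_i,\delta_{i-1},\ldots)$ with $(\delta_i)$ i.i.d. in a measurable space $S$ and $f:S^\infty\to L^2$ measurable; $\sum_{m\ge1}(E\int_0^1(\varepsilon_i(t)-\varepsilon_{i,m}(t))^2dt)^{1/2}<\infty$, where $\varepsilon_{i,m}=f(\delta_i,\ldots,\delta_{i-m+1},\delta^{(m)}_{i,i-m},\delta^{(m)}_{i,i-m-1},\ldots)$ with $(\delta^{(m)}_{i,k})_k$ independent copies of $(\delta_k)$; $E\varepsilon_0=0$ in $L^2$; $\int_0^1E\varepsilon_0^2(t)dt<\infty$. Suppose $(\varepsilon^*_j)$ satisfies the same conditions. Suppose the two error samples are independent, $H_A:\mu\ne\mu^*$ (i.e. $\int_0^1(\mu-\mu^* )^2>0$) holds, and $N/(N+M)\to\theta\in[0,1]$ as $\min(M,N)\to\infty$. Let $d(t,s)=(1-\theta)c(t,s)+\theta c^*(t,s)$, where $c(t,s)=E\varepsilon_0(t)\varepsilon_0(s)+\sum_{i\ge1}E\varepsilon_0(t)\varepsilon_i(s)+\sum_{i\ge1}E\varepsilon_0(s)\varepsilon_i(t)$ and $c^*$ is defined identically from the $\varepsilon^*_j$; let $\lambda_1\ge\lambda_2\ge\cdots$ be the eigenvalues of the integral operator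 $D$ with kernel $d$ and $\varphi_i$ corresponding orthonormal eigenfunctions. Let $\hat d_{N,M}$ be a kernel with $\int\!\!\int(\hat d_{N,M}-d)^2dtds\to0$ in probability, with eigenvalues $\hat\lambda_1\ge\hat\lambda_2\ge\cdots$ and unit-norm eigenfunctions $\hat\varphi_i$. Fix $p\ge1$ and assume $\lambda_1>\lambda_2>\cdots>\lambda_p>\lambda_{p+1}$. With $\bar X_N=N^{-1}\sum_{i=1}^NX_i$, $\bar X^*_M=M^{-1}\sum_{j=1}^MX^*_j$, $\hat a_i=\langle\bar X_N-\bar X^*_M,\hat\varphi_i\rangle$, $U^{(1)}_{N,M}=\frac{MN}{M+N}\sum_{i=1}^p\hat a_i^2$ and $U^{(2)}_{N,M}=\frac{MN}{M+N}\sum_{i=1}^p\hat a_i^2/\hat\lambda_i$, we have, in probability as $\min(M,N)\to\infty$, $$\frac{N+M}{NM}U^{(1)}_{N,M}\to\sum_{i=1}^p\langle\mu-\mu^*,\varphi_i\rangle^2,\qquad \frac{N+M}{NM}U^{(2)}_{N,M}\to\sum_{i=1}^p\frac{\langle\mu-\mu^*,\varphi_i\rangle^2}{\lambda_i}.$$ In particular, if $0<\theta<1$ and $\langle\mu-\mu^*,\varphi_i\rangle\ne0$ for at least one $1\le i\le p$, then $U^{(1)}_{N,M}\to\infty$ and $U^{(2)}_{N,M}\to\infty$ in probability.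
   Context: $L^2=L^2([0,1])$ with $\langle x,y\rangle=\int_0^1x(t)y(t)dt$. *)

(* Defs.v *)
From HB Require Import structures.
From mathcomp Require Import all_boot all_order all_algebra.
From mathcomp Require Import all_classical all_reals all_analysis.

Set Implicit Arguments.
Unset Strict Implicit.
Unset Printing Implicit Defensive.

Import Order.TTheory GRing.Theory Num.Theory.
Import numFieldNormedType.Exports.

Local Open Scope classical_set_scope.
Local Open Scope ring_scope.

(*  L^2([0,1]) and kernels on [0,1]^2 (functions R -> R, values outside      *)
(*  [0,1] are irrelevant; everything is taken w.r.t. Lebesgue measure).      *)
Definition I01 {R : realType} : set R := `[0%R, 1%R].

Section L2defs.
Context {R : realType}.

Definition L2fun (f : R -> R) : Prop :=
  measurable_fun I01 f /\
  (\int[lebesgue_measure]_(t in I01) ((f t) ^+ 2)%:E < +oo)%E.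

Definition ip (f g : R -> R) : R :=
  Rintegral lebesgue_measure I01 (fun t => f t * g t).

Definition ksq (k : R -> R -> R) : \bar R :=
  (\int[lebesgue_measure]_(t in I01)
     \int[lebesgue_measure]_(s in I01) ((k t s) ^+ 2)%:E)%E.

Definition L2kernel (k : R -> R -> R) : Prop :=
  measurable_fun (I01 `*` I01) (fun ts : R * R => k ts.1 ts.2) /\
  (ksq k < +oo)%E.

Definition kop (k : R -> R -> R) (f : R -> R) (t : R) : R :=
  Rintegral lebesgue_measure I01 (fun s => k t s * f s).

Definition eigpair (k : R -> R -> R) (lam : R) (phi : R -> R) : Prop :=
  [/\ L2fun phi, ip phi phi = 1 &
      {ae lebesgue_measure, forall t, I01 t -> kop k phi t = lam * phi t}].

Definition lin_indep (n : nat) (phi : nat -> R -> R) : Prop :=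
  forall c : nat -> R,
    {ae lebesgue_measure, forall t, I01 t -> \sum_(i < n) c i * phi i t = 0} ->
    forall i, (i < n)%N -> c i = 0.

Definition orthonormal_fam (n : nat) (phi : nat -> R -> R) : Prop :=
  forall i j, (i < n)%N -> (j < n)%N -> ip (phi i) (phi j) = (i == j)%:R.

(* lam 0 >= lam 1 >= ... >= lam (n-1) are the first n terms of the
   nonincreasing enumeration of the (real) eigenvalues of the integral
   operator with kernel k, counted with multiplicity, and phi 0, ..., phi (n-1)
   are corresponding (unit-norm, linearly independent) eigenfunctions:
   every eigenfunction for an eigenvalue strictly larger than lam (n-1)
   lies in the span of the phi i having that eigenvalue. *)
Definition leading_eigs (k : R -> R -> R) (n : nat) (lam : nat -> R)
    (phi : nat -> R -> R) : Prop :=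
  [/\ forall i, (i < n)%N -> eigpair k (lam i) (phi i),
      forall i j, (i <= j)%N -> (j < n)%N -> lam j <= lam i,
      lin_indep n phi &
      forall (mu0 : R) (psi : R -> R), (0 < n)%N -> eigpair k mu0 psi ->
        lam n.-1 < mu0 ->
        exists c : nat -> R,
          {ae lebesgue_measure, forall t, I01 t ->
             psi t = \sum_(i < n | lam i == mu0) c i * phi i t}].

End L2defs.

Definition cyl {dS : measure_display} (S : measurableType dS) : set (set (nat -> S)) :=
  [set B | exists (k : nat) (A : set S), measurable A /\ B = [set x | A (x k)]].

Definition seqS {dS : measure_display} (S : measurableType dS) :=
  g_sigma_algebraType (@cyl _ S).

Section probdefs.
Context {R : realType} {d : measure_display} {Omega : measurableType d}
  (P : probability Omega R).

Definition Pr (A : set Omega) : R := fine (P A).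

Definition iid {I : eqType} {dS : measure_display} {S : measurableType dS}
    (X : I -> Omega -> S) : Prop :=
  [/\ forall i, measurable_fun setT (X i),
      forall i j (A : set S), measurable A -> P (X i @^-1` A) = P (X j @^-1` A) &
      forall (J : seq I) (A : I -> set S), uniq J -> (forall j, measurable (A j)) ->
        Pr [set w | forall j, j \in J -> A j (X j w)] =
        \prod_(j <- J) Pr (X j @^-1` A j)].

Definition bshift {dS : measure_display} {S : measurableType dS}
    (f : (nat -> S) -> R -> R) (delta : int -> Omega -> S) (i : int) :
    Omega -> R -> R :=
  fun w => f (fun k : nat => delta (i - k%:Z)%R w).

Definition bshift_cpl {dS : measure_display} {S : measurableType dS}
    (f : (nat -> S) -> R -> R) (delta : int -> Omega -> S)
    (dc : int -> Omega -> S) (m : nat) (i : int) : Omega -> R -> R :=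
  fun w => f (fun k : nat => if (k < m)%N then delta (i - k%:Z)%R w
                             else dc (i - k%:Z)%R w).

(* the error sequence eps_i = f(delta_i, delta_{i-1}, ...) satisfies the
   assumptions of the paper; dcopy m i is the independent copy
   (delta^{(m)}_{i,k})_k of (delta_k)_k used to build eps_{i,m} *)
Definition L2_m_approximable {dS : measure_display} {S : measurableType dS}
    (f : (nat -> S) -> R -> R) (delta : int -> Omega -> S)
    (dcopy : nat -> int -> int -> Omega -> S) : Prop :=
  iid delta /\
      (forall (m : nat) (i : int),
         iid (fun z : int + int => match z with
                                   | inl k => delta k
                                   | inr k => dcopy m i k end)) /\
      measurable_fun setT (fun p : seqS S * R => f p.1 p.2) /\
      (forall x, L2fun (f x)) /\
      (forall i : int,
        (\sum_(1 <= m <oo)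
           sqrte (\int[P]_w \int[lebesgue_measure]_(t in I01)
              ((bshift f delta i w t - bshift_cpl f delta (dcopy m i) m i w t) ^+ 2)%:E)
         < +oo)%E) /\
      {ae lebesgue_measure, forall t, I01 t ->
          Rintegral P setT (fun w => bshift f delta 0 w t) = 0} /\
      (\int[lebesgue_measure]_(t in I01)
          \int[P]_w ((bshift f delta 0 w t) ^+ 2)%:E < +oo)%E.

Definition autocov {dS : measure_display} {S : measurableType dS}
    (f : (nat -> S) -> R -> R) (delta : int -> Omega -> S) (h : nat) (t s : R) : R :=
  Rintegral P setT (fun w => bshift f delta 0 w t * bshift f delta h%:Z w s).

(* c is the long-run covariance kernel
   c(t,s) = E eps_0(t)eps_0(s) + sum_{i>=1} E eps_0(t)eps_i(s)
                               + sum_{i>=1} E eps_0(s)eps_i(t),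
   the series being understood in L^2([0,1]^2) *)
Definition is_lrcov {dS : measure_display} {S : measurableType dS}
    (f : (nat -> S) -> R -> R) (delta : int -> Omega -> S) (c : R -> R -> R) : Prop :=
  L2kernel c /\
  (fun n : nat => ksq (fun t s =>
      autocov f delta 0 t s
      + \sum_(1 <= h < n.+1) (autocov f delta h t s + autocov f delta h s t)
      - c t s)) @ \oo --> 0%E.

(* independence of the two L^2-valued sequences X and Y: the families of
   real random variables (<X_i, g>)_{i, g in L^2} and (<Y_j, h>)_{j, h in L^2}
   are independent *)
Definition evt (X : int -> Omega -> R -> R) (s : seq (int * (R -> R)))
    (A : nat -> set R) : set Omega :=
  [set w | forall n, (n < size s)%N ->
     A n (ip (X (nth (0%R, fun _ => 0) s n).1 w) (nth (0%R, fun _ => 0) s n).2)].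

Definition indep_L2seq (X Y : int -> Omega -> R -> R) : Prop :=
  forall (s t : seq (int * (R -> R))) (A B : nat -> set R),
    (forall n, (n < size s)%N -> L2fun (nth (0%R, fun _ => 0) s n).2) ->
    (forall n, (n < size t)%N -> L2fun (nth (0%R, fun _ => 0) t n).2) ->
    (forall n, measurable (A n)) -> (forall n, measurable (B n)) ->
    Pr (evt X s A `&` evt Y t B) = Pr (evt X s A) * Pr (evt Y t B).

Definition cvg_in_prob (Y : nat -> Omega -> R) (y : R) : Prop :=
  forall e : R, 0 < e ->
    (fun k => Pr [set w | e <= `|Y k w - y|]) @ \oo --> 0.

Definition cvg_in_prob_pinfty (Y : nat -> Omega -> R) : Prop :=
  forall C : R, (fun k => Pr [set w | C < Y k w]) @ \oo --> (1 : R).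

Definition smean {dS : measure_display} {S : measurableType dS}
    (mu : R -> R) (f : (nat -> S) -> R -> R) (delta : int -> Omega -> S)
    (N : nat) (w : Omega) (t : R) : R :=
  N%:R^-1 * \sum_(1 <= i < N.+1) (mu t + bshift f delta i%:Z w t).

End probdefs.

(* Main.v *)
Require Import Defs.
From HB Require Import structures.
From mathcomp Require Import all_boot all_order all_algebra.
From mathcomp Require Import all_classical all_reals all_analysis.
From mathcomp Require Import measurable_realfun.
From mathcomp Require Import ring lra.

Set Implicit Arguments.
Unset Strict Implicit.
Unset Printing Implicit Defensive.

Import Order.TTheory GRing.Theory Num.Theory.
Import numFieldNormedType.Exports.
Local Open Scope classical_set_scope.
Local Open Scope ring_scope.

(** For stationary errors, [E <e_1 + ... + e_N, g>^2] is the sum over [n < N] of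
    the quadratic forms at [g] of the [n]-th partial sums of the series defining
    the long-run covariance [c].  Since these converge, [c] is symmetric and
    positive, and the averages [<ebar_N, g>] tend to 0 in L^2(P); the norms of
    [ebar_N] are merely bounded in probability, and that is enough.

    The estimated kernel need not be symmetric.  For the limit operator [D],
    positivity and compactness give a spectral gap: [D] has norm at most
    [lam_p] on the orthogonal complement of the first eigenfunctions (indices
    starting at 0).  A contraction argument then shows that every operator close
    to [D] has an eigenvalue near each of [lam_0 > ... > lam_(p-1)], and the
    maximality of the estimated eigenvalues forces them to be exactly these
    perturbed ones.  Eigenvectors follow up to sign, and the signs disappear in
    the squares of the scores. *)

(** * Semi-inner product spaces *)

(** Functions that agree almost everywhere are not identified: L^2 is a module of genuine functions
    with a positive semidefinite form, and equality of vectors becomes the vanishing of the seminorm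
    of a difference.

    Since the estimated operator [T] need not be symmetric, min-max principles and Weyl's inequality
    do not apply to it. Only [D] has a usable resolvent bound. It places each eigenvalue of [T] that
    exceeds [lam_p] by some margin near some [lam_j], but does not show that every [lam_j] is
    approached; the contraction supplies this. A counting argument combines the two: existence keeps
    the last of the [p] estimated eigenvalues from being too low, linearly independent eigenvectors
    cannot be attached to the same [lam_j], and an increasing self-map of [p] indices is the
    identity.

    On the probabilistic side, the difference [h] of the sample means is paired with random
    eigenvectors. Replacing these by the [phi_i] costs at most the norm of [h] times a distance that
    tends to 0, so convergence of [h] itself is required only against fixed vectors. *)

Record semi_inner (R : realType) (V : lmodType R) := SemiInner {
  sip :> V -> V -> R ;
  sipC : forall x y, sip x y = sip y x ;
  sipDl : forall x y z, sip (x + y) z = sip x z + sip y z ;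
  sipZl : forall a x y, sip (a *: x) y = a * sip x y ;
  sip_ge0 : forall x, 0 <= sip x x }.

Section SemiInner.
Context (R : realType) (V : lmodType R) (ip : semi_inner V).
Implicit Types (x y z : V) (a : R).

Definition nrm x : R := Num.sqrt (ip x x).

Lemma nrmE x : nrm x = Num.sqrt (ip x x). Proof. by []. Qed.

Lemma sipDr x y z : ip z (x + y) = ip z x + ip z y.
Proof. by rewrite sipC sipDl !(sipC _ z). Qed.

Lemma sipZr a x y : ip x (a *: y) = a * ip x y.
Proof. by rewrite sipC sipZl sipC. Qed.

Lemma sip0l x : ip 0 x = 0.
Proof. by rewrite -(scale0r 0) sipZl mul0r. Qed.

Lemma sipNl x y : ip (- x) y = - ip x y.
Proof. by rewrite -scaleN1r sipZl mulN1r. Qed.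

Lemma sipNr x y : ip x (- y) = - ip x y.
Proof. by rewrite sipC sipNl sipC. Qed.

Lemma sipBl x y z : ip (x - y) z = ip x z - ip y z.
Proof. by rewrite sipDl sipNl. Qed.

Lemma sipBr x y z : ip z (x - y) = ip z x - ip z y.
Proof. by rewrite sipDr sipNr. Qed.

Lemma sip_suml (I : Type) (r : seq I) (P : pred I) (F : I -> V) y :
  ip (\sum_(i <- r | P i) F i) y = \sum_(i <- r | P i) ip (F i) y.
Proof.
by apply: (big_morph (ip^~ y)) => [u v|]; [rewrite sipDl | rewrite sip0l].
Qed.

Lemma nrm_ge0 x : 0 <= nrm x. Proof. exact: sqrtr_ge0. Qed.

Lemma sqr_nrm x : nrm x ^+ 2 = ip x x.
Proof. by rewrite sqr_sqrtr// sip_ge0. Qed.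

Lemma sip_CS x y : ip x y ^+ 2 <= ip x x * ip y y.
Proof.
have key t : 0 <= ip x x + 2 * t * ip x y + t ^+ 2 * ip y y.
  have := sip_ge0 ip (x + t *: y).
  by rewrite sipDl !sipDr !sipZl !sipZr (sipC _ y x); nra.
have [y0|y0] := eqVneq (ip y y) 0.
  rewrite y0 mulr0; have [->|n0] := eqVneq (ip x y) 0; first by rewrite expr0n.
  (* For a null [y] the polynomial is affine in [t]; with a nonzero slope it would take the value -1
     at this point. *)
  have := key (- (ip x x + 1) / (2 * ip x y)).
  rewrite y0 mulr0 addr0.
  have -> : 2 * (- (ip x x + 1) / (2 * ip x y)) * ip x y = - (ip x x + 1).
    by field.
  lra.
have yp : 0 < ip y y by rewrite lt_def y0 sip_ge0.
have := key (- ip x y / ip y y).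
have -> : ip x x + 2 * (- ip x y / ip y y) * ip x y +
    (- ip x y / ip y y) ^+ 2 * ip y y = (ip x x * ip y y - ip x y ^+ 2) / ip y y.
  by field; exact: y0.
by rewrite pmulr_lge0 ?invr_gt0// subr_ge0.
Qed.

Lemma sip_le x y : `|ip x y| <= nrm x * nrm y.
Proof.
rewrite -(@ler_pXn2r _ 2)// ?nnegrE ?mulr_ge0 ?nrm_ge0//.
by rewrite exprMn !sqr_nrm real_normK ?num_real// sip_CS.
Qed.

Lemma nrmZ a x : nrm (a *: x) = `|a| * nrm x.
Proof. by rewrite /nrm sipZl sipZr mulrA -expr2 sqrtrM ?sqr_ge0// sqrtr_sqr. Qed.

Lemma nrmN x : nrm (- x) = nrm x.
Proof. by rewrite -scaleN1r nrmZ normrN1 mul1r. Qed.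

Lemma nrmBC x y : nrm (x - y) = nrm (y - x).
Proof. by rewrite -opprB nrmN. Qed.

Lemma nrm0 : nrm 0 = 0.
Proof. by rewrite /nrm sip0l sqrtr0. Qed.

Lemma nrmD x y : nrm (x + y) <= nrm x + nrm y.
Proof.
rewrite -(@ler_pXn2r _ 2)// ?nnegrE ?addr_ge0 ?nrm_ge0//.
rewrite sqr_nrm sipDl !sipDr (sipC _ y x) sqrrD !sqr_nrm.
have := sip_le x y; have := ler_norm (ip x y); lra.
Qed.

Lemma nrmB x y : nrm (x - y) <= nrm x + nrm y.
Proof. by rewrite -(nrmN y); exact: nrmD. Qed.

Lemma nrm_dist z x y : nrm (x - y) <= nrm (x - z) + nrm (z - y).
Proof. by apply: le_trans (nrmD _ _); rewrite addrA subrK. Qed.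

Lemma ler_nrmB x y : nrm x - nrm y <= nrm (x - y).
Proof. by rewrite lerBlDr; apply: le_trans (nrmD _ _); rewrite subrK. Qed.

Lemma nrm_sum (I : Type) (r : seq I) (P : pred I) (F : I -> V) :
  nrm (\sum_(i <- r | P i) F i) <= \sum_(i <- r | P i) nrm (F i).
Proof.
elim/big_rec2: _ => [|i a b _ h]; first by rewrite nrm0.
by apply: le_trans (nrmD _ _) _; rewrite lerD2l.
Qed.

Lemma nrm_eq0 x : (nrm x == 0) = (ip x x == 0).
Proof. by rewrite sqrtr_eq0 le_eqVlt ltNge sip_ge0 orbF. Qed.

Lemma nrm0_sip x y : nrm x = 0 -> ip x y = 0.
Proof.
move=> h; apply/eqP.
by rewrite -normr_le0 (le_trans (sip_le _ _))// h mul0r.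
Qed.

Lemma nrmB0_sip x y z : nrm (x - y) = 0 -> ip x z = ip y z.
Proof. by move/(@nrm0_sip _ z)/eqP; rewrite sipBl subr_eq0 => /eqP. Qed.

Lemma sip_ext_nrm0 x : (forall y, ip x y = 0) -> nrm x = 0.
Proof. by move=> h; apply/eqP; rewrite nrm_eq0 h. Qed.

Lemma nrmB0_nrm x y : nrm (x - y) = 0 -> nrm x = nrm y.
Proof.
move=> h; rewrite /nrm (nrmB0_sip _ h) sipC (nrmB0_sip _ h); by [].
Qed.

Definition sip_complete := forall u : nat -> V,
  (forall e : R, 0 < e -> exists N, forall m n, (N <= m)%N -> (N <= n)%N ->
     nrm (u m - u n) <= e) ->
  exists l, nrm (u n - l) @[n --> \oo] --> (0 : R).

(** Complete continuity, which for linear operators on a Hilbert space amounts to compactness. This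
    form follows from dominated convergence for a square integrable kernel and avoids extracting
    subsequences. *)
Definition compl_continuous (T : V -> V) := forall (u : nat -> V) (C : R),
  (forall n, nrm (u n) <= C) ->
  (forall g, ip (u n) g @[n --> \oo] --> (0 : R)) ->
  nrm (T (u n)) @[n --> \oo] --> (0 : R).

End SemiInner.

Lemma cvg0_le_cst (R : realType) (u : nat -> R) (a : R) :
  u n @[n --> \oo] --> (0 : R) -> (forall n, a <= u n) -> a <= 0.
Proof.
move=> ucv h; rewrite -(cvg_lim _ ucv)//; apply: limr_ge.
  by apply/cvg_ex; exists 0.
by near=> n.
Unshelve. all: by end_near. Qed.

(** * The top eigenvector of a compact positive operator *)

Section Contraction.
Context (R : realType) (V : lmodType R) (ip : semi_inner V).
Context (A : {linear V -> V}).
Context (Asym : forall x y, ip (A x) y = ip x (A y)).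
Context (A1 : forall x, nrm ip (A x) <= nrm ip x).
Local Notation nrm := (nrm ip).

Lemma iter_sym n x y : ip (iter n A x) y = ip x (iter n A y).
Proof. by elim: n x y => // n IH x y; rewrite iterS Asym IH -iterSr. Qed.

Lemma iter_nrm_le n x : nrm (iter n A x) <= nrm x.
Proof. by elim: n => // n IH; apply: le_trans IH; rewrite iterS. Qed.

(** Powers of [A] move across the product, so only the sum of the exponents matters; when it is
    even, the value is a squared norm. This is why even iterates are used below. *)
Lemma iter_sipE m n k v : (m + n = k + k)%N ->
  ip (iter m A v) (iter n A v) = nrm (iter k A v) ^+ 2.
Proof.
move=> e; rewrite sqr_nrm iter_sym -iterD e iterD.
by rewrite -iter_sym.
Qed.

(** By Cauchy-Schwarz the norms of the iterates are log-convex, so their successive ratios increase;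
    the first ratio is at least [nrm (A x)] because [nrm x <= 1]. *)
Lemma iter_nrm_logconvex n x : nrm x <= 1 ->
  nrm (A x) * nrm (iter n A x) <= nrm (iter n.+1 A x).
Proof.
move=> x1; elim: n => [|n IH] /=; first by rewrite ler_piMr// nrm_ge0.
set b := nrm (iter n A x) in IH *; set b1 := nrm (A (iter n A x)) in IH *.
have b0 : 0 <= b by exact: nrm_ge0.
have CS : b1 ^+ 2 <= b * nrm (A (A (iter n A x))).
  rewrite sqr_nrm Asym; apply: le_trans (ler_norm _) _; exact: sip_le.
have b10 : 0 <= b1 by exact: nrm_ge0.
have a0 : 0 <= nrm (A x) by exact: nrm_ge0.
have c0 := nrm_ge0 ip (A (A (iter n A x))).
have [bz|bz] := eqVneq b 0.
  have : b1 <= b by exact: A1.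
  rewrite bz => h; have b1z : b1 = 0 by lra.
  by rewrite b1z mulr0.
have bp : 0 < b by rewrite lt_def bz.
rewrite -(ler_pM2l bp); apply: le_trans CS; rewrite expr2 mulrA.
by apply: ler_wpM2r => //; rewrite mulrC.
Qed.

Lemma iter_nrm_ge n x : nrm x <= 1 -> nrm (A x) ^+ n.+1 <= nrm (iter n.+1 A x).
Proof.
move=> x1; elim: n => [|n IH]; first by rewrite expr1.
apply: le_trans (iter_nrm_logconvex n.+1 x1).
by rewrite exprS ler_wpM2l ?nrm_ge0.
Qed.

(** With [a k] the squared norm of the [k]-th iterate, the squared distance is
    [a (2m) + a (2n) - 2 a (m+n)], and [a] converges, being nonincreasing and nonnegative. *)
Lemma even_iter_cauchy v (e : R) : 0 < e -> exists N, forall m n,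
  (N <= m)%N -> (N <= n)%N ->
  nrm (iter m.*2 A v - iter n.*2 A v) <= e.
Proof.
move=> e0.
pose a k := nrm (iter k A v) ^+ 2.
have a_dec : {homo a : n m / (n <= m)%N >-> m <= n}.
  apply: homo_leq => [//|x y z h1 h2|n]; first exact: le_trans h1.
  by rewrite /a ler_pXn2r ?nnegrE ?nrm_ge0//= A1.
have alb : has_lbound (range a).
  by exists 0 => _ [k _ <-]; rewrite /a sqr_ge0.
have acv := nonincreasing_cvgn a_dec alb.
set l := inf _ in acv.
have la k : l <= a k by apply: ge_inf => //; exists k.
have e2 : 0 < e ^+ 2 / 2 by rewrite divr_gt0// exprn_gt0.
have /cvgrPdist_lt/(_ _ e2) [N _ HN] := acv.
exists N => m n Nm Nn.
rewrite -(@ler_pXn2r _ 2)// ?nnegrE ?nrm_ge0//; last lra.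
rewrite sqr_nrm sipBl !sipBr (sipC _ (iter n.*2 A v) (iter m.*2 A v)).
rewrite -!sqr_nrm -!/(a _) (@iter_sipE _ _ (m + n)%N); last first.
  by rewrite -doubleD -addnn.
rewrite -/(a _).
have N2 k : (N <= k)%N -> (N <= k.*2)%N.
  by move=> h; rewrite (leq_trans h)// -addnn leq_addr.
have := HN _ (N2 _ Nm); have := HN _ (N2 _ Nn).
rewrite /= !ltr_norml => /andP[h1 _] /andP[h2 _].
have := la (m + n)%N; have := la m.*2; have := la n.*2; move: h1 h2.
set x := e ^+ 2; lra.
Qed.

End Contraction.

Section TopEigenvector.
Context (R : realType) (V : lmodType R) (ip : semi_inner V).
Context (cplt : sip_complete ip) (B : {linear V -> V}).
Context (Bsym : forall x y, ip (B x) y = ip x (B y)).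
Context (Bpsd : forall x, 0 <= ip (B x) x).
Context (K : R) (Bbnd : forall x, nrm ip (B x) <= K * nrm ip x).
Context (Bcc : compl_continuous ip B).
Local Notation nrm := (nrm ip).

(* With [A] the multiple of [B] of norm 1, [A^(2n) v] converges to a vector
   fixed by [A^2], hence by [A].  If all these limits vanished, the vectors
   [A^(2n) u_n], where [u_n] nearly attains the norm of [A^(2n+1)], would be
   weakly null although their images under [B] stay away from 0. *)
Lemma top_eigenvector (c : R) : 0 <= c -> ~ (forall x, nrm (B x) <= c * nrm x) ->
  exists nu x, [/\ c < nu, nrm x = 1 & nrm (B x - nu *: x) = 0].
Proof.
move=> c0 nc.
pose E := [set nrm (B x) | x in [set x | nrm x <= 1]].
have E0 : E 0 by exists 0; rewrite /= ?linear0 ?nrm0.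
have K0 : 0 <= `|K| by [].
have Eub : has_ubound E.
  exists `|K| => _ [x x1 <-]; apply: le_trans (Bbnd x) _.
  have := ler_norm K; have := nrm_ge0 ip x; rewrite /= in x1; nra.
have hsE : has_sup E by split => //; exists 0.
pose nu := sup E.
have Ble x : nrm (B x) <= nu * nrm x.
  have [x0|x0] := eqVneq (nrm x) 0.
    by rewrite x0 mulr0; have := Bbnd x; rewrite x0 mulr0.
  have xp : 0 < nrm x by rewrite lt_def x0 nrm_ge0.
  have : nrm (B ((nrm x)^-1 *: x)) <= nu.
    apply: ub_le_sup => //; exists ((nrm x)^-1 *: x) => //=.
    by rewrite nrmZ ger0_norm ?invr_ge0 ?nrm_ge0// mulVf.
  rewrite linearZ/= nrmZ ger0_norm ?invr_ge0 ?nrm_ge0// mulrC.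
  by rewrite ler_pdivrMr.
have cnu : c < nu.
  rewrite ltNge; apply/negP => h; apply: nc => x; apply: le_trans (Ble x) _.
  by rewrite ler_wpM2r// nrm_ge0.
have nu0 : 0 < nu by lra.
pose A : {linear V -> V} := (nu^-1 \*: B)%R.
have AE x : A x = nu^-1 *: B x by [].
have Asym x y : ip (A x) y = ip x (A y) by rewrite !AE sipZl sipZr Bsym.
have A1 x : nrm (A x) <= nrm x.
  rewrite AE nrmZ ger0_norm ?invr_ge0 ?(ltW nu0)//.
  by rewrite mulrC ler_pdivrMr// mulrC.
have [[v [q [qcv q0]]]|hall] := pselect (exists v q,
   nrm (iter n.*2 A v - q) @[n --> \oo] --> (0 : R) /\ nrm q != 0).
  have AAq : nrm (A (A q) - q) = 0.
    apply/eqP; rewrite eq_le nrm_ge0 andbT.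
    have qcvS : nrm (iter n.+1.*2 A v - q) @[n --> \oo] --> (0 : R).
      by rewrite -(cvg_shiftS (fun n => nrm (iter n.*2 A v - q))) in qcv.
    apply: (@cvg0_le_cst _ (fun n => nrm (iter n.*2 A v - q) +
      nrm (iter n.+1.*2 A v - q))).
      by rewrite -[X in _ --> X](addr0 0); exact: cvgD.
    move=> n; apply: le_trans (nrm_dist _ (iter n.+1.*2 A v) _ _) _.
    rewrite lerD2r doubleS /= -!linearB/= (le_trans (A1 _))//.
    by rewrite (le_trans (A1 _))// nrmBC.
  (* Since [q] is fixed by the square of [A], the vector [y = A q - q] satisfies [A y = - y] up to a
     null vector; positivity of [A] then makes [y] null. *)
  have Aq : nrm (A q - q) = 0.
    apply/eqP; rewrite nrm_eq0; set y := A q - q.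
    have h : ip (A y) y + ip y y = 0.
      by rewrite -sipDl {1}/y linearB addrA subrK; exact: nrm0_sip.
    have : 0 <= ip (A y) y.
      by rewrite AE sipZl mulr_ge0// invr_ge0 ltW.
    have := sip_ge0 ip y => h1 h2; apply/eqP; lra.
  exists nu, ((nrm q)^-1 *: q); split => //.
    by rewrite nrmZ ger0_norm ?invr_ge0 ?nrm_ge0// mulVf.
  rewrite linearZ/= scalerA mulrC -scalerA -scalerBr nrmZ.
  have -> : B q - nu *: q = nu *: (A q - q).
    by rewrite scalerBr AE scalerA divff ?gt_eqF// scale1r.
  by rewrite nrmZ Aq !mulr0.
exfalso.
have lim0 v : nrm (iter n.*2 A v) @[n --> \oo] --> (0 : R).
  have [q qcv] := cplt (@even_iter_cauchy _ _ ip A Asym A1 v).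
  have q0 : nrm q = 0.
    by apply/eqP/negPn/negP => h; apply: hall; exists v, q.
  rewrite (_ : (fun n => _) = (fun n => nrm (iter n.*2 A v - q)))//.
  apply/funext => n; rewrite -(@nrmB0_nrm _ _ ip (iter n.*2 A v) (iter n.*2 A v - q))//.
  by rewrite opprB addrC subrK.
have unear n : exists u, nrm u <= 1 /\ 2^-1 <= nrm (iter n.*2.+1 A u).
  (* [r] is chosen so that Bernoulli's inequality gives [(1 - r) ^+ k >= 1 - k r = 1/2]. *)
  pose k := n.*2.+1; pose r : R := (2 * k%:R)^-1.
  have k0 : 0 < (k%:R : R) by rewrite ltr0n.
  have r0 : 0 < r by rewrite invr_gt0 mulr_gt0.
  have [|_ [u u1 <-] hu] := @sup_adherent _ E (nu * r) _ hsE.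
    by rewrite mulr_gt0.
  exists u; split => //.
  apply: le_trans (iter_nrm_ge Asym A1 n.*2 u1).
  have ru : 1 - r <= nrm (A u).
    rewrite AE nrmZ ger0_norm ?invr_ge0 ?(ltW nu0)// mulrC ler_pdivlMr//.
    by apply: ltW; rewrite mulrBl mul1r mulrC; rewrite mulrC [r * _]mulrC.
  have r1 : 0 <= 1 - r.
    rewrite subr_ge0 invf_le1 ?mulr_gt0//.
    have : (1 : R) <= k%:R by rewrite ler1n.
    lra.
  have bern m : 1 - m%:R * r <= (1 - r) ^+ m.
    elim: m => [|m IH]; first by rewrite mul0r subr0 expr0.
    rewrite exprS -natr1.
    have m0 : 0 <= m%:R * r by rewrite mulr_ge0// ltW.
    apply: le_trans (ler_wpM2l r1 IH); nra.
  have : (1 - r) ^+ k <= nrm (A u) ^+ k.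
    by rewrite lerXn2r ?nnegrE ?nrm_ge0.
  apply: le_trans; apply: le_trans (bern k).
  have -> : k%:R * r = 2^-1 by rewrite /r; field; rewrite gt_eqF.
  lra.
have /choice [u hu] := unear.
pose e n := iter n.*2 A (u n).
have e1 n : nrm (e n) <= 1.
  by apply: le_trans (iter_nrm_le A1 _ _) _; case: (hu n).
(* The iterate moves to the fixed vector [g], whose even iterates tend to 0 by [lim0], while the
   [u n] stay in the unit ball. *)
have ew g : ip (e n) g @[n --> \oo] --> (0 : R).
  apply/cvgr0Pnorm_lt => eps eps0.
  have /cvgr0Pnorm_lt/(_ _ eps0) := lim0 g.
  apply: filterS => n; rewrite ger0_norm ?nrm_ge0//; apply: le_lt_trans.
  rewrite /e (iter_sym Asym); apply: le_trans (sip_le _ _ _) _.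
  by rewrite ler_piMl ?nrm_ge0//; case: (hu n).
have := Bcc e1 ew => /cvgr0Pnorm_lt.
have nu2 : 0 < nu / 2 by lra.
move=> /(_ _ nu2) [N _ /(_ N (leqnn N))] /=.
rewrite ger0_norm ?nrm_ge0// ltNge => /negP; apply.
have [_] := hu N; rewrite iterS AE nrmZ ger0_norm ?invr_ge0 ?(ltW nu0)//.
by rewrite mulrC ler_pdivlMr// mulrC.
Qed.

End TopEigenvector.

(** * Spectral gap and lower bounds for the resolvent *)

Section OrthoProj.
Context (R : realType) (V : lmodType R) (ip : semi_inner V).
Context (p : nat) (phi : nat -> V).
Local Notation nrm := (nrm ip).

Definition proj x := \sum_(i < p) ip x (phi i) *: phi i.
Definition res x := x - proj x.

Lemma res_is_linear : linear res.
Proof.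
move=> a x y; rewrite /res scalerBr addrACA -opprD; congr (_ - _).
rewrite /proj scaler_sumr -big_split/=; apply: eq_bigr => i _.
by rewrite sipDl sipZl scalerDl scalerA.
Qed.
HB.instance Definition _ := GRing.isLinear.Build R V V *:%R res res_is_linear.

Lemma proj_res x : proj x + res x = x.
Proof. by rewrite /res addrC subrK. Qed.

Lemma sip_projl x y : ip (proj x) y = \sum_(i < p) ip x (phi i) * ip (phi i) y.
Proof. by rewrite sip_suml; apply: eq_bigr => i _; rewrite sipZl. Qed.

Lemma sip_resl x y :
  ip (res x) y = ip x y - \sum_(i < p) ip x (phi i) * ip (phi i) y.
Proof. by rewrite sipBl sip_projl. Qed.

Lemma res_sym x y : ip (res x) y = ip x (res y).
Proof.
rewrite sip_resl [RHS]sipC sip_resl sipC; congr (_ - _).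
by apply: eq_bigr => i _; rewrite mulrC sipC (sipC _ x).
Qed.

Context (on : forall i j, (i < p)%N -> (j < p)%N ->
  ip (phi i) (phi j) = (i == j)%:R).

Lemma nrm_phi i : (i < p)%N -> nrm (phi i) = 1.
Proof. by move=> ip0; rewrite nrmE on// eqxx sqrtr1. Qed.

Lemma sum_onE (c : nat -> R) j : (j < p)%N ->
  \sum_(i < p) c i * ip (phi i) (phi j) = c j.
Proof.
move=> jp; rewrite (bigD1 (Ordinal jp))//= on// eqxx mulr1 big1 ?addr0// => i ij.
rewrite on// (_ : (_ == _) = false) ?mulr0//.
by apply/negbTE; rewrite -val_eqE in ij.
Qed.

Lemma sip_res_phi x j : (j < p)%N -> ip (res x) (phi j) = 0.
Proof. by move=> jp; rewrite sip_resl (sum_onE (fun i => ip x (phi i)))// subrr. Qed.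

Lemma res_id w : (forall i, (i < p)%N -> ip w (phi i) = 0) -> res w = w.
Proof. by move=> h; rewrite /res /proj big1 ?subr0// => i _; rewrite h// scale0r. Qed.

Lemma res_res x : res (res x) = res x.
Proof. by apply: res_id => i; exact: sip_res_phi. Qed.

Lemma pythagoras x :
  ip x x = \sum_(i < p) ip x (phi i) ^+ 2 + ip (res x) (res x).
Proof.
rewrite res_sym res_res -res_sym sip_resl addrCA addrC.
rewrite (eq_bigr (fun i : 'I_p => ip x (phi i) * ip (phi i) x)) ?subrr ?add0r//.
by move=> i _; rewrite expr2 (sipC _ (phi i)).
Qed.

Lemma nrm_res x : nrm (res x) <= nrm x.
Proof.
rewrite ler_sqrt ?sip_ge0// [leRHS]pythagoras lerDr.
by apply: sumr_ge0 => i _; rewrite sqr_ge0.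
Qed.

Context (D : {linear V -> V}) (Dsym : forall x y, ip (D x) y = ip x (D y)).
Context (lam : nat -> R).
Context (Deig : forall i, (i < p)%N -> nrm (D (phi i) - lam i *: phi i) = 0).

Lemma sip_D_phil i y : (i < p)%N -> ip (D (phi i)) y = lam i * ip (phi i) y.
Proof. by move=> ip0; rewrite (nrmB0_sip _ (Deig ip0)) sipZl. Qed.

Lemma sip_D_phir i x : (i < p)%N -> ip (D x) (phi i) = lam i * ip x (phi i).
Proof. by move=> ip0; rewrite Dsym sipC sip_D_phil// sipC. Qed.

Lemma sip_D_res_phi x j : (j < p)%N -> ip (D (res x)) (phi j) = 0.
Proof. by move=> jp; rewrite sip_D_phir// sip_res_phi// mulr0. Qed.

Lemma sip_D_res_res x y : ip (D (res x)) (res y) = ip (D (res x)) y.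
Proof.
rewrite [LHS]sipC sip_resl sipC big1 ?subr0// => i _.
by rewrite [X in _ * X]sipC sip_D_res_phi// mulr0.
Qed.

(** The span of the eigenvectors [phi i] and its orthogonal complement are both stable under [D], so
    [D] and [res] commute up to null vectors and their product stays symmetric. *)
Lemma D_res_sym x y : ip (D (res x)) y = ip x (D (res y)).
Proof.
by rewrite -sip_D_res_res Dsym [LHS]sipC sip_D_res_res sipC.
Qed.

(** If [D \o res] violated the bound, it would have a unit eigenvector [x] with an eigenvalue
    [nu > lamp]. As [nu] is nonzero, [x] is orthogonal to the [phi i], hence an eigenvector of [D]
    itself. Maximality then puts [x] in the span of the [phi i], so [x] is null: a contradiction. *)
Lemma spectral_gap (K lamp : R) : sip_complete ip ->
  (forall x, 0 <= ip (D x) x) ->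
  (forall x, nrm (D x) <= K * nrm x) -> compl_continuous ip D -> 0 <= lamp ->
  (forall nu x, lamp < nu -> nrm x = 1 -> nrm (D x - nu *: x) = 0 ->
     exists c : nat -> R, nrm (x - \sum_(i < p) c i *: phi i) = 0) ->
  forall w, nrm (D (res w)) <= lamp * nrm w.
Proof.
move=> cplt psd Kb cc lamp0 maxi; apply: contrapT => nb.
pose DR : {linear V -> V} := (D \o res)%FUN.
have DRpsd x : 0 <= ip (DR x) x by rewrite /= -sip_D_res_res.
have DRcc : compl_continuous ip DR.
  move=> u C uC uw; apply: (cc (fun n => res (u n)) C).
    by move=> n; apply: le_trans (nrm_res _) _.
  move=> g; rewrite (_ : (fun n => _) = (fun n => ip (u n) (res g)))//.
  by apply/funext => n; rewrite res_sym.
have DRb x : nrm (DR x) <= `|K| * nrm x.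
  apply: le_trans (Kb _) _; apply: (@le_trans _ _ (`|K| * nrm (res x))).
    by rewrite ler_wpM2r ?nrm_ge0// ler_norm.
  by rewrite ler_wpM2l// nrm_res.
have [nu [x [lnu x1 xe]]] := top_eigenvector cplt (B := DR) D_res_sym DRpsd DRb
  DRcc lamp0 nb.
have nu0 : nu != 0 by rewrite gt_eqF//; apply: le_lt_trans lnu.
have xphi j : (j < p)%N -> ip x (phi j) = 0.
  move=> jp; have := nrmB0_sip (phi j) xe; rewrite /= sip_D_res_phi// sipZl.
  by move/esym/eqP; rewrite mulf_eq0 (negbTE nu0) => /eqP.
have rx : res x = x by exact: res_id.
rewrite /= rx in xe; have [c hc] := maxi nu x lnu x1 xe.
have : ip x x = 0.
  rewrite (nrmB0_sip _ hc) sip_suml big1// => i _.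
  by rewrite sipZl sipC xphi// mulr0.
move/eqP; rewrite -(nrm_eq0 ip) x1; exact/negP/oner_neq0.
Qed.

Context (lamp : R) (gap : forall w, nrm (D (res w)) <= lamp * nrm w).

Lemma gap_res w : nrm (D (res w)) <= lamp * nrm (res w).
Proof. by rewrite -{1}res_res. Qed.

(** Pythagoras splits the estimate: along [phi i] the operator acts as [lam i - mu], and on the
    complement the form of [D] is bounded by [lamp]. The alternative [ip v (phi i) = 0] allows [mu]
    to be close to an eigenvalue as long as [v] has no component there. *)
Lemma resolvent_lb (mu delta : R) v : 0 <= delta -> delta <= mu - lamp ->
  (forall i, (i < p)%N -> delta <= `|lam i - mu| \/ ip v (phi i) = 0) ->
  delta * nrm v <= nrm (D v - mu *: v).
Proof.
move=> d0 dmu di; set G := D v - mu *: v.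
rewrite -(@ler_pXn2r _ 2)// ?nnegrE ?mulr_ge0 ?nrm_ge0//.
rewrite exprMn !sqr_nrm !(pythagoras v) (pythagoras G) mulrDr lerD//.
  rewrite mulr_sumr; apply: ler_sum => i _.
  rewrite /G sipBl sip_D_phir// sipZl -mulrBl exprMn.
  have [h|->] := di i (ltn_ord i); last by rewrite expr0n !mulr0.
  rewrite ler_wpM2r ?sqr_ge0//.
  by rewrite -[leRHS]real_normK ?num_real// lerXn2r// ?nnegrE.
rewrite -!sqr_nrm -exprMn lerXn2r ?nnegrE ?mulr_ge0 ?nrm_ge0//.
have [r0|r0] := eqVneq (nrm (res v)) 0; first by rewrite r0 mulr0 nrm_ge0.
have rp : 0 < nrm (res v) by rewrite lt_def r0 nrm_ge0.
rewrite -(ler_pM2r rp) -mulrA -expr2.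
(* On the complement it suffices to test [res G] against [res v]: the form of [mu - D] is at least
   [mu - lamp] there. *)
have h1 : - ip (res G) (res v) <= nrm (res G) * nrm (res v).
  by apply: le_trans (sip_le _ _ _); rewrite -normrN ler_norm.
have h2 : ip (res G) (res v) = ip (D (res v)) (res v) - mu * ip (res v) (res v).
  have e1 : ip (res v) (res v) = ip v (res v) by rewrite res_sym res_res.
  rewrite [in LHS]res_sym res_res /G sipBl sipZl -e1; congr (_ - _).
  by rewrite Dsym -D_res_sym sip_D_res_res.
have h3 : ip (D (res v)) (res v) <= lamp * nrm (res v) ^+ 2.
  apply: le_trans (ler_norm _) _; apply: le_trans (sip_le _ _ _) _.
  by rewrite expr2 mulrA ler_wpM2r ?nrm_ge0// gap_res.
apply: le_trans h1; rewrite h2 -sqr_nrm.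
have : delta * nrm (res v) ^+ 2 <= (mu - lamp) * nrm (res v) ^+ 2.
  by rewrite ler_wpM2r ?sqr_ge0.
lra.
Qed.

End OrthoProj.

(** * Eigenvalues of a perturbed operator *)

Section FixedPoint.
Context (R : realType) (V : lmodType R) (ip : semi_inner V).
Local Notation nrm := (nrm ip).

Lemma banach_fixpoint (Phi : V -> V) (r q : R) : sip_complete ip ->
  0 <= q -> q < 1 -> 0 <= r ->
  (forall z, nrm z <= r -> nrm (Phi z) <= r) ->
  (forall z z', nrm z <= r -> nrm z' <= r ->
     nrm (Phi z - Phi z') <= q * nrm (z - z')) ->
  exists z, nrm z <= r /\ nrm (Phi z - z) = 0.
Proof.
move=> cplt q0 q1 r0 ball contr; pose u n := iter n Phi 0.
have ur n : nrm (u n) <= r.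
  by elim: n => [|n IH]; [rewrite /u /= nrm0 | exact: ball].
have step n k : nrm (u (n + k)%N - u n) <= q ^+ n * r.
  elim: n => [|n IH]; first by rewrite expr0 mul1r add0n [u 0%N]/= subr0.
  rewrite addSn exprS -mulrA; apply: le_trans (contr _ _ (ur _) (ur _)) _.
  exact: ler_wpM2l.
have qcv : (q ^+ n * r) @[n --> \oo] --> (0 : R).
  rewrite -[X in _ --> X](mul0r r); apply: cvgMr_tmp.
  by apply: cvg_expr; rewrite ger0_norm.
have [e e0|z zcv] := cplt u.
  have /cvgr0Pnorm_lt/(_ _ e0) [N _ HN] := qcv.
  exists N => m n; wlog nm : m n / (n <= m)%N => [H Nm Nn|Nm Nn].
    by have [h|/ltnW h] := leqP n m; [|rewrite nrmBC]; exact: H.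
  rewrite -(subnKC nm); apply: le_trans (step _ _) _.
  by apply: ltW; apply: le_lt_trans (HN n Nn); exact: ler_norm.
exists z; have zr : nrm z <= r.
  rewrite -subr_le0; apply: (cvg0_le_cst zcv) => n.
  by have := ur n; have := ler_nrmB ip z (u n); rewrite nrmBC; lra.
split => //; apply/eqP; rewrite eq_le nrm_ge0 andbT.
apply: (@cvg0_le_cst _ (fun n => q * nrm (u n - z) + nrm (u n.+1 - z))).
  rewrite -[X in _ --> X](addr0 0); apply: cvgD.
    by rewrite -[X in _ --> X](mulr0 q); apply: cvgMl_tmp.
  by rewrite (cvg_shiftS (fun n => nrm (u n - z))).
move=> n; apply: le_trans (nrm_dist _ (u n.+1) _ _) _.
by rewrite lerD2r (nrmBC _ (u n)) contr.
Qed.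

End FixedPoint.

Section Existence.
Context (R : realType) (V : lmodType R) (ip : semi_inner V).
Context (cplt : sip_complete ip) (p : nat) (phi : nat -> V).
Local Notation nrm := (nrm ip).
Local Notation res := (res ip p phi).
Context (on : forall i j, (i < p)%N -> (j < p)%N ->
  ip (phi i) (phi j) = (i == j)%:R).
Context (D : {linear V -> V}) (Dsym : forall x y, ip (D x) y = ip x (D y)).
Context (lam : nat -> R).
Context (Deig : forall i, (i < p)%N -> nrm (D (phi i) - lam i *: phi i) = 0).
Context (lamp : R) (gapD : forall w, nrm (D (res w)) <= lamp * nrm w).
Context (lamp0 : 0 <= lamp) (g : R) (g0 : 0 < g).
Context (gap_lamp : forall i, (i < p)%N -> g <= lam i - lamp).
Context (gap_lam : forall i j, (i < p)%N -> (j < p)%N -> i != j ->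
  g <= `|lam i - lam j|).

Section AtIndex.
Context (j : nat) (jp : (j < p)%N).

Let lamj0 : 0 < lam j.
Proof. by have := gap_lamp jp; have := g0; have := lamp0; lra. Qed.

(** The value 0 at [j] replaces the infinite coefficient and keeps the correction [z] below
    orthogonal to [phi j]. *)
Definition rcoef i : R := if i == j then 0 else (lam j - lam i)^-1.

(* The reduced resolvent of [D] at [lam j], except that on the orthogonal
   complement of the [phi i] the operator [D] is replaced by 0. *)
Definition rresolvent y :=
  \sum_(i < p) (rcoef i * ip y (phi i)) *: phi i + (lam j)^-1 *: res y.

Lemma rresolventB y y' : rresolvent (y - y') = rresolvent y - rresolvent y'.
Proof.
rewrite /rresolvent opprD addrACA -sumrB -scalerBr -linearB; congr (_ + _).
by apply: eq_bigr => i _; rewrite sipBl mulrBr scalerBl.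
Qed.

Lemma rcoef_le i : (i < p)%N -> `|rcoef i| <= g^-1.
Proof.
move=> ip0; rewrite /rcoef; have [_|ij] := eqVneq i j.
  by rewrite normr0 invr_ge0 ltW.
rewrite normfV lef_pV2 ?posrE//; first by rewrite gap_lam// eq_sym.
by apply: lt_le_trans (gap_lam jp ip0 _) => //; rewrite eq_sym.
Qed.

(** Triangle inequality over [p + 1] terms: the [p] coefficients and the factor [(lam j)^-1] are all
    at most [g^-1], the latter because [lamp >= 0]. *)
Lemma nrm_rresolvent y : nrm (rresolvent y) <= p.+1%:R / g * nrm y.
Proof.
have lj : (lam j)^-1 <= g^-1.
  by rewrite lef_pV2 ?posrE//; have := gap_lamp jp; have := lamp0; lra.
apply: le_trans (nrmD _ _ _) _; rewrite -natr1 !mulrDl mul1r lerD//.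
  apply: le_trans (nrm_sum _ _ _ _) _.
  apply: (@le_trans _ _ (\sum_(i < p) g^-1 * nrm y)).
    apply: ler_sum => i _; rewrite nrmZ (nrm_phi on)// mulr1 normrM.
    apply: ler_pM => //; first exact: rcoef_le.
    by apply: le_trans (sip_le _ _ _) _; rewrite (nrm_phi on)// mulr1.
  by rewrite sumr_const card_ord -[(_ * _) *+ p]mulr_natl mulrA.
rewrite nrmZ ger0_norm ?invr_ge0 ?(ltW lamj0)//.
by apply: ler_pM => //; rewrite ?nrm_ge0 ?(nrm_res on)// invr_ge0 ltW.
Qed.

Lemma sip_rresolvent_phi y i : (i < p)%N ->
  ip (rresolvent y) (phi i) = rcoef i * ip y (phi i).
Proof.
move=> ip0; rewrite /rresolvent sipDl sipZl (sip_res_phi on)// mulr0 addr0.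
rewrite sip_suml -[RHS](sum_onE on (fun i => rcoef i * ip y (phi i)))//.
by apply: eq_bigr => k _; rewrite sipZl.
Qed.

Lemma sip_rresolvent_res y x :
  ip (rresolvent y) (res x) = (lam j)^-1 * ip (res y) x.
Proof.
rewrite /rresolvent sipDl sipZl sip_suml big1 ?add0r.
  by rewrite -(res_sym ip p phi (res y)) (res_res on).
by move=> i _; rewrite sipZl [X in _ * X]sipC (sip_res_phi on)// mulr0.
Qed.

Context (E : {linear V -> V}) (e : R) (e0 : 0 <= e).
Context (Ee : forall x, nrm (E x) <= e * nrm x).

(** An eigenvector of [D + E] is sought as [x = phi j + z] with [z] orthogonal to [phi j], which
    forces the eigenvalue [lam j + ip (E x) (phi j)]. The equation becomes [lam j *: z - D z = Y z]
    off [phi j]. It is inverted explicitly along the [phi i]. On the complement it reads [res z =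
    (lam j)^-1 *: (D (res z) + res (Y z))], where the term in [D] stays inside the fixed point map
    because it already contracts by [lamp / lam j]. *)
Let Y z := E (phi j + z) - ip (E (phi j + z)) (phi j) *: z.
Let Phi z := (lam j)^-1 *: D (res z) + rresolvent (Y z).

Lemma fixpoint_eigenvector z : nrm (Phi z - z) = 0 ->
  let x := phi j + z in
  let mu := lam j + ip (E x) (phi j) in
  [/\ nrm (D x + E x - mu *: x) = 0 & ip x (phi j) = 1].
Proof.
move=> fz x mu.
have lj : lam j != 0 by rewrite gt_eqF.
have zphi i : (i < p)%N -> ip z (phi i) = rcoef i * ip (Y z) (phi i).
  move=> ip0; rewrite -(nrmB0_sip _ fz) sipDl sipZl (sip_D_res_phi on Dsym Deig)//.
  by rewrite mulr0 add0r sip_rresolvent_phi.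
have zj : ip z (phi j) = 0 by rewrite zphi// /rcoef eqxx mul0r.
have zres y : lam j * ip (res z) y = ip (D (res z)) y + ip (res (Y z)) y.
  rewrite res_sym -(nrmB0_sip _ fz) sipDl sipZl sip_rresolvent_res.
  by rewrite (sip_D_res_res on Dsym Deig) -mulrDr mulrA divff// mul1r.
(* The coordinates of [z] at [i <> j] cancel the factors [lam j - lam i]. At [j] the vector [z] has
   no coordinate, so the [phi j] component of [Y z] is left over; it is absorbed by the shift of the
   eigenvalue. *)
have Dz y : ip (D z) y = lam j * ip z y - ip (Y z) y +
    ip (Y z) (phi j) * ip (phi j) y.
  have zE : z = proj ip p phi z + res z by rewrite proj_res.
  have -> : ip (D z) y = \sum_(i < p) ip z (phi i) * (lam i * ip (phi i) y) +
      ip (D (res z)) y.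
    rewrite {1}zE linearD sipDl; congr (_ + _).
    rewrite /proj linear_sum sip_suml; apply: eq_bigr => i _.
    by rewrite linearZ sipZl (sip_D_phil Deig).
  have -> : ip (D (res z)) y = lam j * ip (res z) y - ip (res (Y z)) y.
    by rewrite zres addrK.
  rewrite !sip_resl mulrBr.
  suff : \sum_(i < p) ip z (phi i) * (lam i * ip (phi i) y) -
    lam j * (\sum_(i < p) ip z (phi i) * ip (phi i) y) +
    \sum_(i < p) ip (Y z) (phi i) * ip (phi i) y = ip (Y z) (phi j) * ip (phi j) y.
    by move=> h; lra.
  rewrite mulr_sumr -sumrB -big_split/= (bigD1 (Ordinal jp))//= zj.
  rewrite big1 ?addr0 ?mul0r ?mulr0 ?subr0 ?add0r// => i ij.
  have ne : (i : nat) != j by rewrite -val_eqE in ij.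
  have nz : lam j - lam i != 0.
    rewrite -normr_gt0; apply: lt_le_trans (gap_lam jp (ltn_ord i) _) => //.
    by rewrite eq_sym.
  by rewrite zphi// /rcoef (negbTE ne); field.
have Yj : ip (Y z) (phi j) = ip (E x) (phi j).
  by rewrite /Y sipBl sipZl zj mulr0 subr0.
split; last by rewrite /x sipDl zj addr0 on// eqxx.
apply: sip_ext_nrm0 => y; rewrite sipBl sipDl sipZl {1}/x linearD sipDl Dz Yj.
by rewrite (sip_D_phil Deig)// /Y sipBl sipZl -/x /mu /x !sipDl; ring.
Qed.

(** With [C = (p + 1) / g], the map has Lipschitz constant [q0 + 4 e C] on the ball: [q0] from [D],
    and [4 e] from [Y] times the bound of [rresolvent]. The factor 8 leaves room to make this
    constant smaller than 1 even for [r = 1]. *)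
Lemma perturbed_fixpoint (q0 : R) : lamp / lam j <= q0 -> q0 < 1 ->
  forall r, 0 <= r -> r <= 1 -> 8 * e * (p.+1%:R / g) <= (1 - q0) * r ->
  exists z, nrm z <= r /\ nrm (Phi z - z) = 0.
Proof.
move=> lq q1 r r0 r1 small.
set C := p.+1%:R / g in small.
have C0 : 0 <= C by rewrite divr_ge0// ltW.
have q00 : 0 <= q0 by apply: le_trans lq; rewrite divr_ge0// ltW.
have eC : 0 <= e * C by rewrite mulr_ge0.
have Dq z : nrm ((lam j)^-1 *: D (res z)) <= q0 * nrm z.
  rewrite nrmZ ger0_norm ?invr_ge0 ?(ltW lamj0)//.
  apply: (@le_trans _ _ ((lam j)^-1 * (lamp * nrm z))).
    by rewrite ler_wpM2l// invr_ge0 ltW.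
  by rewrite mulrA ler_wpM2r ?nrm_ge0// mulrC.
have E2 z : nrm z <= 1 -> nrm (E (phi j + z)) <= 2 * e.
  move=> z1; apply: le_trans (Ee _) _; rewrite mulrC ler_wpM2r//.
  apply: le_trans (nrmD _ _ _) _; rewrite (nrm_phi on)//; lra.
have Ej x : `|ip (E x) (phi j)| <= nrm (E x).
  by apply: le_trans (sip_le _ _ _) _; rewrite (nrm_phi on)// mulr1.
have Y4 z : nrm z <= 1 -> nrm (Y z) <= 4 * e.
  move=> z1; apply: le_trans (nrmB _ _ _) _; rewrite nrmZ.
  have := E2 z z1; have := Ej (phi j + z); have := nrm_ge0 ip z.
  have := normr_ge0 (ip (E (phi j + z)) (phi j)); nra.
(* In the expansion below the three terms contribute [e], [2 e] and [e], using
   [nrm (phi j + z) <= 2] and [nrm z' <= 1]. *)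
have YL z z' : nrm z <= 1 -> nrm z' <= 1 ->
    nrm (Y z - Y z') <= 4 * e * nrm (z - z').
  move=> z1 z'1.
  have -> : Y z - Y z' = E (z - z') - (ip (E (phi j + z)) (phi j) *: (z - z') +
      ip (E (z - z')) (phi j) *: z').
    have EB : E (z - z') = E (phi j + z) - E (phi j + z').
      by rewrite -linearB opprD addrACA subrr add0r.
    rewrite EB sipBl scalerBr scalerBl addrA subrK /Y.
    by rewrite !opprD !opprK addrACA.
  apply: le_trans (nrmB _ _ _) _.
  have := nrmD ip (ip (E (phi j + z)) (phi j) *: (z - z'))
     (ip (E (z - z')) (phi j) *: z').
  rewrite !nrmZ.
  have := Ee (z - z'); have := E2 z z1; have := Ej (phi j + z); have := Ej (z - z').
  have := nrm_ge0 ip z'; have := nrm_ge0 ip (z - z').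
  have := normr_ge0 (ip (E (z - z')) (phi j)).
  have := normr_ge0 (ip (E (phi j + z)) (phi j)).
  set a := `|ip (E (phi j + z)) _|; set b := `|ip (E (z - z')) _|.
  set zz := nrm (z - z'); move=> a0 b0 zz0 z'0 h1 h2 h3 h4 h5.
  have : a * zz <= 2 * e * zz by rewrite ler_wpM2r//; lra.
  have : b * nrm z' <= e * zz.
    apply: le_trans (_ : b * 1 <= _); first by rewrite ler_wpM2l.
    by rewrite mulr1; lra.
  lra.
apply: (@banach_fixpoint _ _ ip Phi r (q0 + 4 * e * C)) => //.
- lra.
- have : (1 - q0) * r <= (1 - q0) by rewrite ler_piMr//; lra.
  move: small; rewrite -!mulrA; lra.
- move=> z zr; apply: le_trans (nrmD _ _ _) _.
  have zq : q0 * nrm z <= q0 * r by rewrite ler_wpM2l.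
  have h := nrm_rresolvent (Y z); rewrite -/C in h.
  have : C * nrm (Y z) <= 4 * (e * C).
    by rewrite mulrA mulrC ler_wpM2r// Y4//; lra.
  have := Dq z; move: small; rewrite -mulrA; lra.
- move=> z z' zr z'r.
  have -> : Phi z - Phi z' = (lam j)^-1 *: D (res (z - z')) +
      rresolvent (Y z - Y z').
    have resB : res (z - z') = res z - res z' by exact: linearB.
    by rewrite rresolventB resB (linearB D) scalerBr /Phi opprD addrACA.
  apply: le_trans (nrmD _ _ _) _; rewrite mulrDl lerD//.
  apply: le_trans (nrm_rresolvent _) _; rewrite -/C.
  apply: (@le_trans _ _ (C * (4 * e * nrm (z - z')))).
    by rewrite ler_wpM2l// YL//; lra.
  by rewrite le_eqVlt; apply/orP; left; apply/eqP; ring.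
Qed.

End AtIndex.

Context (L : R) (lamL : forall i, (i < p)%N -> lam i <= L).

Lemma perturbed_eigenvalue j (e : R) (T : {linear V -> V}) : (j < p)%N ->
  0 <= e -> 8 * e * (p.+1%:R / g) <= g / L ->
  (forall x, nrm (T x - D x) <= e * nrm x) ->
  exists mu x, [/\ nrm x = 1, nrm (T x - mu *: x) = 0 & `|mu - lam j| <= 2 * e].
Proof.
move=> jp e0 small TD.
pose E : {linear V -> V} := (T \- D)%R.
have Ee x : nrm (E x) <= e * nrm x by exact: TD.
have lj0 : 0 < lam j by have := gap_lamp jp; have := g0; have := lamp0; lra.
have L0 : 0 < L by apply: lt_le_trans lj0 _; exact: lamL.
have gL : 0 < g / L by rewrite divr_gt0.
(* From [lamp <= lam j - g] and [lam j <= L], the ratio [lamp / lam j] is at most [1 - g / L].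
   Radius 1 gives [nrm x <= 2], hence the bound [2 * e] on the shift of the eigenvalue. *)
have [|||||z [z1 fz]] := @perturbed_fixpoint j jp E e e0 Ee (1 - g / L) _ _ 1.
- rewrite ler_pdivrMr//.
  have : g / L * lam j <= g by rewrite mulrAC ler_pdivrMr// ler_pM2l// lamL.
  have := gap_lamp jp; lra.
- lra.
- lra.
- lra.
- lra.
have [ev xj] := fixpoint_eigenvector jp fz.
set x := phi j + z in ev xj *; set mu := lam j + _ in ev.
have x2 : nrm x <= 2.
  by apply: le_trans (nrmD _ _ _) _; rewrite (nrm_phi on)//; lra.
have x0 : nrm x != 0.
  by apply/eqP => /(nrm0_sip (phi j)); rewrite xj => /eqP; rewrite oner_eq0.
exists mu, ((nrm x)^-1 *: x); split.
- by rewrite nrmZ ger0_norm ?invr_ge0 ?nrm_ge0// mulVf.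
- rewrite linearZ/= scalerA mulrC -scalerA -scalerBr nrmZ.
  have -> : T x = D x + E x by rewrite /= addrC subrK.
  by rewrite ev mulr0.
- rewrite /mu addrC addKr; apply: le_trans (sip_le _ _ _) _.
  rewrite (nrm_phi on)// mulr1; apply: le_trans (Ee _) _.
  by rewrite mulrC ler_wpM2r.
Qed.

End Existence.

(** * Stability of the leading eigenpairs *)

(** Used to match estimated and limit eigenvalues index by index. Strict growth gives [k <= h k]
    from below, and from above [h i + (p - 1 - i) <= h (p - 1) <= p - 1]. *)
Lemma incr_endo_id (p : nat) (h : nat -> nat) :
  (forall i, (i < p)%N -> (h i < p)%N) ->
  (forall i j, (i < j)%N -> (j < p)%N -> (h i < h j)%N) ->
  forall i, (i < p)%N -> h i = i.
Proof.
move=> hp hinc i ip.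
have lb k : (k < p)%N -> (k <= h k)%N.
  elim: k => // k IH kp.
  by apply: leq_ltn_trans (IH (ltnW kp)) _; exact: hinc.
have ub k : (i + k < p)%N -> (h i + k <= h (i + k))%N.
  elim: k => [|k IH]; first by rewrite !addn0.
  rewrite !addnS => kp; apply: leq_ltn_trans (IH (ltnW kp)) _.
  exact: hinc.
apply/eqP; rewrite eqn_leq lb// andbT.
have e : (i + (p.-1 - i))%N = p.-1.
  by rewrite subnKC// -ltnS prednK// (leq_ltn_trans _ ip).
have p1 : (p.-1 < p)%N by rewrite prednK// (leq_ltn_trans _ ip).
have := ub (p.-1 - i)%N; rewrite e => /(_ p1) H.
have : (h i + (p.-1 - i) <= i + (p.-1 - i))%N.
  by apply: leq_trans H _; rewrite e -ltnS (ltn_predK ip); exact: hp.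
by rewrite leq_add2r.
Qed.

Section Leading.
Context (R : realType) (V : lmodType R) (ip : semi_inner V).
Context (cplt : sip_complete ip) (p : nat) (phi : nat -> V).
Local Notation nrm := (nrm ip).
Local Notation res := (res ip p phi).
Context (on : forall i j, (i < p)%N -> (j < p)%N ->
  ip (phi i) (phi j) = (i == j)%:R).
Context (D : {linear V -> V}) (Dsym : forall x y, ip (D x) y = ip x (D y)).
Context (lam : nat -> R).
Context (Deig : forall i, (i < p)%N -> nrm (D (phi i) - lam i *: phi i) = 0).
Context (lamp : R) (gapD : forall w, nrm (D (res w)) <= lamp * nrm w).
Context (lamp0 : 0 <= lamp) (g : R) (g0 : 0 < g).
Context (gap_lamp : forall i, (i < p)%N -> g <= lam i - lamp).
Context (gap_dec : forall i j, (i < j)%N -> (j < p)%N -> g <= lam i - lam j).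

Let gap_lam i j : (i < p)%N -> (j < p)%N -> i != j -> g <= `|lam i - lam j|.
Proof.
move=> ip0 jp; rewrite neq_ltn => /orP[ij|ji].
  by apply: le_trans (ler_norm _); exact: gap_dec.
by rewrite distrC; apply: le_trans (ler_norm _); exact: gap_dec.
Qed.

Section Perturbed.
Context (T : {linear V -> V}) (e delta : R) (lh : nat -> R) (u : nat -> V).
Context (e0 : 0 <= e) (ed : e < delta) (dg : 16 * delta <= g).
Context (TD : forall x, nrm (T x - D x) <= e * nrm x).

Lemma approx_eigenvector (mu : R) x : nrm x = 1 -> nrm (T x - mu *: x) = 0 ->
  nrm (D x - mu *: x) <= e.
Proof.
move=> x1 ex; apply: le_trans (nrm_dist _ (T x) _ _) _.
by rewrite ex addr0 nrmBC (le_trans (TD _))// x1 mulr1.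
Qed.

(** Otherwise [D - mu] would be bounded below by [delta], whereas [x] is an approximate eigenvector
    of [D] with error [e < delta]. *)
Lemma eigenvalue_near (mu : R) x : nrm x = 1 -> nrm (T x - mu *: x) = 0 ->
  delta <= mu - lamp -> exists2 j, (j < p)%N & `|lam j - mu| < delta.
Proof.
move=> x1 ex dmu; apply: contrapT => H.
have : delta * nrm x <= nrm (D x - mu *: x).
  apply: (resolvent_lb on Dsym Deig gapD) => //.
    have := ed; have := e0; lra.
  move=> i ip0; left; rewrite leNgt; apply/negP => h; apply: H.
  by exists i.
have := approx_eigenvector x1 ex; rewrite x1 mulr1 => h1 h2.
have := le_trans h2 h1; have := ed; lra.
Qed.

Lemma gap_other (mu : R) j i : (j < p)%N -> `|lam j - mu| < delta -> (i < p)%N ->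
  i != j -> g / 2 <= `|lam i - mu|.
Proof.
move=> jp near ip0 ij; have := gap_lam ip0 jp ij.
have := ler_distD mu (lam i) (lam j); rewrite (distrC mu).
have := dg; have := e0; have := ed; lra.
Qed.

Lemma gap_other_lamp (mu : R) j : (j < p)%N -> `|lam j - mu| < delta ->
  g / 2 <= mu - lamp.
Proof.
move=> jp near; have := gap_lamp jp; have := ler_norm (lam j - mu).
have := dg; have := e0; have := ed; lra.
Qed.

(** Removing the [phi j] component from [x] removes the small denominator [lam j - mu], so the
    resolvent bound holds with the constant [g / 2]. The image of the remainder has norm at most
    [e + delta <= 2 delta]. *)
Lemma eigenvector_near (mu : R) x j : nrm x = 1 -> nrm (T x - mu *: x) = 0 ->
  (j < p)%N -> `|lam j - mu| < delta ->
  nrm (x - ip x (phi j) *: phi j) <= 4 * delta / g.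
Proof.
move=> x1 ex jp near; set c := ip x (phi j); set w := x - c *: phi j.
have c1 : `|c| <= 1.
  by apply: le_trans (sip_le _ _ _) _; rewrite x1 (nrm_phi on)// mulr1.
have : g / 2 * nrm w <= nrm (D w - mu *: w).
  apply: (resolvent_lb on Dsym Deig gapD).
  - have := g0; lra.
  - exact: gap_other_lamp near.
  - move=> i ip0; have [->|ij] := eqVneq i j.
      by right; rewrite /w sipBl sipZl on// eqxx mulr1 subrr.
    by left; exact: gap_other near _ _.
have -> : D w - mu *: w = (D x - mu *: x) - c *: (D (phi j) - mu *: phi j).
  rewrite /w linearB linearZ /= !scalerBr !scalerA (mulrC c) !opprB.
  by rewrite addrACA [RHS]addrACA; congr (_ + _); rewrite addrC.
have Dj : nrm (D (phi j) - mu *: phi j) <= delta.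
  have -> : D (phi j) - mu *: phi j =
      (D (phi j) - lam j *: phi j) + (lam j - mu) *: phi j.
    by rewrite scalerBl addrA subrK.
  apply: le_trans (nrmD _ _ _) _.
  by rewrite Deig// nrmZ (nrm_phi on)// mulr1 add0r ltW.
move=> h; have := nrmB ip (D x - mu *: x) (c *: (D (phi j) - mu *: phi j)).
rewrite nrmZ => h2.
have h3 : `|c| * nrm (D (phi j) - mu *: phi j) <= delta.
  apply: le_trans Dj; rewrite ler_piMl//; exact: nrm_ge0.
have h4 := approx_eigenvector x1 ex.
rewrite ler_pdivlMr//; have := ed; lra.
Qed.

(** Eigenvectors of the nonsymmetric [T] need not be orthogonal, so simplicity is proved by hand.
    The combination [v = x' - a *: x] without [phi j] component satisfies [T v = mu' v + k x].
    Testing against [phi j] bounds [k] by [2 e nrm v], because the coordinate [c] of [x] is at least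
    1/2 in absolute value. Hence [v] is an eigenvector of [D] up to [3 e nrm v], too small for the
    resolvent bound unless [v] is null. *)
Lemma near_eigenvectors_dep (mu mu' : R) x x' j :
  nrm x = 1 -> nrm (T x - mu *: x) = 0 ->
  nrm x' = 1 -> nrm (T x' - mu' *: x') = 0 ->
  (j < p)%N -> `|lam j - mu| < delta -> `|lam j - mu'| < delta ->
  exists a : R, nrm (x' - a *: x) = 0.
Proof.
move=> x1 ex x1' ex' jp near near'.
set c := ip x (phi j); pose a := ip x' (phi j) / c.
have c2 : 2^-1 <= `|c|.
  have := eigenvector_near x1 ex jp near; rewrite -/c => h.
  have h4 : 4 * delta / g <= 4^-1 by rewrite ler_pdivrMr//; have := dg; lra.
  have := nrmD ip (x - c *: phi j) (c *: phi j).
  rewrite subrK x1 nrmZ (nrm_phi on)// mulr1; lra.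
have c0 : c != 0 by rewrite -normr_gt0; lra.
exists a; set v := x' - a *: x.
have vj : ip v (phi j) = 0 by rewrite /v sipBl sipZl /a divfK// subrr.
pose k := a * (mu' - mu).
have Tv : nrm (T v - (mu' *: v + k *: x)) = 0.
  have -> : T v - (mu' *: v + k *: x) =
      (T x' - mu' *: x') - a *: (T x - mu *: x).
    rewrite /v linearB linearZ /= !scalerBr !scalerA /k mulrBr scalerBl.
    rewrite (mulrC mu' a) addrA subrK !opprB.
    by rewrite addrACA [RHS]addrACA; congr (_ + _); rewrite addrC.
  apply/eqP; rewrite eq_le nrm_ge0 andbT; apply: le_trans (nrmB _ _ _) _.
  by rewrite nrmZ ex ex' mulr0 addr0.
have kE : k * c = ip (T v - D v) (phi j).
  rewrite sipBl (nrmB0_sip _ Tv) sipDl !sipZl vj mulr0 add0r.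
  by rewrite (sip_D_phir Dsym Deig)// vj mulr0 subr0.
have k2 : `|k| <= 2 * (e * nrm v).
  have : `|k| * `|c| <= e * nrm v.
    rewrite -normrM kE; apply: le_trans (sip_le _ _ _) _.
    by rewrite (nrm_phi on)// mulr1.
  have : `|k| * 2^-1 <= `|k| * `|c| by rewrite ler_wpM2l.
  lra.
have h1 : nrm (D v - mu' *: v) <= 3 * (e * nrm v).
  have -> : D v - mu' *: v = (T v - (mu' *: v + k *: x)) +
      (k *: x - (T v - D v)).
    rewrite (addrA _ (k *: x)) opprD (addrA (T v)) subrK opprB.
    by rewrite addrC addrA subrK.
  apply: le_trans (nrmD _ _ _) _; rewrite Tv add0r.
  apply: le_trans (nrmB _ _ _) _; rewrite nrmZ x1 mulr1.
  have := TD v; lra.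
have h2 : g / 2 * nrm v <= nrm (D v - mu' *: v).
  apply: (resolvent_lb on Dsym Deig gapD).
  - have := g0; lra.
  - exact: gap_other_lamp near'.
  - move=> i ip0; have [->|ij] := eqVneq i j; first by right.
    by left; exact: gap_other near' _ _.
apply/eqP; rewrite eq_le nrm_ge0 andbT leNgt; apply/negP => v0.
have : 3 * (e * nrm v) < g / 2 * nrm v.
  rewrite mulrA ltr_pM2r//; have := ed; have := e0; have := dg; lra.
by move: (le_trans h2 h1); rewrite leNgt => /negP.
Qed.

End Perturbed.

Lemma leading_eigs_perturbation (eta : R) : (0 < p)%N -> 0 < eta ->
  exists2 e : R, 0 < e & forall (T : {linear V -> V}) (lh : nat -> R) (u : nat -> V),
    (forall x, nrm (T x - D x) <= e * nrm x) ->
    (forall i, (i < p)%N -> nrm (u i) = 1 /\ nrm (T (u i) - lh i *: u i) = 0) ->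
    (forall i j, (i <= j)%N -> (j < p)%N -> lh j <= lh i) ->
    (forall c : nat -> R, nrm (\sum_(i < p) c i *: u i) = 0 ->
       forall i, (i < p)%N -> c i = 0) ->
    (forall mu x, nrm x = 1 -> nrm (T x - mu *: x) = 0 -> lh p.-1 < mu ->
       exists2 i, (i < p)%N & lh i = mu) ->
    forall i, (i < p)%N -> `|lh i - lam i| <= eta /\
      exists s : R, `|s| = 1 /\ nrm (u i - s *: phi i) <= eta.
Proof.
move=> p0 eta0.
have lam_le i : (i < p)%N -> lam i <= lam 0%N.
  by case: i => // i ip0; have := gap_dec (ltn0Sn i) ip0; have := g0; lra.
have lam00 : 0 < lam 0%N.
  by have := gap_lamp p0; have := g0; have := lamp0; lra.
(* The three bounds give the accuracy of the eigenvalues, the separation of the [lam j], and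
   [4 * delta / g <= eta / 2] for the eigenvectors. *)
pose delta := Num.min (eta / 2) (Num.min (g / 16) (eta * g / 8)).
have d0 : 0 < delta.
  rewrite !lt_min; have := g0; have := eta0 => h1 h2.
  by apply/and3P; split; rewrite ?divr_gt0 ?mulr_gt0.
have de : delta <= eta / 2 by rewrite !ge_min lexx.
have dg : 16 * delta <= g.
  have : delta <= g / 16 by rewrite !ge_min lexx orbT.
  lra.
have dge : delta <= eta * g / 8 by rewrite !ge_min lexx !orbT.
have C0 : 0 < 8 * (p.+1%:R / g) by rewrite mulr_gt0// divr_gt0.
(* The second bound is the smallness condition of [perturbed_eigenvalue] with [L = lam 0]. *)
pose e := Num.min (delta / 2) (g / lam 0%N / (8 * (p.+1%:R / g))).
have e0 : 0 < e by rewrite lt_min !divr_gt0.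
have ed : e < delta.
  have : e <= delta / 2 by rewrite ge_min lexx.
  lra.
have eg : 8 * e * (p.+1%:R / g) <= g / lam 0%N.
  have : e <= g / lam 0%N / (8 * (p.+1%:R / g)) by rewrite ge_min lexx orbT.
  by rewrite ler_pdivlMr// mulrCA mulrA.
exists e => // T lh u TD ueig lh_dec uli lhmax.
have e0' := ltW e0.
(* If the last estimated eigenvalue were lower, all [p] perturbed eigenvalues would exceed it and
   so, by maximality, occur in the list. They are distinct, hence would occupy all [p] positions
   including the last one, a contradiction. *)
have low : lam p.-1 - g / 4 <= lh p.-1.
  rewrite leNgt; apply/negP => lt1.
  have H (j : 'I_p) : exists mi : R * 'I_p,
      `|mi.1 - lam j| <= 2 * e /\ lh mi.2 = mi.1.
    have [mu [x [x1 ex near]]] := perturbed_eigenvalue cplt on Dsym Deig gapD lamp0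
      g0 gap_lamp gap_lam lam_le (ltn_ord j) e0' eg TD.
    have [|i ip0 lhi] := lhmax mu x x1 ex.
      have : lam p.-1 <= lam j.
        have [->//|jp] := eqVneq (j : nat) p.-1.
        have jlt : (j < p.-1)%N by rewrite ltn_neqAle jp -ltnS prednK// ltn_ord.
        have p1 : (p.-1 < p)%N by rewrite prednK.
        by have := gap_dec jlt p1; have := g0; lra.
      by have := ler_norm (lam j - mu); rewrite distrC; lra.
    by exists (mu, Ordinal ip0).
  have /choice [h hh] := H.
  have hinj : injective (fun j => (h j).2).
    move=> j j' /= hE; apply/val_inj/eqP; apply/negPn/negP => ne.
    have [n1 l1] := hh j; have [n2 l2] := hh j'.
    have mE : (h j).1 = (h j').1 by rewrite -l1 -l2 hE.
    have := gap_lam (ltn_ord j) (ltn_ord j') ne.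
    have := ler_distD (h j).1 (lam j) (lam j').
    rewrite -mE in n2; rewrite (distrC (lam j) (h j).1).
    by have := g0; lra.
  have p1 : (p.-1 < p)%N by rewrite prednK.
  have [k _ hk] := injF_bij hinj.
  have [n1 l1] := hh (k (Ordinal p1)).
  rewrite hk /= in l1; rewrite -l1 in n1.
  set j := k (Ordinal p1) in n1.
  have : lam p.-1 <= lam j.
    have [->//|jp] := eqVneq (j : nat) p.-1.
    have jlt : (j < p.-1)%N by rewrite ltn_neqAle jp -ltnS prednK// ltn_ord.
    by have := gap_dec jlt p1; have := g0; lra.
  by have := ler_norm (lam j - lh p.-1); rewrite distrC; lra.
have lh_lamp i : (i < p)%N -> delta <= lh i - lamp.
  move=> ip0; have p1 : (p.-1 < p)%N by rewrite prednK.
  have ip1 : (i <= p.-1)%N by rewrite -ltnS prednK.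
  have := lh_dec i p.-1 ip1 p1.
  have := gap_lamp p1; lra.
have H i : exists j, (i < p)%N -> (j < p)%N /\ `|lam j - lh i| < delta.
  have [ip0|] := ltnP i p; last by exists 0%N.
  have [u1 ue] := ueig i ip0.
  have [j jp near] := eigenvalue_near e0' ed TD u1 ue (lh_lamp i ip0).
  by exists j.
have /choice [h hh] := H.
(* Two indices with the same [h] would give dependent eigenvectors, against [uli]; a decrease of [h]
   would contradict the ordering of [lh], since distinct [lam] are [g] apart. *)
have hid : forall i, (i < p)%N -> h i = i.
  apply: incr_endo_id => [i ip0|i i' ii' ip']; first by case: (hh i ip0).
  have ip0 := ltn_trans ii' ip'.
  have [hp n1] := hh i ip0; have [hp' n2] := hh i' ip'.
  rewrite ltn_neqAle; apply/andP; split.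
    apply/negP => /eqP hE; rewrite -hE in n2.
    have [u1 ue] := ueig i ip0; have [u1' ue'] := ueig i' ip'.
    have [a ha] := near_eigenvectors_dep e0' ed dg TD u1 ue u1' ue' hp n1 n2.
    pose c k : R := if k == i' then 1 else if k == i then - a else 0.
    suff /uli/(_ i' ip')/eqP : nrm (\sum_(k < p) c k *: u k) = 0.
      by rewrite /c eqxx oner_eq0.
    rewrite /c.
    rewrite (bigD1 (Ordinal ip'))//= eqxx scale1r.
    rewrite (bigD1 (Ordinal ip0))/=; last by rewrite -val_eqE/= neq_ltn ii'.
    rewrite eqxx (_ : (i == i') = false) ?ltn_eqF// scaleNr big1 ?addr0//.
    move=> k /andP[k1 k2]; rewrite -val_eqE/= in k1; rewrite -val_eqE/= in k2.
    by rewrite (negbTE k1) (negbTE k2) scale0r.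
  rewrite leqNgt; apply/negP => lt1.
  have := gap_dec lt1 hp; have := lh_dec i i' (ltnW ii') ip'.
  have := ler_norm (lh i - lam (h i)); rewrite distrC.
  have := ler_norm (lam (h i') - lh i'); have := g0; lra.
move=> i ip0; have [hp] := hh i ip0; rewrite hid// => near.
split; first by rewrite distrC; apply: ltW; lra.
have [u1 ue] := ueig i ip0.
have := eigenvector_near e0' ed dg TD u1 ue ip0 near.
set c := ip (u i) (phi i); set w := u i - _ => hw.
have hw2 : nrm w <= eta / 2.
  apply: le_trans hw _; rewrite ler_pdivrMr//; lra.
have c1 : `|c| <= 1.
  by apply: le_trans (sip_le _ _ _) _; rewrite u1 (nrm_phi on)// mulr1.
have c2 : 1 <= `|c| + nrm w.
  rewrite -u1 -{1}(subrK (c *: phi i) (u i)); apply: le_trans (nrmD _ _ _) _.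
  by rewrite nrmZ (nrm_phi on)// mulr1 addrC.
(* Replacing the coefficient [c] by its sign costs [1 - |c|], which is at most [nrm w]; the total
   error is at most [2 nrm w <= eta]. *)
pose s : R := if 0 <= c then 1 else -1.
exists s; split; first by rewrite /s; case: ifP; rewrite ?normrN normr1.
have -> : u i - s *: phi i = w + (c - s) *: phi i.
  by rewrite /w scalerBl addrA subrK.
apply: le_trans (nrmD _ _ _) _; rewrite nrmZ (nrm_phi on)// mulr1.
suff : `|c - s| = 1 - `|c| by lra.
rewrite /s; case: (lerP 0 c) => cs.
  by rewrite ger0_norm in c1 *; rewrite ?ler0_norm ?subr_le0 ?opprB// ger0_norm.
rewrite (ltr0_norm cs) in c1 *; rewrite ger0_norm; lra.
Qed.

End Leading.

(** * Square integrable functions *)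

Section L2space.
Context {R : realType} {d : measure_display} {T : measurableType d}.
Context (mu : {measure set T -> \bar R}) (D : set T) (mD : measurable D).
Implicit Types f g : T -> R.

Definition L2in f : Prop :=
  measurable_fun D f /\ (\int[mu]_(t in D) ((f t) ^+ 2)%:E < +oo)%E.

Definition ipin f g : R := Rintegral mu D (fun t => f t * g t).

Lemma L2in_measurable_sqr f : L2in f ->
  measurable_fun D (EFin \o (fun t => (f t) ^+ 2)).
Proof. by move=> [mf _]; apply/measurable_EFinP; exact: measurable_funX. Qed.

Lemma L2in_integrable_sqr f : L2in f ->
  mu.-integrable D (fun t => ((f t) ^+ 2)%:E).
Proof.
move=> Lf; apply/integrableP; split; first exact: L2in_measurable_sqr.
under eq_integral do rewrite /= ger0_norm ?sqr_ge0//.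
by case: Lf.
Qed.

Lemma L2in_integrable f g : L2in f -> L2in g ->
  mu.-integrable D (EFin \o (fun t => f t * g t)).
Proof.
move=> Lf Lg.
apply: (le_integrable mD _ _
  (integrableD mD (L2in_integrable_sqr Lf) (L2in_integrable_sqr Lg))).
  by apply/measurable_EFinP; apply: measurable_funM; [case: Lf|case: Lg].
move=> t _ /=; rewrite lee_fin [leRHS]ger0_norm ?addr_ge0 ?sqr_ge0//.
have := sqr_ge0 (f t - g t); have := sqr_ge0 (f t + g t); rewrite ler_norml.
set a := f t; set b := g t => h1 h2; apply/andP; split; nra.
Qed.

Lemma L2in_le f g : measurable_fun D f -> L2in g ->
  (forall t, D t -> f t ^+ 2 <= g t ^+ 2) -> L2in f.
Proof.
move=> mf Lg fg; split => //; apply: le_lt_trans (proj2 Lg).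
apply: ge0_le_integral => //.
- by move=> t _; rewrite lee_fin sqr_ge0.
- by apply/measurable_EFinP; exact: measurable_funX.
- exact: L2in_measurable_sqr.
Qed.

Lemma L2in0 : L2in (fun=> 0).
Proof.
split; first exact: measurable_cst.
by under eq_integral do rewrite expr0n; rewrite integral0.
Qed.

Lemma L2inZ a f : L2in f -> L2in (fun t => a * f t).
Proof.
move=> Lf; split; first by apply: measurable_funM => //; case: Lf.
under eq_integral do rewrite exprMn EFinM.
rewrite ge0_integralZl//; last 3 first.
- exact: L2in_measurable_sqr.
- by move=> t _; rewrite lee_fin sqr_ge0.
- by rewrite lee_fin sqr_ge0.
by rewrite lte_mul_pinfty ?lee_fin ?sqr_ge0//; case: Lf.
Qed.

Lemma L2inD f g : L2in f -> L2in g -> L2in (fun t => f t + g t).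
Proof.
move=> Lf Lg; split; first by apply: measurable_funD; [case: Lf|case: Lg].
have L2 h := L2in_integrable_sqr h.
have := integrable_lty mD (integrableD mD (integrableZl mD 2 (L2 _ Lf))
  (integrableZl mD 2 (L2 _ Lg))).
apply: le_lt_trans; apply: ge0_le_integral => //.
- by move=> t _; rewrite lee_fin sqr_ge0.
- apply/measurable_EFinP; apply: measurable_funX.
  by apply: measurable_funD; [case: Lf|case: Lg].
- by apply: emeasurable_funD; apply: measurable_funeM; exact: L2in_measurable_sqr.
- move=> t _; rewrite -!EFinM -EFinD lee_fin; have := sqr_ge0 (f t - g t).
  by set a := f t; set b := g t; nra.
Qed.

Definition L2pred : {pred T -> R} := fun f => `[< L2in f >].

Lemma L2pred_submod : submod_closed L2pred.
Proof.
split => [|a f g /asboolP Lf /asboolP Lg]; apply/asboolP; first exact: L2in0.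
by apply: L2inD => //; exact: L2inZ.
Qed.
End L2space.

Section L2type.
Context {R : realType} {d : measure_display} {T : measurableType d}.
Context (mu : {measure set T -> \bar R}) (D : set T) (mD : measurable D).

(* [mD] is carried by the predicate so that the closure properties, which need
   it, can be inferred from the type. *)
Definition L2mem of measurable D : {pred T -> R} := L2pred mu D.

HB.instance Definition _ := GRing.isSubmodClosed.Build R (T -> R) (L2mem mD)
  (L2pred_submod mu mD).

Definition L2 := {f : T -> R | f \in L2mem mD}.
HB.instance Definition _ := [isSub of L2 for @sval _ _].
HB.instance Definition _ := [Choice of L2 by <:].
HB.instance Definition _ := [SubChoice_isSubLmodule of L2 by <:].

Lemma L2P (f : L2) : L2in mu D (val f).
Proof. by case: f => f /= /asboolP. Qed.

Definition mkL2 f (Lf : L2in mu D f) : L2 := exist _ f (asboolT Lf).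

Lemma valL2D (f g : L2) t : val (f + g) t = val f t + val g t.
Proof. by rewrite raddfD. Qed.

Lemma valL2B (f g : L2) t : val (f - g) t = val f t - val g t.
Proof. by rewrite raddfB. Qed.

Lemma valL2Z a (f : L2) t : val (a *: f) t = a * val f t.
Proof. by rewrite linearZ. Qed.

Lemma valL2_sum (I : Type) (r : seq I) (P : pred I) (F : I -> L2) t :
  val (\sum_(i <- r | P i) F i) t = \sum_(i <- r | P i) val (F i) t.
Proof.
by apply: (big_morph (fun f => val f t)) => [u v|]; rewrite ?valL2D// raddf0.
Qed.

Let ipL (f g : L2) : R := ipin mu D (val f) (val g).

Let ipLC f g : ipL f g = ipL g f.
Proof. by apply: eq_Rintegral => t _; rewrite mulrC. Qed.

Let ipLDl f g h : ipL (f + g) h = ipL f h + ipL g h.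
Proof.
rewrite /ipL /ipin -RintegralD//; [|exact: L2in_integrable (L2P _) (L2P _)..].
by apply: eq_Rintegral => t _; rewrite valL2D mulrDl.
Qed.

Let ipLZl a f g : ipL (a *: f) g = a * ipL f g.
Proof.
rewrite /ipL /ipin -RintegralZl//; last exact: L2in_integrable (L2P _) (L2P _).
by apply: eq_Rintegral => t _; rewrite valL2Z mulrA.
Qed.

Let ipL_ge0 f : 0 <= ipL f f.
Proof. by apply: Rintegral_ge0 => t _; rewrite -expr2 sqr_ge0. Qed.

Definition L2ip : semi_inner L2 := SemiInner ipLC ipLDl ipLZl ipL_ge0.

Lemma L2ipE (f g : L2) : L2ip f g = ipin mu D (val f) (val g). Proof. by []. Qed.

Lemma L2ip_sqrE (f : L2) : ((L2ip f f)%:E = \int[mu]_(t in D) ((val f t) ^+ 2)%:E)%E.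
Proof.
rewrite L2ipE /ipin /Rintegral.
rewrite (eq_integral (fun t => ((val f t) ^+ 2)%:E)); last first.
  by move=> t _; rewrite expr2.
by rewrite fineK// integrable_fin_num//; exact: L2in_integrable_sqr (L2P _).
Qed.

Lemma L2nrm_sqrE (f : L2) :
  ((nrm L2ip f ^+ 2)%:E = \int[mu]_(t in D) ((val f t) ^+ 2)%:E)%E.
Proof. by rewrite sqr_nrm L2ip_sqrE. Qed.

Lemma L2nrm0P (f : L2) :
  nrm L2ip f = 0 <-> {ae mu, forall t, D t -> val f t = 0}.
Proof.
have mf : measurable_fun D (EFin \o (fun t => (val f t) ^+ 2)).
  exact: L2in_measurable_sqr (L2P _).
have E1 : (\int[mu]_(t in D) `|((val f t) ^+ 2)%:E| =
    \int[mu]_(t in D) ((val f t) ^+ 2)%:E)%E.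
  by apply: eq_integral => t _; rewrite gee0_abs// lee_fin sqr_ge0.
have := ae_eq_integral_abs mu mD mf; rewrite E1 -L2nrm_sqrE => -[H1 H2].
split=> [h|h].
  rewrite h expr0n /= in H1; apply: filterS (H1 erefl) => t /= h1 Dt.
  by have [h2] := h1 Dt; apply/eqP; rewrite -sqrf_eq0; apply/eqP.
apply/eqP; rewrite -sqrf_eq0; apply/eqP/EFin_inj/H2.
by apply: filterS h => t /= + Dt => /(_ Dt) ->; rewrite expr0n.
Qed.

End L2type.

(** * Completeness of L^2 *)

Section RieszFischer.
Context {R : realType} {d : measure_display} {T : measurableType d}.
Context (mu : {measure set T -> \bar R}) (D : set T) (mD : measurable D).
Local Notation L2 := (L2 mu mD).
Local Notation nrm := (nrm (L2ip mu mD)).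

Lemma fatou_L2_le (f : nat -> T -> R) (l : T -> R) (C : R) :
  (forall n, measurable_fun D (f n)) ->
  (forall t, D t -> f n t @[n --> \oo] --> l t) ->
  (forall n, (\int[mu]_(t in D) ((f n t) ^+ 2)%:E <= C%:E)%E) ->
  (\int[mu]_(t in D) ((l t) ^+ 2)%:E <= C%:E)%E.
Proof.
move=> mf fl fC.
have := @fatou _ _ _ mu D mD (fun n t => ((f n t) ^+ 2)%:E).
move=> /(_ _ _)/le_trans H; apply: le_trans (H _ _ _ _).
- rewrite le_eqVlt; apply/orP; left; apply/eqP; apply: eq_integral => t.
  rewrite inE => Dt; apply/esym.
  have : (fun n => ((f n t) ^+ 2)%:E) @ \oo --> ((l t) ^+ 2)%:E.
    apply: cvg_EFin; first by near=> n.
    rewrite expr2; under eq_fun do rewrite /= expr2.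
    by apply: cvgM; exact: fl.
  by move/cvg_limn_einf_sup => [].
- by move=> n; apply/measurable_EFinP; exact: measurable_funX.
- by move=> n t _; rewrite lee_fin sqr_ge0.
- rewrite limn_einf_lim; apply: lime_le; first exact: is_cvg_einfs.
  near=> n; apply: le_trans (fC n); apply: ereal_inf_lbound.
  by exists n => //=.
Unshelve. all: by end_near. Qed.

(** The increments are at most [sqrt G * 2^-k], so the telescoping series converges absolutely. The
    weighted form of the hypothesis is the one that an integrable sum of squares provides
    pointwise. *)
Lemma geo_pointwise_cvg (x : nat -> R) (G : R) :
  (forall k, 4 ^+ k * (x k.+1 - x k) ^+ 2 <= G) -> cvgn x.
Proof.
move=> H.
have G0 : 0 <= G by apply: le_trans (H 0%N); rewrite expr0 mul1r sqr_ge0.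
have -> : x = (fun n => x 0%N + series (telescope x) n).
  by apply/funext => n; exact: eq_sum_telescope.
apply: is_cvgD; first exact: is_cvg_cst.
apply: normed_cvg.
apply: (@series_le_cvg _ _ (geometric (Num.sqrt G) 2^-1)) => //.
- by move=> n; rewrite /= normr_ge0.
- by move=> n; rewrite /= mulr_ge0 ?sqrtr_ge0 ?exprn_ge0.
- move=> n /=; rewrite /telescope -sqrtr_sqr.
  have -> : 2^-1 ^+ n = Num.sqrt ((4^-1 : R) ^+ n).
    have -> : (4^-1 : R) = 2^-1 ^+ 2 by rewrite expr2 -invfM -natrM.
    by rewrite -exprM mulnC exprM sqrtr_sqr ger0_norm// exprn_ge0.
  rewrite -sqrtrM// ler_sqrt ?mulr_ge0 ?exprn_ge0//.
  have := H n; rewrite exprVn ler_pdivlMr ?exprn_gt0//.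
  by rewrite mulrC.
- apply: is_cvg_geometric_series; rewrite ger0_norm//; lra.
Qed.

Lemma sum_geo4_le n : \sum_(0 <= k < n) (4^-1 : R) ^+ k <= 2.
Proof.
suff : \sum_(0 <= k < n) (4^-1 : R) ^+ k <= 2 - 2 * 4^-1 ^+ n.
  by move/le_trans; apply; rewrite gerBl mulr_ge0 ?exprn_ge0.
elim: n => [|n IH]; first by rewrite big_nil expr0; lra.
rewrite big_nat_recr//= exprS.
have : 0 <= (4^-1 : R) ^+ n by rewrite exprn_ge0.
move: IH; set a := 4^-1 ^+ n; lra.
Qed.

Lemma L2_complete : sip_complete (L2ip mu mD).
Proof.
(* Along the subsequence [v] the increments have norm at most [4^-k], so after the weight [4^k] in
   [G] the terms still have integrals at most [4^-k]. *)
move=> u ucau; pose eps k : R := 4^-1 ^+ k.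
have eps0 k : 0 < eps k by rewrite exprn_gt0.
have /choice [N HN] : forall k, exists N, forall m n, (N <= m)%N -> (N <= n)%N ->
    nrm (u m - u n) <= eps k by move=> k; exact: ucau.
(* The maximum makes [nn k] lie beyond the thresholds of all earlier indices, although [N] need not
   be monotone. *)
pose nn k := (\max_(i < k.+1) N i)%N.
have nnN i k : (i <= k)%N -> (N i <= nn k)%N.
  move=> ik; have ik1 : (i < k.+1)%N by rewrite ltnS.
  exact: (@leq_bigmax _ (fun i : 'I_k.+1 => N i) (Ordinal ik1)).
pose v k := u (nn k).
have vv i k : (i <= k)%N -> nrm (v k - v i) <= eps i.
  by move=> ik; apply: HN; apply: nnN.
pose G t := (\sum_(k <oo) (4 ^+ k * (val (v k.+1) t - val (v k) t) ^+ 2)%:E)%E.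
have Lv k : L2in mu D (val (v k)) by exact: L2P.
have mv k : measurable_fun D (val (v k)) by case: (Lv k).
have mterm k : measurable_fun D
    (EFin \o (fun t => 4 ^+ k * (val (v k.+1) t - val (v k) t) ^+ 2)).
  apply/measurable_EFinP; apply: measurable_funM => //; apply: measurable_funX.
  exact: measurable_funB.
have term0 k t : 0 <= 4 ^+ k * (val (v k.+1) t - val (v k) t) ^+ 2.
  by rewrite mulr_ge0 ?sqr_ge0 ?exprn_ge0.
have mG : measurable_fun D G.
  by apply: ge0_emeasurable_sum => [k t _ _|k _]; rewrite ?lee_fin//; exact: mterm.
have iG : mu.-integrable D G.
  apply/integrableP; split => //.
  under eq_integral.
    move=> t _; rewrite gee0_abs; last first.
      by apply: nneseries_ge0 => k _ _; rewrite lee_fin.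
    over.
  rewrite integral_nneseries//; last by move=> k t _; rewrite lee_fin.
  apply: (@le_lt_trans _ _ 2%:E); last by rewrite ltry.
  apply: lime_le.
    by apply: is_cvg_nneseries => k _ _; apply: integral_ge0 => t _; rewrite lee_fin.
  near=> n; apply: le_trans (_ : (\sum_(0 <= k < n) (4^-1 ^+ k)%:E <= _)%E).
    apply: lee_sum => k _.
    under eq_integral do rewrite EFinM.
    rewrite ge0_integralZl//; last 2 first.
    + apply/measurable_EFinP; apply: measurable_funX.
      exact: measurable_funB.
    + by move=> t _; rewrite lee_fin sqr_ge0.
    have -> : (\int[mu]_(t in D) ((val (v k.+1) t - val (v k) t) ^+ 2)%:E =
        (nrm (v k.+1 - v k) ^+ 2)%:E)%E.
      by rewrite L2nrm_sqrE; apply: eq_integral => t _; rewrite valL2B.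
    rewrite -EFinM lee_fin.
    have h : nrm (v k.+1 - v k) ^+ 2 <= (eps k) ^+ 2.
      by rewrite lerXn2r ?nnegrE ?nrm_ge0 ?(ltW (eps0 _))// vv.
    apply: le_trans (ler_wpM2l _ h) _; first by rewrite exprn_ge0.
    rewrite le_eqVlt; apply/orP; left; apply/eqP.
    by rewrite /eps expr2 mulrA -exprMn divff// expr1n mul1r.
  by rewrite sumEFin lee_fin sum_geo4_le.
(* Setting the functions to 0 where [G] is infinite makes the sequence converge at every point of
   [D], so the limit is measurable; the norms do not see the change because [G] is integrable. *)
pose E := D `&` [set t | (G t < +oo)%E].
have mE : measurable E by exact: emeasurable_fun_infty_o.
pose h k t := \1_E t * val (v k) t.
have mh k : measurable_fun D (h k).
  apply: measurable_funM; last by case: (Lv k).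
  exact: measurable_indic.
have hcv t : D t -> cvgn (h ^~ t).
  move=> Dt; have [tE|tE] := boolP (t \in E).
    rewrite /h indicE tE; under eq_fun do rewrite mul1r.
    have Gfin : (G t \is a fin_num).
      rewrite ge0_fin_numE; first by move: tE; rewrite inE => -[].
      by apply: nneseries_ge0 => k _ _; rewrite lee_fin.
    apply: (@geo_pointwise_cvg _ (fine (G t))) => k.
    rewrite -lee_fin fineK//.
    apply: le_trans (nneseries_lim_ge k.+1 _); last first.
      by move=> i _ _; rewrite lee_fin.
    rewrite big_nat_recr//= leeDr//; apply: sume_ge0 => i _.
    by rewrite lee_fin; exact: term0.
  rewrite /h indicE (negbTE tE); under eq_fun do rewrite mul0r.
  exact: is_cvg_cst.
pose l t := limn (h ^~ t).
have ml : measurable_fun D l.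
  by apply: measurable_fun_cvg mh _ => t Dt; exact: hcv.
have hL k : L2in mu D (h k).
  apply: L2in_le (mh k) (Lv k) _ => // t _; rewrite /h indicE.
  by case: (_ \in _); rewrite ?mul1r// mul0r expr0n sqr_ge0.
have hh k : (\int[mu]_(t in D) ((l t - h k t) ^+ 2)%:E <= (eps k ^+ 2)%:E)%E.
  apply: (@fatou_L2_le (fun m t => h (m + k)%N t - h k t)).
  - by move=> m; exact: measurable_funB.
  - move=> t Dt; apply: cvgB; last exact: cvg_cst.
    by rewrite (cvg_shiftn k (h ^~ t)); exact: hcv.
  - move=> m; apply: (@le_trans _ _ ((nrm (v (m + k)%N - v k) ^+ 2)%:E)).
      rewrite L2nrm_sqrE; apply: ge0_le_integral => //.
      + by move=> t _; rewrite lee_fin sqr_ge0.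
      + by apply/measurable_EFinP; apply: measurable_funX; exact: measurable_funB.
      + exact: L2in_measurable_sqr (L2P _).
      + move=> t _; rewrite lee_fin valL2B /h -mulrBr exprMn ler_piMl ?sqr_ge0//.
    rewrite lee_fin lerXn2r ?nnegrE ?nrm_ge0 ?(ltW (eps0 _))//.
    by apply: vv; rewrite leq_addl.
have Llh k : L2in mu D (fun t => l t - h k t).
  split; first exact: measurable_funB.
  by apply: le_lt_trans (hh k) _; rewrite ltry.
have Ll : L2in mu D l.
  have := L2inD mD (Llh 0%N) (hL 0%N).
  by congr (L2in mu D _); apply/funext => t; rewrite subrK.
exists (mkL2 mD Ll).
apply/cvgr0Pnorm_lt => e e0.
have [k hk] : exists k, 2 * eps k < e.
  have : (eps k @[k --> \oo] --> (0 : R)).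
    by apply: cvg_expr; rewrite ger0_norm//; lra.
  have e2 : 0 < e / 2 by lra.
  move=> /cvgr0Pnorm_lt/(_ _ e2) [k _ /(_ k (leqnn k))] /=.
  by rewrite gtr0_norm// => ?; exists k; lra.
exists (N k) => // n Nn /=; rewrite ger0_norm ?nrm_ge0//.
apply: le_lt_trans hk; apply: le_trans (nrm_dist _ (v k) _ _) _.
have h1 : nrm (u n - v k) <= eps k by apply: HN => //; exact: nnN.
suff : nrm (v k - mkL2 mD Ll) <= eps k by lra.
apply: le_trans (nrm_dist _ (mkL2 mD (hL k)) _ _) _.
have -> : nrm (v k - mkL2 mD (hL k)) = 0.
  apply/L2nrm0P; apply: filterS (integrable_ae mD iG) => t H Dt.
  have Gt := H Dt; rewrite valL2B /= /h indicE mem_set ?mul1r ?subrr//.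
  by split => //=; rewrite ltey_eq Gt.
rewrite add0r nrmBC -(@ler_pXn2r _ 2)// ?nnegrE ?nrm_ge0 ?(ltW (eps0 _))//.
rewrite -lee_fin L2nrm_sqrE; apply: le_trans (hh k).
rewrite le_eqVlt; apply/orP; left; apply/eqP.
by apply: eq_integral => t _; rewrite valL2B.
Unshelve. all: by end_near. Qed.

End RieszFischer.

(** * Fubini's theorem on measurable rectangles *)

Section RestrictedFubini.
Context {R : realType} {d1 d2 : measure_display}.
Context {T1 : measurableType d1} {T2 : measurableType d2}.
Context (m1 : {sigma_finite_measure set T1 -> \bar R}).
Context (m2 : {sigma_finite_measure set T2 -> \bar R}).
Context (D1 : set T1) (D2 : set T2).
Context (mD1 : measurable D1) (mD2 : measurable D2).

Let mD12 : measurable (D1 `*` D2). Proof. exact: measurableX. Qed.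

Let restrict_in (F : T1 * T2 -> \bar R) x y : D1 x ->
  (F \_ (D1 `*` D2)) (x, y) = ((fun y => F (x, y)) \_ D2) y.
Proof.
move=> Dx; rewrite !patchE in_setX/= (_ : (x \in D1) = true) ?andTb//.
exact/mem_set.
Qed.

Let restrict_out (F : T1 * T2 -> \bar R) x y : ~ D1 x ->
  (F \_ (D1 `*` D2)) (x, y) = 0%E.
Proof. by move=> Dx; rewrite patchE in_setX/= memNset. Qed.

Let restrict_in2 (F : T1 * T2 -> \bar R) x y : D2 y ->
  (F \_ (D1 `*` D2)) (x, y) = ((fun x => F (x, y)) \_ D1) x.
Proof.
move=> Dy; rewrite !patchE in_setX/= (_ : (y \in D2) = true) ?andbT//.
exact/mem_set.
Qed.

Let restrict_out2 (F : T1 * T2 -> \bar R) x y : ~ D2 y ->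
  (F \_ (D1 `*` D2)) (x, y) = 0%E.
Proof. by move=> Dy; rewrite patchE in_setX/= (memNset Dy) andbF. Qed.

(** Extension by 0 outside the rectangle transfers the theorems on the whole product space. *)
Let int1 (F : T1 * T2 -> \bar R) :
  (\int[m1]_x \int[m2]_y (F \_ (D1 `*` D2)) (x, y) =
   \int[m1]_(x in D1) \int[m2]_(y in D2) F (x, y))%E.
Proof.
rewrite [RHS]integral_mkcond; apply: eq_integral => x _.
rewrite patchE; case: ifPn => [/set_mem Dx|/negP Dx].
  by rewrite [RHS]integral_mkcond; apply: eq_integral => y _; rewrite restrict_in.
rewrite -[RHS](@integral0 _ _ _ m2 setT); apply: eq_integral => y _.
by rewrite restrict_out//; move=> /mem_set.
Qed.

Let int2 (F : T1 * T2 -> \bar R) :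
  (\int[m2]_y \int[m1]_x (F \_ (D1 `*` D2)) (x, y) =
   \int[m2]_(y in D2) \int[m1]_(x in D1) F (x, y))%E.
Proof.
rewrite [RHS]integral_mkcond; apply: eq_integral => y _.
rewrite patchE; case: ifPn => [/set_mem Dy|/negP Dy].
  by rewrite [RHS]integral_mkcond; apply: eq_integral => x _; rewrite restrict_in2.
rewrite -[RHS](@integral0 _ _ _ m1 setT); apply: eq_integral => x _.
by rewrite restrict_out2//; move=> /mem_set.
Qed.

Lemma measurable_section1 {d3 : measure_display} {T3 : sigmaRingType d3}
    (F : T1 * T2 -> T3) x : measurable_fun (D1 `*` D2) F -> D1 x ->
  measurable_fun D2 (fun y => F (x, y)).
Proof.
move=> mF Dx _ B mB.
have := measurable_xsection x (mF mD12 B mB).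
congr measurable; apply/seteqP; split => y; rewrite /xsection/= inE/=.
  by move=> [[_ Dy] By].
by move=> [Dy By].
Qed.

Lemma measurable_swap_in {d3 : measure_display} {T3 : sigmaRingType d3}
    (F : T1 * T2 -> T3) : measurable_fun (D1 `*` D2) F ->
  measurable_fun (D2 `*` D1) (fun z => F (z.2, z.1)).
Proof.
move=> mF; apply: (measurable_comp (F := D1 `*` D2)); first exact: measurableX.
- by move=> _ [[y x] /= [Dy Dx] <-].
- exact: mF.
- exact: measurable_funS (@measurable_swap _ _ T2 T1).
Qed.

Lemma tonelli_prod (F : T1 * T2 -> \bar R) :
  measurable_fun (D1 `*` D2) F -> (forall z, (D1 `*` D2) z -> (0 <= F z)%E) ->
  (\int[(m1 \x m2)%E]_(z in D1 `*` D2) F z =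
   \int[m1]_(x in D1) \int[m2]_(y in D2) F (x, y))%E.
Proof.
move=> mF F0; have mF' := (measurable_restrictT F mD12).1 mF.
have F'0 z : (0 <= (F \_ (D1 `*` D2)) z)%E.
  by rewrite patchE; case: ifPn => // /set_mem; exact: F0.
by rewrite -int1 integral_mkcond fubini_tonelli1.
Qed.

Lemma measurable_int_section (F : T1 * T2 -> \bar R) :
  measurable_fun (D1 `*` D2) F -> (forall z, (D1 `*` D2) z -> (0 <= F z)%E) ->
  measurable_fun D1 (fun x => \int[m2]_(y in D2) F (x, y))%E.
Proof.
move=> mF F0; have mF' := (measurable_restrictT F mD12).1 mF.
have F'0 z : (0 <= (F \_ (D1 `*` D2)) z)%E.
  by rewrite patchE; case: ifPn => // /set_mem; exact: F0.
have H : measurable_fun setT (fubini_F m2 (F \_ (D1 `*` D2))).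
  exact: measurable_fun_fubini_tonelli_F.
apply: (eq_measurable_fun (fubini_F m2 (F \_ (D1 `*` D2)))); last first.
  exact: measurable_funS H.
move=> x /set_mem Dx; rewrite /fubini_F [RHS]integral_mkcond.
by apply: eq_integral => y _; rewrite restrict_in.
Qed.

Lemma tonelli_in (F : T1 * T2 -> \bar R) :
  measurable_fun (D1 `*` D2) F -> (forall z, (D1 `*` D2) z -> (0 <= F z)%E) ->
  (\int[m1]_(x in D1) \int[m2]_(y in D2) F (x, y) =
   \int[m2]_(y in D2) \int[m1]_(x in D1) F (x, y))%E.
Proof.
move=> mF F0; have mF' := (measurable_restrictT F mD12).1 mF.
have F'0 z : (0 <= (F \_ (D1 `*` D2)) z)%E.
  by rewrite patchE; case: ifPn => // /set_mem; exact: F0.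
by rewrite -int1 -int2; exact: fubini_tonelli.
Qed.

(** The value is [fine] of a difference of two Tonelli integrals, of the positive and the negative
    part; this is measurable even where a section fails to be integrable. *)
Lemma measurable_Rint_section (F : T1 * T2 -> R) :
  measurable_fun (D1 `*` D2) F ->
  measurable_fun D1 (fun x => Rintegral m2 D2 (fun y => F (x, y))).
Proof.
move=> mF; have mF' : measurable_fun (D1 `*` D2) (EFin \o F).
  exact/measurable_EFinP.
rewrite (_ : (fun x => _) = (fun x =>
  fine (\int[m2]_(y in D2) (EFin \o F)^\+ (x, y) -
        \int[m2]_(y in D2) (EFin \o F)^\- (x, y))%E)); last first.
  apply/funext => x; rewrite /Rintegral [in LHS]integralE; congr (fine (_ - _)).
    by apply: eq_integral => y _; rewrite !funeposE.
  by apply: eq_integral => y _; rewrite !funenegE.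
apply: measurableT_comp => //; apply: emeasurable_funB.
  by apply: measurable_int_section => //; exact: measurable_funepos.
by apply: measurable_int_section => //; exact: measurable_funeneg.
Qed.

(** [Rintegral] applies [fine], which loses infinite values; almost every section is integrable, so
    the outer integral is not affected. *)
Lemma fubini_in (F : T1 * T2 -> R) :
  measurable_fun (D1 `*` D2) F ->
  (\int[m1]_(x in D1) \int[m2]_(y in D2) `|F (x, y)|%:E < +oo)%E ->
  [/\ {ae m1, forall x, D1 x -> m2.-integrable D2 (fun y => (F (x, y))%:E)},
     m1.-integrable D1 (EFin \o (fun x => Rintegral m2 D2 (fun y => F (x, y)))) &
     (\int[m1]_(x in D1) (Rintegral m2 D2 (fun y => F (x, y)))%:E =
      \int[m1]_(x in D1) \int[m2]_(y in D2) (F (x, y))%:E)%E].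
Proof.
move=> mF Foo; have mF' : measurable_fun (D1 `*` D2) (EFin \o F).
  exact/measurable_EFinP.
have mabs : measurable_fun (D1 `*` D2) (fun z => `|(F z)%:E|%E).
  exact: measurableT_comp.
have iabs : m1.-integrable D1 (fun x => \int[m2]_(y in D2) `|(F (x, y))%:E|)%E.
  apply/integrableP; split; first exact: (measurable_int_section mabs).
  under eq_integral.
    move=> x _; rewrite gee0_abs; last exact: integral_ge0.
    over.
  exact: Foo.
have msec x : D1 x -> measurable_fun D2 (fun y => (F (x, y))%:E).
  by move=> Dx; exact: (measurable_section1 mF').
have aei : {ae m1, forall x, D1 x -> m2.-integrable D2 (fun y => (F (x, y))%:E)}.
  apply: filterS (integrable_ae mD1 iabs) => x H Dx.
  apply/integrableP; split; first exact: msec.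
  by have := H Dx; rewrite ge0_fin_numE//; exact: integral_ge0.
have mRint := measurable_Rint_section mF.
have iR : m1.-integrable D1 (EFin \o (fun x => Rintegral m2 D2 (fun y => F (x, y)))).
  apply/integrableP; split; first exact/measurable_EFinP.
  apply: le_lt_trans Foo.
  apply: ae_ge0_le_integral => //.
  - by apply: measurableT_comp => //; exact/measurable_EFinP.
  - by move=> x _; exact: integral_ge0.
  - exact: (measurable_int_section mabs).
  - apply: filterS aei => x H Dx; have iF := H Dx.
    have := le_abse_integral m2 mD2 (msec x Dx); apply: le_trans.
    by rewrite -EFin_normr_Rintegral.
split => //.
apply: ae_eq_integral => //; first exact/measurable_EFinP.
  rewrite (_ : (fun x => _) = (fun x =>
    (\int[m2]_(y in D2) (EFin \o F)^\+ (x, y) -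
     \int[m2]_(y in D2) (EFin \o F)^\- (x, y))%E)).
    apply: emeasurable_funB; apply: measurable_int_section => //.
    - exact: measurable_funepos.
    - exact: measurable_funeneg.
  apply/funext => x; rewrite integralE; congr (_ - _)%E.
    by apply: eq_integral => y _; rewrite !funeposE.
  by apply: eq_integral => y _; rewrite !funenegE.
apply: filterS aei => x H Dx; rewrite /Rintegral fineK//.
exact: integrable_fin_num (H Dx).
Qed.

Lemma Rfubini_in (F : T1 * T2 -> R) :
  measurable_fun (D1 `*` D2) F ->
  (\int[m1]_(x in D1) \int[m2]_(y in D2) `|F (x, y)|%:E < +oo)%E ->
  (\int[m1]_(x in D1) \int[m2]_(y in D2) (F (x, y))%:E =
   \int[m2]_(y in D2) \int[m1]_(x in D1) (F (x, y))%:E)%E.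
Proof.
move=> mF Foo; have mF' : measurable_fun (D1 `*` D2) (EFin \o F).
  exact/measurable_EFinP.
have mR := (measurable_restrictT _ mD12).1 mF'.
rewrite -(int1 (EFin \o F)) -(int2 (EFin \o F)).
apply: (Fubini (f := (EFin \o F) \_ (D1 `*` D2))).
apply/(integrable12ltyP _ _ mR); apply: le_lt_trans Foo.
rewrite -(int1 (fun z => `|F z|%:E)) le_eqVlt; apply/orP; left; apply/eqP.
apply: eq_integral => x _; apply: eq_integral => y _.
by rewrite !patchE; case: ifPn => //=; rewrite normr0.
Qed.

End RestrictedFubini.

Section ProductL2.
Context {R : realType} {d1 d2 : measure_display}.
Context {T1 : measurableType d1} {T2 : measurableType d2}.
Context (m1 : {sigma_finite_measure set T1 -> \bar R}).
Context (m2 : {sigma_finite_measure set T2 -> \bar R}).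
Context (D1 : set T1) (D2 : set T2).
Context (mD1 : measurable D1) (mD2 : measurable D2).

Let mD12 : measurable (D1 `*` D2). Proof. exact: measurableX. Qed.

Lemma L2in_prodP (F : T1 * T2 -> R) : L2in (m1 \x m2)%E (D1 `*` D2) F <->
  measurable_fun (D1 `*` D2) F /\
  (\int[m1]_(x in D1) \int[m2]_(y in D2) ((F (x, y)) ^+ 2)%:E < +oo)%E.
Proof.
suff E : measurable_fun (D1 `*` D2) F ->
    (\int[(m1 \x m2)%E]_(z in D1 `*` D2) ((F z) ^+ 2)%:E =
     \int[m1]_(x in D1) \int[m2]_(y in D2) ((F (x, y)) ^+ 2)%:E)%E.
  by split=> -[mF iF]; split => //; [rewrite -E | rewrite E].
move=> mF; rewrite (tonelli_prod m1 m2 mD1 mD2 (F := fun z => ((F z) ^+ 2)%:E))//.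
  by apply/measurable_EFinP; exact: measurable_funX.
by move=> z _; rewrite lee_fin sqr_ge0.
Qed.

Lemma L2in_prod_tensor (f : T1 -> R) (g : T2 -> R) : L2in m1 D1 f -> L2in m2 D2 g ->
  L2in (m1 \x m2)%E (D1 `*` D2) (fun z => f z.1 * g z.2).
Proof.
move=> Lf Lg; apply/L2in_prodP; split.
  apply: measurable_funM.
    apply: (measurable_comp mD1).
    - by move=> _ [z [Dz _] <-].
    - by case: Lf.
    - exact: measurable_funS measurable_fst.
  apply: (measurable_comp mD2).
  - by move=> _ [z [_ Dz] <-].
  - by case: Lg.
  - exact: measurable_funS measurable_snd.
have E t : (\int[m2]_(s in D2) ((f t * g s) ^+ 2)%:E = ((f t) ^+ 2)%:E *
    \int[m2]_(s in D2) ((g s) ^+ 2)%:E)%E.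
  under eq_integral do rewrite exprMn EFinM.
  rewrite ge0_integralZl//.
  - exact: (L2in_measurable_sqr Lg).
  - by move=> s _; rewrite lee_fin sqr_ge0.
  - by rewrite lee_fin sqr_ge0.
under eq_integral do rewrite E.
rewrite -(L2nrm_sqrE (mkL2 mD2 Lg)); under eq_integral do rewrite muleC.
rewrite ge0_integralZl//; first by rewrite -(L2nrm_sqrE (mkL2 mD1 Lf)) -EFinM ltry.
- exact: (L2in_measurable_sqr Lf).
- by move=> s _; rewrite lee_fin sqr_ge0.
- by rewrite lee_fin sqr_ge0.
Qed.

Lemma L2in_prod_integrable (a b : T1 * T2 -> R) :
  L2in (m1 \x m2)%E (D1 `*` D2) a -> L2in (m1 \x m2)%E (D1 `*` D2) b ->
  measurable_fun (D1 `*` D2) (fun z => a z * b z) /\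
  (\int[m1]_(x in D1) \int[m2]_(y in D2) `|a (x, y) * b (x, y)|%:E < +oo)%E.
Proof.
move=> La Lb; have /integrableP [mF iF] := L2in_integrable mD12 La Lb.
have mF' : measurable_fun (D1 `*` D2) (fun z => a z * b z) by exact/measurable_EFinP.
split => //.
rewrite -(tonelli_prod m1 m2 mD1 mD2 (F := fun z => `|a z * b z|%:E))//.
by apply/measurable_EFinP; exact: measurableT_comp.
Qed.

End ProductL2.

Lemma Rintegral_ae (R : realType) (d : measure_display) (T : measurableType d)
    (mu : {measure set T -> \bar R}) (D : set T) (f g : T -> R) :
  measurable D -> measurable_fun D f -> measurable_fun D g ->
  {ae mu, forall t, D t -> f t = g t} -> Rintegral mu D f = Rintegral mu D g.
Proof.
move=> mD mf mg fg; rewrite /Rintegral; congr fine; apply: ae_eq_integral => //.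
- exact/measurable_EFinP.
- exact/measurable_EFinP.
- by apply: filterS fg => t H Dt; rewrite H.
Qed.

Section RintegralFubini.
Context {R : realType} {d1 d2 : measure_display}.
Context {T1 : measurableType d1} {T2 : measurableType d2}.
Context (m1 : {sigma_finite_measure set T1 -> \bar R}).
Context (m2 : {sigma_finite_measure set T2 -> \bar R}).
Context (D1 : set T1) (D2 : set T2).
Context (mD1 : measurable D1) (mD2 : measurable D2).

Lemma measurable_Rint_section2 (F : T1 * T2 -> R) : measurable_fun (D1 `*` D2) F ->
  measurable_fun D2 (fun y => Rintegral m1 D1 (fun x => F (x, y))).
Proof.
move=> mF.
exact: (measurable_Rint_section m1 mD2 mD1 (measurable_swap_in mD1 mD2 mF)).
Qed.

Lemma Rintegral_fubini (F : T1 * T2 -> R) : measurable_fun (D1 `*` D2) F ->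
  (\int[m1]_(x in D1) \int[m2]_(y in D2) `|F (x, y)|%:E < +oo)%E ->
  Rintegral m1 D1 (fun x => Rintegral m2 D2 (fun y => F (x, y))) =
  Rintegral m2 D2 (fun y => Rintegral m1 D1 (fun x => F (x, y))).
Proof.
move=> mF iF; have [_ _ E1] := fubini_in mD1 mD2 mF iF.
pose F' (z : T2 * T1) := F (z.2, z.1).
have mF' : measurable_fun (D2 `*` D1) F' by exact: (measurable_swap_in mD1 mD2 mF).
have iF' : (\int[m2]_(y in D2) \int[m1]_(x in D1) `|F' (y, x)|%:E < +oo)%E.
  rewrite -(tonelli_in m1 m2 mD1 mD2 (F := fun z => `|F z|%:E))//.
  by apply/measurable_EFinP; exact: measurableT_comp.
have [_ _ E2] := fubini_in mD2 mD1 mF' iF'.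
rewrite /Rintegral -[in LHS]/(Rintegral m2 D2 _) E1.
under [in RHS]eq_integral do rewrite -/(Rintegral m1 D1 (fun x => F (x, _))).
by rewrite E2 (Rfubini_in mD1 mD2 mF iF).
Qed.

End RintegralFubini.

(** * Integral operators on [0,1] *)

Section KernelOperator.
Context {R : realType}.
Local Notation mu := (@lebesgue_measure R).
Local Notation RR := (measurableTypeR R).
Local Notation I := (@I01 R : set RR).
Implicit Types (k : R -> R -> R) (f g : R -> R).

Lemma mI01 : @measurable _ RR I. Proof. exact: measurable_itv. Qed.

Local Notation L2I := (L2 mu mI01).
Local Notation nrm := (nrm (L2ip mu mI01)).

Lemma ipE f g : ip f g = ipin mu I f g. Proof. by []. Qed.

Definition rowsq k t : \bar R := (\int[mu]_(s in I) ((k t s) ^+ 2)%:E)%E.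
Definition good_rows k := I `&` [set t | (rowsq k t < +oo)%E].
(** Where a row of [k] is not square integrable, [kop k] need not be additive in [f]. Putting 0 on
    this null set of [t] gives a map that is linear as a map of functions, not merely almost
    everywhere. *)
Definition koper k f t : R := \1_(good_rows k) t * kop k f t.

Lemma L2kernelP k :
  L2kernel k <-> L2in (mu \x mu)%E (I `*` I) (fun z : RR * RR => k z.1 z.2).
Proof.
have E := L2in_prodP mu mu mI01 mI01 (fun z : RR * RR => k z.1 z.2).
by split=> H; [exact: (E.2 H) | exact: (E.1 H)].
Qed.

Section OneKernel.
Context (k : R -> R -> R) (Lk : L2kernel k).

Let mk2 : measurable_fun (I `*` I) (fun z : RR * RR => ((k z.1 z.2) ^+ 2)%:E).
Proof. by apply/measurable_EFinP; apply: measurable_funX; case: Lk. Qed.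

Lemma measurable_rowsq : measurable_fun I (rowsq k).
Proof.
apply: (measurable_int_section mu mI01 mI01 mk2).
by move=> z _; rewrite lee_fin sqr_ge0.
Qed.

Lemma measurable_good_rows : measurable (good_rows k).
Proof. exact: emeasurable_fun_infty_o mI01 measurable_rowsq _. Qed.

Lemma rowsq_ge0 t : (0 <= rowsq k t)%E.
Proof. by apply: integral_ge0 => s _; rewrite lee_fin sqr_ge0. Qed.

Lemma ae_good_rows : {ae mu, forall t, I t -> good_rows k t}.
Proof.
have iq : mu.-integrable I (rowsq k).
  apply/integrableP; split; first exact: measurable_rowsq.
  under eq_integral do rewrite gee0_abs ?rowsq_ge0//.
  by case: Lk.
apply: filterS (integrable_ae mI01 iq) => t H It; split => //=.
by rewrite ltey_eq H.
Qed.

Lemma good_row_L2 t : good_rows k t -> L2in mu I (k t).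
Proof.
move=> [It qt]; split => //; have [mk _] := Lk.
exact: (measurable_section1 mI01 mI01 mk It).
Qed.

Lemma koper_good f t : good_rows k t -> koper k f t = kop k f t.
Proof. by move=> gt; rewrite /koper indicE mem_set// mul1r. Qed.

Lemma ae_koper f : {ae mu, forall t, I t -> koper k f t = kop k f t}.
Proof. by apply: filterS ae_good_rows => t H It; rewrite koper_good//; exact: H. Qed.

Lemma kop_CS t (f : L2I) : good_rows k t ->
  (((kop k (val f) t) ^+ 2)%:E <= rowsq k t * (nrm f ^+ 2)%:E)%E.
Proof.
move=> gt; pose kt : L2I := mkL2 mI01 (good_row_L2 gt).
have -> : rowsq k t = (L2ip mu mI01 kt kt)%:E by rewrite L2ip_sqrE.
by rewrite -EFinM lee_fin sqr_nrm; exact: (sip_CS (L2ip mu mI01) kt f).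
Qed.

Lemma measurable_kop f : measurable_fun I f -> measurable_fun I (kop k f).
Proof.
move=> mf; apply: (measurable_Rint_section mu mI01 mI01
  (F := fun z : RR * RR => k z.1 z.2 * f z.2)).
apply: measurable_funM; first by case: Lk.
apply: (measurable_comp mI01) => //; last exact: measurable_funS measurable_snd.
by move=> _ [z [_ Iz] <-].
Qed.

Lemma measurable_koper f : measurable_fun I f -> measurable_fun I (koper k f).
Proof.
move=> mf; apply: measurable_funM; last exact: measurable_kop.
exact: measurable_indic measurable_good_rows.
Qed.

Lemma koper_sq_le (f : L2I) :
  (\int[mu]_(t in I) ((koper k (val f) t) ^+ 2)%:E <= ksq k * (nrm f ^+ 2)%:E)%E.
Proof.
have mf : measurable_fun I (val f) by case: (L2P f).
rewrite muleC -ge0_integralZl//; last 4 first.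
- exact: mI01.
- exact: measurable_rowsq.
- by move=> t _; exact: rowsq_ge0.
- by rewrite lee_fin sqr_ge0.
apply: ge0_le_integral.
- exact: mI01.
- by move=> t _; rewrite lee_fin sqr_ge0.
- by apply/measurable_EFinP; apply: measurable_funX; exact: measurable_koper.
- by apply: measurable_funeM; exact: measurable_rowsq.
- move=> t It; have [gt|gt] := pselect (good_rows k t).
    by rewrite koper_good// muleC kop_CS.
  rewrite /koper indicE memNset// mul0r expr0n /= mule_ge0 ?rowsq_ge0//.
  by rewrite lee_fin sqr_ge0.
Qed.

Lemma ksq_fin : ksq k = (fine (ksq k))%:E.
Proof.
rewrite fineK// ge0_fin_numE; first by case: Lk.
by apply: integral_ge0 => t _; exact: rowsq_ge0.
Qed.

Lemma koper_L2 (f : L2I) : L2in mu I (koper k (val f)).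
Proof.
split; first by apply: measurable_koper; case: (L2P f).
by apply: le_lt_trans (koper_sq_le f) _; rewrite ksq_fin -EFinM ltry.
Qed.

Definition Kop (f : L2I) : L2I := mkL2 mI01 (koper_L2 f).

Lemma Kop_is_linear : linear Kop.
Proof.
move=> a f g; apply: val_inj; apply/funext => t.
rewrite valL2D valL2Z; have [gt|gt] := pselect (good_rows k t); last first.
  have e (h : L2I) : val (Kop h) t = 0.
    by rewrite /= /koper indicE memNset// mul0r.
  by rewrite !e mulr0 addr0.
pose kt : L2I := mkL2 mI01 (good_row_L2 gt).
have e (h : L2I) : val (Kop h) t = L2ip mu mI01 kt h by rewrite /= koper_good.
by rewrite !e sipDr sipZr.
Qed.
HB.instance Definition _ := GRing.isLinear.Build R L2I L2I *:%R Kop Kop_is_linear.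

Lemma nrm_Kop (f : L2I) : nrm (Kop f) <= Num.sqrt (fine (ksq k)) * nrm f.
Proof.
have k0 : 0 <= fine (ksq k).
  by rewrite -lee_fin -ksq_fin; apply: integral_ge0 => t _; exact: rowsq_ge0.
rewrite -(@ler_pXn2r _ 2)// ?nnegrE ?mulr_ge0 ?sqrtr_ge0 ?nrm_ge0//.
have sq : Num.sqrt (fine (ksq k)) ^+ 2 = fine (ksq k) by rewrite sqr_sqrtr.
rewrite exprMn sq -lee_fin L2nrm_sqrE EFinM -ksq_fin.
exact: koper_sq_le.
Qed.

(** At a good [t] the value is the product of [u n] with a fixed row, so it tends to 0 by weak
    convergence, and its square is dominated by the integrable [rowsq k t * C ^+ 2]. *)
Lemma Kop_cc : compl_continuous (L2ip mu mI01) Kop.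
Proof.
move=> u C uC uw.
have C0 : 0 <= C by apply: le_trans (uC 0%N); exact: nrm_ge0.
have iq : mu.-integrable I (fun t => rowsq k t * (C ^+ 2)%:E)%E.
  under eq_fun do rewrite muleC.
  apply: integrableZl; first exact: mI01.
  apply/integrableP; split; first exact: measurable_rowsq.
  under eq_integral do rewrite gee0_abs ?rowsq_ge0//.
  by case: Lk.
have mK n : measurable_fun I (EFin \o (fun t => (koper k (val (u n)) t) ^+ 2)).
  apply/measurable_EFinP; apply: measurable_funX; apply: measurable_koper.
  by case: (L2P (u n)).
have [] := @dominated_convergence _ _ _ mu I mI01
  (fun n t => ((koper k (val (u n)) t) ^+ 2)%:E) (cst 0%E)
  (fun t => rowsq k t * (C ^+ 2)%:E)%E mK _ _ iq.
- exact: measurable_cst.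
- apply: filterS ae_good_rows => t H It; have gt := H It.
  pose kt : L2I := mkL2 mI01 (good_row_L2 gt).
  apply: cvg_EFin; first by near=> n.
  rewrite -[X in _ --> X](mulr0 0).
  have e n : koper k (val (u n)) t = L2ip mu mI01 (u n) kt.
    by rewrite koper_good// sipC.
  rewrite (_ : fine \o _ = (fun n => L2ip mu mI01 (u n) kt * L2ip mu mI01 (u n) kt)).
    by apply: cvgM; exact: uw.
  by apply/funext => n /=; rewrite e expr2.
- apply: filterS ae_good_rows => t H n It; have gt := H It.
  rewrite gee0_abs ?lee_fin ?sqr_ge0// koper_good//.
  apply: le_trans (kop_CS (u n) gt) _.
  rewrite lee_wpmul2l ?rowsq_ge0// lee_fin lerXn2r ?nnegrE ?nrm_ge0//.
move=> _ _; rewrite integral0 => cv.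
have {}cv : (nrm (Kop (u n)) ^+ 2) @[n --> \oo] --> (0 : R).
  apply: (fine_cvg (f := fun n => (nrm (Kop (u n)) ^+ 2)%:E)).
  by under eq_fun do rewrite L2nrm_sqrE.
apply/cvgr0Pnorm_lt => e e0.
have e2 : 0 < e ^+ 2 by rewrite exprn_gt0.
have /cvgr0Pnorm_lt/(_ _ e2) := cv; apply: filterS => n.
rewrite !ger0_norm ?sqr_ge0 ?nrm_ge0// ltr_pXn2r// ?nnegrE ?nrm_ge0//.
exact: ltW.
Unshelve. all: by end_near. Qed.

End OneKernel.
End KernelOperator.

(** * Bilinear forms of square integrable kernels *)

Section KernelForms.
Context {R : realType}.
Local Notation mu := (@lebesgue_measure R).
Local Notation RR := (measurableTypeR R).
Local Notation I := (@I01 R : set RR).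
Local Notation L2I := (L2 mu (@mI01 R)).
Local Notation L2ip := (L2ip mu (@mI01 R)).
Local Notation nrm := (nrm L2ip).
Implicit Types (k : R -> R -> R).

Lemma nrmB0P (f g : L2I) :
  nrm (f - g) = 0 <-> {ae mu, forall t, I t -> val f t = val g t}.
Proof.
split=> [/L2nrm0P|] h; last apply/L2nrm0P; apply: filterS h => t H It.
  by have /eqP := H It; rewrite valL2B subr_eq0 => /eqP.
by rewrite valL2B H// subrr.
Qed.

Lemma nrm1P (f : L2I) : nrm f = 1 <-> ip (val f) (val f) = 1.
Proof.
rewrite -[ip _ _]/(L2ip f f) -sqr_nrm; split=> [->|]; first by rewrite expr1n.
by move/eqP; rewrite sqrp_eq1 ?nrm_ge0// => /eqP.
Qed.

Lemma eigpair_Kop k (Lk : L2kernel k) lam (x : L2I) :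
  eigpair k lam (val x) <-> nrm x = 1 /\ nrm (Kop Lk x - lam *: x) = 0.
Proof.
split=> [[_ /nrm1P x1 ex]|[x1 /nrmB0P ex]]; split => //.
- apply/nrmB0P; apply: (filterS2 (ae_filter_ringOfSetsType mu) _ ex
    (ae_koper Lk (val x))) => t H1 H2 It.
  by rewrite valL2Z /= H2// H1.
- exact: (L2P x).
- exact/nrm1P.
- apply: (filterS2 (ae_filter_ringOfSetsType mu) _ ex
    (ae_koper Lk (val x))) => t H1 H2 It.
  by rewrite -H2// -valL2Z -H1.
Qed.

Lemma L2kernel_comb (a b : R) k1 k2 : L2kernel k1 -> L2kernel k2 ->
  L2kernel (fun t s => a * k1 t s + b * k2 t s).
Proof.
have mII : @measurable _ (RR * RR)%type (I `*` I) by apply: measurableX; exact: mI01.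
by move=> /L2kernelP L1 /L2kernelP L2; apply/L2kernelP; apply: L2inD => //;
  exact: L2inZ.
Qed.

Lemma L2kernel_tr k : L2kernel k -> L2kernel (fun t s => k s t).
Proof.
move=> [mk qk].
have mkt : measurable_fun (I `*` I) (fun z : RR * RR => k z.2 z.1).
  exact: (measurable_swap_in mI01 mI01 mk).
split; first exact: mkt.
rewrite /ksq (tonelli_in mu mu mI01 mI01 (F := fun z => ((k z.2 z.1) ^+ 2)%:E))//.
  by apply/measurable_EFinP; exact: measurable_funX.
by move=> z _; rewrite lee_fin sqr_ge0.
Qed.

(** The equality is only up to a null function because the three kernels may have different good
    rows. *)
Lemma Kop_comb (a b : R) k1 k2 (L1 : L2kernel k1) (L2 : L2kernel k2)
    (L12 : L2kernel (fun t s => a * k1 t s + b * k2 t s)) (f : L2I) :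
  nrm (Kop L12 f - (a *: Kop L1 f + b *: Kop L2 f)) = 0.
Proof.
apply/nrmB0P.
apply: (filterS3 (ae_filter_ringOfSetsType mu) _ (ae_good_rows L1)
  (ae_good_rows L2) (ae_good_rows L12)).
move=> t H1 H2 H12 It.
have g1 := H1 It; have g2 := H2 It; have g12 := H12 It.
rewrite valL2D !valL2Z /= !koper_good//.
pose t1 : L2I := mkL2 mI01 (good_row_L2 L1 g1).
pose t2 : L2I := mkL2 mI01 (good_row_L2 L2 g2).
rewrite -[kop k1 _ _]/(L2ip t1 f) -[kop k2 _ _]/(L2ip t2 f).
rewrite -!sipZl -sipDl; apply: eq_Rintegral => s _.
by rewrite valL2D !valL2Z.
Qed.

(** A long-run covariance is known only as an L^2 limit of kernels. Its symmetry and positivity are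
    therefore expressed by this form, which is continuous in the kernel ([kform_cvg]). *)
Definition kform k (f g : R -> R) : R := ip (kop k f) g.

Lemma sip_Kop k (Lk : L2kernel k) (f g : L2I) :
  L2ip (Kop Lk f) g = kform k (val f) (val g).
Proof.
have mf : measurable_fun I (val f) by case: (L2P f).
have mg : measurable_fun I (val g) by case: (L2P g).
apply: Rintegral_ae; first exact: mI01.
- by apply: measurable_funM => //; exact: measurable_koper.
- by apply: measurable_funM => //; exact: measurable_kop.
- by apply: (@filterS _ _ (ae_filter_ringOfSetsType mu)) (ae_koper Lk (val f))
    => t H It; rewrite /= H.
Qed.

Lemma kform_le k (Lk : L2kernel k) (f g : L2I) :
  `|kform k (val f) (val g)| <= Num.sqrt (fine (ksq k)) * nrm f * nrm g.
Proof.
rewrite -(sip_Kop Lk); apply: le_trans (sip_le _ _ _) _.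
by rewrite ler_wpM2r ?nrm_ge0// nrm_Kop.
Qed.

Lemma kform_comb (a b : R) k1 k2 (f g : L2I) : L2kernel k1 -> L2kernel k2 ->
  kform (fun t s => a * k1 t s + b * k2 t s) (val f) (val g) =
  a * kform k1 (val f) (val g) + b * kform k2 (val f) (val g).
Proof.
move=> L1 L2; have L12 := L2kernel_comb a b L1 L2.
rewrite -(sip_Kop L12) -(sip_Kop L1) -(sip_Kop L2).
by rewrite (nrmB0_sip _ (Kop_comb L1 L2 L12 f)) sipDl !sipZl.
Qed.

Lemma kernel_combB k1 k2 : (fun t s => 1 * k1 t s + -1 * k2 t s) =
  (fun t s => k1 t s - k2 t s) :> (R -> R -> R).
Proof. by apply/funext => t; apply/funext => s; rewrite mul1r mulN1r. Qed.

Lemma L2kernelB k1 k2 : L2kernel k1 -> L2kernel k2 ->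
  L2kernel (fun t s => k1 t s - k2 t s).
Proof. by move=> L1 L2; rewrite -kernel_combB; exact: L2kernel_comb. Qed.

Lemma kformB k1 k2 (f g : L2I) : L2kernel k1 -> L2kernel k2 ->
  kform (fun t s => k1 t s - k2 t s) (val f) (val g) =
  kform k1 (val f) (val g) - kform k2 (val f) (val g).
Proof.
by move=> L1 L2; rewrite -kernel_combB (kform_comb 1 (-1) f g L1 L2) mul1r mulN1r.
Qed.

Lemma kform_cvg (S : nat -> R -> R -> R) c (f g : L2I) :
  (forall n, L2kernel (S n)) -> L2kernel c ->
  ksq (fun t s => S n t s - c t s) @[n --> \oo] --> 0%E ->
  kform (S n) (val f) (val g) @[n --> \oo] --> kform c (val f) (val g).
Proof.
move=> LS Lc cv.
have LB n := L2kernelB (LS n) Lc.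
have kB n := kformB f g (LS n) Lc.
have cvs : (Num.sqrt (fine (ksq (fun t s => S n t s - c t s))) * nrm f * nrm g)
    @[n --> \oo] --> (0 : R).
  rewrite -[X in _ --> X](mul0r (nrm g)); apply: cvgMr_tmp.
  rewrite -[X in _ --> X](mul0r (nrm f)); apply: cvgMr_tmp.
  rewrite -[X in _ --> X](@sqrtr0 R).
  by apply: continuous_cvg => //; [exact: sqrt_continuous|exact: fine_cvg cv].
apply/cvgrPdist_lt => e e0.
have /cvgr0Pnorm_lt/(_ _ e0) := cvs; apply: filterS => n; apply: le_lt_trans.
rewrite distrC -kB; apply: le_trans (kform_le (LB n) f g) _; exact: ler_norm.
Qed.

Lemma kernel_tensor_fubini k (f g : R -> R) : L2kernel k ->
  L2in mu I f -> L2in mu I g ->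
  let F := fun z : RR * RR => k z.1 z.2 * (g z.1 * f z.2) in
  measurable_fun (I `*` I) F /\
  (\int[mu]_(t in I) \int[mu]_(s in I) `|F (t, s)|%:E < +oo)%E.
Proof.
move=> /L2kernelP Lk Lf Lg.
exact: (L2in_prod_integrable mI01 mI01 Lk (L2in_prod_tensor mI01 mI01 Lg Lf)).
Qed.

Lemma kformE k (f g : L2I) : L2kernel k ->
  kform k (val f) (val g) = fine (\int[mu]_(t in I) \int[mu]_(s in I)
    (k t s * (val g t * val f s))%:E)%E.
Proof.
move=> Lk; have [mF iF] := kernel_tensor_fubini Lk (L2P f) (L2P g).
have [ae1 i1 E] := fubini_in mI01 mI01 mF iF.
rewrite /kform /ip /Rintegral -E; congr fine.
apply: ae_eq_integral; first exact: mI01.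
- apply/measurable_EFinP; apply: measurable_funM; last by case: (L2P g).
  by apply: measurable_kop => //; case: (L2P f).
- by case/integrableP: i1.
apply: filterS (ae_good_rows Lk) => t H It; have gt := H It; congr EFin.
rewrite /= [LHS]mulrC -RintegralZl.
- by apply: eq_Rintegral => s _; rewrite mulrCA.
- exact: mI01.
- exact: (L2in_integrable mI01 (good_row_L2 Lk gt) (L2P f)).
Qed.

Lemma kform_tr k (f g : L2I) : L2kernel k ->
  kform (fun t s => k s t) (val f) (val g) = kform k (val g) (val f).
Proof.
move=> Lk; have Lkt := L2kernel_tr Lk; rewrite (kformE _ _ Lkt) (kformE _ _ Lk).
congr fine.
have [mF iF] := kernel_tensor_fubini Lk (L2P g) (L2P f).
rewrite [RHS](Rfubini_in mI01 mI01 mF iF) /=.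
by apply: eq_integral => t _; apply: eq_integral => s _; rewrite (mulrC (val f _)).
Qed.

End KernelForms.

(** * Stability of the leading eigenpairs of an integral operator *)

Lemma exists_pos_lb (R : realType) (a : nat -> R) n :
  (forall i, (i < n)%N -> 0 < a i) ->
  exists2 g : R, 0 < g & forall i, (i < n)%N -> g <= a i.
Proof.
elim: n => [|n IH] H; first by exists 1.
have [i ni|g g0 hg] := IH; first by apply: H; rewrite ltnW.
exists (Num.min g (a n)); first by rewrite lt_min g0 H.
move=> i; rewrite ltnS leq_eqVlt => /orP[/eqP ->|ni].
  by rewrite ge_min lexx orbT.
by rewrite ge_min hg.
Qed.

Section Stability.
Context {R : realType}.
Local Notation mu := (@lebesgue_measure R).
Local Notation RR := (measurableTypeR R).
Local Notation I := (@I01 R : set RR).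
Local Notation L2I := (L2 mu (@mI01 R)).
Local Notation L2ip := (L2ip mu (@mI01 R)).
Local Notation nrm := (nrm L2ip).

Lemma ae_mono (P Q : R -> Prop) : (forall t, P t -> Q t) ->
  {ae mu, forall t, P t} -> {ae mu, forall t, Q t}.
Proof. by move=> PQ; apply: (@filterS _ _ (ae_filter_ringOfSetsType mu)). Qed.

(** Total, so that whole sequences of functions can be lifted; 0 is a default outside L^2. *)
Definition toL2 (f : R -> R) : L2I :=
  if pselect (L2in mu I f) is left H then mkL2 mI01 H else 0.

Lemma toL2E f : L2fun f -> val (toL2 f) = f.
Proof. by rewrite /toL2; case: pselect. Qed.

Section Fixed.
Context (dk : R -> R -> R) (Ldk : L2kernel dk).
Context (dk_sym : forall f g : L2I,
  kform dk (val f) (val g) = kform dk (val g) (val f)).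
Context (dk_psd : forall f : L2I, 0 <= kform dk (val f) (val f)).
Context (lam : nat -> R) (phi : nat -> R -> R) (p : nat).
Context (lead : leading_eigs dk p.+1 lam phi) (on : orthonormal_fam p.+1 phi).
Context (dec : forall i, (i < p)%N -> lam i.+1 < lam i).

Let phiL i := toL2 (phi i).
Let phiE i : (i <= p)%N -> val (phiL i) = phi i.
Proof. by move=> ip; have [/(_ i ip)[+ _ _] _ _ _] := lead; exact: toL2E. Qed.

Let Dsym x y : L2ip (Kop Ldk x) y = L2ip x (Kop Ldk y).
Proof. by rewrite sip_Kop dk_sym -(sip_Kop Ldk) sipC. Qed.

Let Deig i : (i <= p)%N -> nrm (Kop Ldk (phiL i) - lam i *: phiL i) = 0.
Proof.
move=> ip; have [/(_ i ip) + _ _ _] := lead.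
by rewrite -(phiE ip) => /(eigpair_Kop Ldk) [].
Qed.

Let onL i j : (i < p)%N -> (j < p)%N -> L2ip (phiL i) (phiL j) = (i == j)%:R.
Proof.
move=> ip jp; rewrite L2ipE !phiE ?(ltnW ip) ?(ltnW jp)//.
exact: on (ltnW _) (ltnW _).
Qed.

Lemma lam_last_ge0 : 0 <= lam p.
Proof.
have := dk_psd (phiL p); rewrite -(sip_Kop Ldk) (nrmB0_sip _ (Deig (leqnn p))).
by rewrite sipZl L2ipE phiE// -ipE on// eqxx mulr1.
Qed.

Lemma lam_pos i : (i < p)%N -> 0 < lam i.
Proof.
move=> ip; apply: le_lt_trans lam_last_ge0 _; apply: le_lt_trans (dec ip).
by have [_ + _ _] := lead; apply.
Qed.

Let gapD w : nrm (Kop Ldk (res L2ip p phiL w)) <= lam p * nrm w.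
Proof.
apply: (spectral_gap onL Dsym (lam := lam)).
- by move=> i ip; exact/Deig/ltnW.
- exact: L2_complete.
- by move=> x; rewrite sip_Kop.
- exact: nrm_Kop.
- exact: Kop_cc.
- exact: lam_last_ge0.
move=> nu x lnu x1 ex.
have /(eigpair_Kop Ldk) ep : nrm x = 1 /\ nrm (Kop Ldk x - nu *: x) = 0 by [].
have [_ _ _ /(_ nu (val x) isT ep lnu) [c hc]] := lead.
(* The index [p] drops out of the span because [lam p < nu]; the first [p] eigenfunctions remain. *)
exists (fun i => if lam i == nu then c i else 0); apply/nrmB0P.
apply: ae_mono hc => t H It.
transitivity (\sum_(i < p) (if lam i == nu then c i else 0) * phi i t).
  rewrite H// big_mkcond big_ord_recr/=.
  rewrite (_ : (lam p == nu) = false) ?lt_eqF// addr0; apply: eq_bigr => i _.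
  by case: ifP => //; rewrite mul0r.
rewrite valL2_sum; apply: eq_bigr => i _.
by rewrite valL2Z (phiE (ltnW (ltn_ord i))).
Qed.

(** The minimum expresses closeness up to sign without selecting a sign for each kernel, hence later
    for each outcome. *)
Lemma leading_eigs_stable (eta : R) : (0 < p)%N -> 0 < eta ->
  exists2 e : R, 0 < e & forall k lh (u : nat -> R -> R),
    L2kernel k -> (ksq (fun t s => (k t s - dk t s)%R) < e%:E)%E ->
    leading_eigs k p lh u ->
    forall i, (i < p)%N -> `|lh i - lam i| <= eta /\
      Num.min (nrm (toL2 (u i) - toL2 (phi i))) (nrm (toL2 (u i) + toL2 (phi i)))
        <= eta.
Proof.
move=> p0 eta0.
have [i ip|g g0 hg] := @exists_pos_lb _ (fun i => lam i - lam i.+1) p.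
  by rewrite subr_gt0 dec.
have lamd i j : (i < j)%N -> (j <= p)%N -> g <= lam i - lam j.
  move=> ij jp; apply: le_trans (hg i (leq_trans ij jp)) _.
  by rewrite lerD2l lerN2; have [_ + _ _] := lead; apply.
have [|||e e0 He] := @leading_eigs_perturbation _ _ L2ip
  (@L2_complete _ _ _ mu I mI01) p phiL onL (Kop Ldk) Dsym lam _ (lam p) gapD lam_last_ge0 g g0 _ _ eta p0 eta0.
- by move=> i ip; exact/Deig/ltnW.
- by move=> i ip; exact: lamd.
- by move=> i j ij jp; exact: lamd ij (ltnW jp).
(* [ksq] is the square of the Hilbert-Schmidt norm, which bounds the operator norm. *)
exists (e ^+ 2); first by rewrite exprn_gt0.
move=> k lh u Lk small [ueig lhdec uli umax].
have LB := L2kernelB Lk Ldk.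
have se : Num.sqrt (fine (ksq (fun t s => k t s - dk t s))) <= e.
  have -> : e = Num.sqrt (e ^+ 2) by rewrite sqrtr_sqr ger0_norm// ltW.
  by rewrite ler_sqrt ?sqr_ge0// -lee_fin -ksq_fin//; exact: ltW.
have TD x : nrm (Kop Lk x - Kop Ldk x) <= e * nrm x.
  apply: le_trans (_ : Num.sqrt (fine (ksq (fun t s => k t s - dk t s))) * nrm x <= _).
    apply: le_trans (nrm_Kop LB x); rewrite le_eqVlt; apply/orP; left; apply/eqP.
    apply: nrmB0_nrm; rewrite nrmBC.
    have L' := L2kernel_comb 1 (-1) Lk Ldk.
    have := Kop_comb Lk Ldk L' x; rewrite scale1r scaleN1r => /nrmB0P H.
    apply/nrmB0P; apply: ae_mono H => t H It; rewrite -(H It) /Kop /=.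
    by rewrite (kernel_combB k dk).
  by rewrite ler_wpM2r ?nrm_ge0.
pose uL i := toL2 (u i).
have uE i : (i < p)%N -> val (uL i) = u i.
  by move=> ip; have [+ _ _] := ueig i ip; exact: toL2E.
move=> i il.
have uLeig j : (j < p)%N -> nrm (uL j) = 1 /\
    nrm (Kop Lk (uL j) - lh j *: uL j) = 0.
  by move=> jp; apply/(eigpair_Kop Lk); rewrite uE//; exact: ueig.
have uLli (c : nat -> R) : nrm (\sum_(j < p) c j *: uL j) = 0 ->
    forall j, (j < p)%N -> c j = 0.
  move=> hc; apply: uli; apply: ae_mono (proj1 (L2nrm0P _) hc) => t H It.
  rewrite -[RHS](H It) valL2_sum; apply: eq_bigr => j _.
  by rewrite valL2Z uE.
have uLmax nu x : nrm x = 1 -> nrm (Kop Lk x - nu *: x) = 0 -> lh p.-1 < nu ->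
    exists2 j, (j < p)%N & lh j = nu.
  move=> x1 ex lnu.
  have /(eigpair_Kop Lk) ep : nrm x = 1 /\ nrm (Kop Lk x - nu *: x) = 0 by [].
  have [c hc] := umax nu (val x) p0 ep lnu.
  apply: contrapT => H.
  have : nrm x = 0.
    apply/L2nrm0P; apply: ae_mono hc => t H' It; rewrite H'// big_pred0// => j.
    by apply/negP => /eqP hj; apply: H; exists j.
  by rewrite x1 => /eqP; rewrite oner_eq0.
have [hl [s [s1 hs]]] := He (Kop Lk) lh uL TD uLeig lhdec uLli uLmax i il.
split => //; rewrite ge_min.
move/eqP: s1; rewrite eqr_norml => /andP[/orP[]/eqP sE _]; rewrite sE in hs.
  by rewrite scale1r in hs; rewrite hs.
by rewrite scaleN1r opprK in hs; rewrite hs orbT.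
Qed.

End Fixed.
End Stability.

(** * Stationarity of Bernoulli shifts *)

Lemma same_law_ge0_integral (R : realType) (d d' : measure_display)
    (T : measurableType d) (T' : measurableType d') (P : {measure set T -> \bar R})
    (X Y : T -> T') (h : T' -> \bar R) :
  measurable_fun setT X -> measurable_fun setT Y ->
  (forall B, measurable B -> P (X @^-1` B) = P (Y @^-1` B)) ->
  measurable_fun setT h -> (forall x, (0 <= h x)%E) ->
  (\int[P]_w h (X w) = \int[P]_w h (Y w))%E.
Proof.
move=> mX mY XY mh h0.
have := @ge0_integral_pushforward _ _ _ _ _ X mX P setT h measurableT mh.
have := @ge0_integral_pushforward _ _ _ _ _ Y mY P setT h measurableT mh.
rewrite !preimage_setT => EY EX.
rewrite -[LHS]EX; last by move=> x _; exact: h0.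
rewrite -[RHS]EY; last by move=> x _; exact: h0.
by apply: eq_measure_integral => B mB _; exact: XY.
Qed.

Lemma same_law_Rintegral (R : realType) (d d' : measure_display)
    (T : measurableType d) (T' : measurableType d') (P : {measure set T -> \bar R})
    (X Y : T -> T') (h : T' -> R) :
  measurable_fun setT X -> measurable_fun setT Y ->
  (forall B, measurable B -> P (X @^-1` B) = P (Y @^-1` B)) ->
  measurable_fun setT h ->
  Rintegral P setT (fun w => h (X w)) = Rintegral P setT (fun w => h (Y w)).
Proof.
move=> mX mY XY mh; rewrite /Rintegral; congr fine.
rewrite integralE [RHS]integralE.
have mhE : measurable_fun setT (EFin \o h) by exact/measurable_EFinP.
have E Z : (fun w => (h (Z w))%:E) = (EFin \o h) \o Z :> (T -> \bar R) by [].
congr (_ - _)%E.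
  rewrite (E X) (E Y) (funepos_comp (EFin \o h) X) (funepos_comp (EFin \o h) Y).
  apply: (same_law_ge0_integral (h := (EFin \o h)^\+%E)) => //.
  exact: measurable_funepos.
rewrite (E X) (E Y) (funeneg_comp (EFin \o h) X) (funeneg_comp (EFin \o h) Y).
apply: (same_law_ge0_integral (h := (EFin \o h)^\-%E)) => //.
exact: measurable_funeneg.
Qed.

Section FiniteCylinders.
Context {dS : measure_display} (S : measurableType dS).

(** One-coordinate cylinders are in general not closed under intersection. These are, and they
    generate the same sigma-algebra, so two laws that agree on them are equal. *)
Definition fcyl : set (set (seqS S)) := [set B | exists (n : nat) (A : nat -> set S),
  (forall k, measurable (A k)) /\ B = [set x | forall k, (k < n)%N -> A k (x k)]].

Lemma fcyl_setI : setI_closed fcyl.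
Proof.
move=> _ _ [n1 [A1 [mA1 ->]]] [n2 [A2 [mA2 ->]]].
exists (maxn n1 n2), (fun k => (if (k < n1)%N then A1 k else setT) `&`
  (if (k < n2)%N then A2 k else setT)); split.
  by move=> k; apply: measurableI; case: ifP.
apply/seteqP; split => x /=.
  by move=> [H1 H2] k _; split; case: ifPn => // h; [exact: H1 | exact: H2].
move=> H; split => k kn; have := H k; rewrite leq_max kn ?orbT => /(_ isT) [].
  by [].
by [].
Qed.

Lemma measurable_seqS_fcyl : (@measurable _ (seqS S)) = <<s fcyl >>.
Proof.
have mcyl k (A : set S) : measurable A -> @measurable _ (seqS S) [set x | A (x k)].
  by move=> mA; apply: sub_sigma_algebra; exists k, A.
apply/seteqP; split.
  apply: smallest_sub; first exact: smallest_sigma_algebra.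
  move=> _ [k [A [mA ->]]]; apply: sub_sigma_algebra.
  exists k.+1, (fun i => if i == k then A else setT); split.
    by move=> i; case: ifP.
  apply/seteqP; split => x /= H.
    by move=> i _; case: ifPn => // /eqP ->.
  by have := H k (ltnSn k); rewrite eqxx.
apply: smallest_sub; first exact: sigma_algebra_measurable.
move=> _ [n [A [mA ->]]].
rewrite (_ : [set x | _] = \bigcap_(k in `I_n) [set x | A k (x k)]); last first.
  by apply/seteqP; split => x H k; exact: H.
by apply: fin_bigcap_measurable => // k _; exact: mcyl.
Qed.

End FiniteCylinders.

Section Past.
Context {R : realType} {d dS : measure_display} {Omega : measurableType d}.
Context (P : probability Omega R) {S : measurableType dS}.
Context (delta : int -> Omega -> S) (iidd : iid P delta).

Definition past (j : int) (w : Omega) : seqS S := fun k : nat => delta (j - k%:Z) w.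

Lemma measurable_past j : measurable_fun setT (past j).
Proof.
have [md _ _] := iidd.
apply: (@measurability _ _ Omega (seqS S) setT (past j) (@cyl _ S) erefl).
move=> _ [_ [k [A [mA ->]]] <-].
by have := md (j - k%:Z) measurableT A mA; rewrite !setTI.
Qed.

Let P_past_fcyl j (n : nat) (A : nat -> set S) : (forall k, measurable (A k)) ->
  Pr P (past j @^-1` [set x | forall k, (k < n)%N -> A k (x k)]) =
  \prod_(k <- iota 0 n) Pr P (delta 0 @^-1` A k).
Proof.
move=> mA; have [md same ind] := iidd.
pose J := [seq (j - k%:Z) | k <- iota 0 n].
(* Independence is stated for sets indexed by times; the lag is recovered from the time [z = j - k]
   as the absolute value of [j - z]. *)
pose A' z := A `|j - z|%N.
have A'E k : A' (j - k%:Z) = A k by rewrite /A' opprB addrC subrK.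
have uJ : uniq J.
  by rewrite map_inj_uniq ?iota_uniq// => a b /addrI/oppr_inj [].
transitivity (Pr P [set w | forall z, z \in J -> A' z (delta z w)]).
  congr (Pr P _); apply/seteqP; split => w /= H.
    move=> z /mapP [k]; rewrite mem_iota add0n => /andP[_ kn] ->.
    by rewrite A'E; exact: H.
  move=> k kn; rewrite -A'E; apply: H; apply/mapP; exists k => //.
  by rewrite mem_iota.
rewrite ind//; last by move=> z; exact: mA.
rewrite big_map; apply: eq_bigr => k _.
by rewrite A'E /Pr (same _ 0).
Qed.

Lemma past_law j (B : set (seqS S)) : measurable B ->
  P (past j @^-1` B) = P (past 0 @^-1` B).
Proof.
move=> mB.
pose X1 : {mfun Omega >-> seqS S} :=
  HB.pack (past j) (isMeasurableFun.Build _ _ _ _ _ (measurable_past j)).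
pose X2 : {mfun Omega >-> seqS S} :=
  HB.pack (past 0) (isMeasurableFun.Build _ _ _ _ _ (measurable_past 0)).
have mp i B' : measurable B' -> measurable (past i @^-1` B').
  by move=> mB'; rewrite -[X in measurable X]setTI; exact: measurable_past.
apply: (measure_unique (@fcyl _ S) (fun=> setT) _ _ _ _
  (pushforward P X1) (pushforward P X2)) => //.
- exact: measurable_seqS_fcyl.
- exact: fcyl_setI.
- move=> _; exists 0%N, (fun=> setT); split => //.
  by apply/seteqP; split.
- by rewrite bigcup_const//; exists 0%N.
- move=> A fA; have mA : measurable A.
    by rewrite measurable_seqS_fcyl; exact: sub_sigma_algebra.
  case: fA => n [C [mC AE]]; rewrite AE in mA *.
  rewrite /pushforward /= -[LHS]fineK; last by apply: fin_num_measure; exact: mp.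
  rewrite -[RHS]fineK; last by apply: fin_num_measure; exact: mp.
  by congr EFin; rewrite -!/(Pr P _) !P_past_fcyl.
- move=> _; apply: (@le_lt_trans _ _ (P setT)); last by rewrite probability_setT ltry.
  by rewrite /pushforward.
Qed.

Lemma past_ge0_integral j (h : seqS S -> \bar R) :
  measurable_fun setT h -> (forall x, (0 <= h x)%E) ->
  (\int[P]_w h (past j w) = \int[P]_w h (past 0 w))%E.
Proof.
move=> mh h0; apply: same_law_ge0_integral => //; try exact: measurable_past.
by move=> B mB; exact: past_law.
Qed.

Lemma past_Rintegral j (h : seqS S -> R) : measurable_fun setT h ->
  Rintegral P setT (fun w => h (past j w)) = Rintegral P setT (fun w => h (past 0 w)).
Proof.
move=> mh; apply: same_law_Rintegral => //; try exact: measurable_past.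
by move=> B mB; exact: past_law.
Qed.

(** The history at time [j - n] is obtained from the one at [j] by dropping its [n] latest entries.
    A pair of scores at lag [n] is thus one function of a single history, and the invariance of the
    law of the history gives stationarity. *)
Definition seqshift (n : nat) (x : seqS S) : seqS S := fun k => x (n + k)%N.

Lemma measurable_seqshift n : measurable_fun setT (seqshift n).
Proof.
apply: (@measurability _ _ (seqS S) (seqS S) setT _ (@cyl _ S) erefl).
move=> _ [_ [k [A [mA ->]]] <-].
rewrite setTI; apply: sub_sigma_algebra; exists (n + k)%N, A; split => //.
Qed.

Lemma past_shift (j : int) (n : nat) w : past (j - n%:Z) w = seqshift n (past j w).
Proof. by apply/funext => k; rewrite /past /seqshift PoszD opprD addrA. Qed.

End Past.

(** * Second moments of a Bernoulli shift *)

Section Sample.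
Context {R : realType} {d dS : measure_display} {Omega : measurableType d}.
Context (P : probability Omega R) {S : measurableType dS}.
Context (f : (nat -> S) -> R -> R) (delta : int -> Omega -> S).
Context (iidd : iid P delta).
Context (mf : measurable_fun setT (fun p : seqS S * R => f p.1 p.2)).
Context (Lf : forall x, L2fun (f x)).
Context (f2 : (\int[lebesgue_measure]_(t in I01)
   \int[P]_w ((bshift f delta 0 w t) ^+ 2)%:E < +oo)%E).

Local Notation mu := (@lebesgue_measure R).
Local Notation RR := (measurableTypeR R).
Local Notation I := (@I01 R : set RR).
Local Notation L2I := (L2 mu (@mI01 R)).
Local Notation ipI := (L2ip mu (@mI01 R)).
Local Notation nrm := (nrm ipI).
Local Notation eps := (bshift f delta).

Definition epsL i w : L2I := mkL2 mI01 (Lf (past delta i w)).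

Lemma measurable_f : measurable_fun setT (fun z : seqS S * RR => f z.1 z.2).
Proof. exact: mf. Qed.

Lemma measurable_eps i : measurable_fun setT (fun z : Omega * RR => eps i z.1 z.2).
Proof.
have mp : measurable_fun setT (fun z : Omega * RR => (past delta i z.1, z.2)).
  apply: measurable_fun_pair; last exact: measurable_snd.
  exact: measurableT_comp (measurable_past iidd i) measurable_fst.
exact: (measurableT_comp measurable_f mp).
Qed.

Let fsq (x : seqS S) : \bar R := (\int[mu]_(t in I) ((f x t) ^+ 2)%:E)%E.

Let measurable_fsq : measurable_fun setT fsq.
Proof.
apply: (measurable_int_section mu measurableT mI01
  (F := fun z : seqS S * RR => ((f z.1 z.2) ^+ 2)%:E)).
  apply/measurable_EFinP; apply: measurable_funX.
  exact: measurable_funS measurable_f.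
by move=> z _; rewrite lee_fin sqr_ge0.
Qed.

Definition eps_sq : \bar R := (\int[P]_w fsq (past delta 0 w))%E.

Let fsqE i w : fsq (past delta i w) = ((nrm (epsL i w)) ^+ 2)%:E.
Proof. by rewrite L2nrm_sqrE. Qed.

Lemma eps_sq_moment i : (\int[P]_w ((nrm (epsL i w)) ^+ 2)%:E = eps_sq)%E.
Proof.
under eq_integral do rewrite -fsqE.
apply: (past_ge0_integral iidd) => // x.
by apply: integral_ge0 => t _; rewrite lee_fin sqr_ge0.
Qed.

Let measurable_eps_sq i :
  measurable_fun (setT `*` I) (fun z : Omega * RR => ((eps i z.1 z.2) ^+ 2)%:E).
Proof.
apply/measurable_EFinP; apply: measurable_funX.
exact: measurable_funS (measurable_eps i).
Qed.

Lemma eps_sq_lty : (eps_sq < +oo)%E.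
Proof.
apply: le_lt_trans f2.
rewrite -(tonelli_in P mu measurableT mI01
  (F := fun z : Omega * RR => ((eps 0 z.1 z.2) ^+ 2)%:E))//.
by move=> z _; rewrite lee_fin sqr_ge0.
Qed.

Lemma eps_L2prod i : L2in (P \x mu)%E (setT `*` I)
  (fun z : Omega * RR => eps i z.1 z.2).
Proof.
apply/(L2in_prodP P mu measurableT mI01); split.
  exact: measurable_funS (measurable_eps i).
rewrite (_ : (\int[P]_w _)%E = (\int[P]_w ((nrm (epsL i w)) ^+ 2)%:E)%E); last first.
  by apply: eq_integral => w _; rewrite L2nrm_sqrE.
by rewrite eps_sq_moment eps_sq_lty.
Qed.

Definition vareps i (t : RR) : \bar R := (\int[P]_w ((eps i w t) ^+ 2)%:E)%E.

Lemma vareps_ge0 i t : (0 <= vareps i t)%E.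
Proof. by apply: integral_ge0 => w _; rewrite lee_fin sqr_ge0. Qed.

Lemma measurable_vareps i : measurable_fun I (vareps i).
Proof.
have msw : measurable_fun (I `*` setT)
    (fun z : RR * Omega => ((eps i z.2 z.1) ^+ 2)%:E).
  apply/measurable_EFinP; apply: measurable_funX.
  apply: (measurable_funS measurableT) => //.
  exact: (measurableT_comp (measurable_eps i) (@measurable_swap _ _ RR Omega)).
apply: (measurable_int_section P mI01 measurableT msw).
by move=> z _; rewrite lee_fin sqr_ge0.
Qed.

Lemma int_vareps i : (\int[mu]_(t in I) vareps i t = eps_sq)%E.
Proof.
rewrite -(eps_sq_moment i).
rewrite -(tonelli_in P mu measurableT mI01
  (F := fun z : Omega * RR => ((eps i z.1 z.2) ^+ 2)%:E))//.
  by apply: eq_integral => w _; rewrite L2nrm_sqrE.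
by move=> z _; rewrite lee_fin sqr_ge0.
Qed.

Lemma ae_vareps i : {ae mu, forall t, I t -> (vareps i t < +oo)%E}.
Proof.
have iv : mu.-integrable I (vareps i).
  apply/integrableP; split; first exact: measurable_vareps.
  under eq_integral do rewrite gee0_abs ?vareps_ge0//.
  by rewrite int_vareps eps_sq_lty.
apply: ae_mono (integrable_ae mI01 iv) => t H It.
by rewrite ltey_eq H.
Qed.

Lemma eps_section_L2 i t : (vareps i t < +oo)%E -> L2in P setT (fun w => eps i w t).
Proof.
move=> v; split => //.
exact: (measurableT_comp (measurable_eps i) (measurable_pair2 t)).
Qed.

Let L2P' := L2 P (@measurableT _ Omega).

Lemma measurable_autocov h : measurable_fun (I `*` I)
  (fun z : RR * RR => autocov P f delta h z.1 z.2).
Proof.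
apply: (measurable_funS measurableT) => //.
apply: (measurable_Rint_section P measurableT measurableT
  (F := fun z : (RR * RR) * Omega => eps 0 z.2 z.1.1 * eps h%:Z z.2 z.1.2)).
have m1 : measurable_fun setT (fun z : (RR * RR) * Omega => (z.2, z.1.1)).
  apply: measurable_fun_pair; first exact: measurable_snd.
  exact: (measurableT_comp measurable_fst measurable_fst).
have m2 : measurable_fun setT (fun z : (RR * RR) * Omega => (z.2, z.1.2)).
  apply: measurable_fun_pair; first exact: measurable_snd.
  exact: (measurableT_comp measurable_snd measurable_fst).
apply: (measurable_funS measurableT) => //; apply: measurable_funM.
  exact: (measurableT_comp (measurable_eps 0) m1).
exact: (measurableT_comp (measurable_eps h%:Z) m2).
Qed.

Lemma autocov_CS h t s : (vareps 0 t < +oo)%E -> (vareps h%:Z s < +oo)%E ->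
  (((autocov P f delta h t s) ^+ 2)%:E <= vareps 0 t * vareps h%:Z s)%E.
Proof.
move=> vt vs.
pose a : L2P' := mkL2 measurableT (eps_section_L2 vt).
pose b : L2P' := mkL2 measurableT (eps_section_L2 vs).
have -> : vareps 0 t = (L2ip P measurableT a a)%:E by rewrite L2ip_sqrE.
have -> : vareps h%:Z s = (L2ip P measurableT b b)%:E by rewrite L2ip_sqrE.
by rewrite -EFinM lee_fin; exact: (sip_CS (L2ip P measurableT) a b).
Qed.

(** Cauchy-Schwarz over the probability space bounds the squared kernel by [vareps 0 t * vareps h s]
    for almost all [t] and [s], and the double integral of this product is the square of
    [eps_sq]. *)
Lemma L2kernel_autocov h : L2kernel (autocov P f delta h).
Proof.
split; first exact: measurable_autocov.
have mac := measurable_autocov h.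
have E1 : (\int[mu]_(t in I) (eps_sq * vareps 0 t) = eps_sq * eps_sq)%E.
  rewrite ge0_integralZl//.
  - by rewrite int_vareps.
  - exact: mI01.
  - exact: measurable_vareps.
  - by move=> t _; exact: vareps_ge0.
  - by rewrite -(int_vareps 0); apply: integral_ge0 => t _; exact: vareps_ge0.
have es0 : (0 <= eps_sq)%E.
  by rewrite -(int_vareps 0); apply: integral_ge0 => t _; exact: vareps_ge0.
apply: (@le_lt_trans _ _ (eps_sq * eps_sq)%E); last first.
  by apply: lte_mul_pinfty => //; rewrite ?ge0_fin_numE// eps_sq_lty.
rewrite -E1; apply: ae_ge0_le_integral.
- exact: mI01.
- by move=> t _; apply: integral_ge0 => s _; rewrite lee_fin sqr_ge0.
- apply: (measurable_int_section mu mI01 mI01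
    (F := fun z : RR * RR => ((autocov P f delta h z.1 z.2) ^+ 2)%:E)).
    by apply/measurable_EFinP; exact: measurable_funX.
  by move=> z _; rewrite lee_fin sqr_ge0.
- by move=> t _; rewrite mule_ge0 ?vareps_ge0.
- by apply: emeasurable_funM => //; exact: measurable_vareps.
apply: ae_mono (ae_vareps 0) => t H It; have vt := H It.
have -> : (eps_sq * vareps 0 t = \int[mu]_(s in I) (vareps 0 t * vareps h%:Z s))%E.
  rewrite ge0_integralZl//.
  - by rewrite int_vareps muleC.
  - exact: mI01.
  - exact: measurable_vareps.
  - by move=> s _; exact: vareps_ge0.
  - exact: vareps_ge0.
apply: ae_ge0_le_integral.
- exact: mI01.
- by move=> s _; rewrite lee_fin sqr_ge0.
- apply/measurable_EFinP; apply: measurable_funX.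
  exact: (measurable_section1 mI01 mI01 mac It).
- by move=> s _; rewrite mule_ge0 ?vareps_ge0.
- by apply: emeasurable_funM => //; exact: measurable_vareps.
apply: ae_mono (ae_vareps h%:Z) => s H' Is; exact: (autocov_CS vt (H' Is)).
Qed.

Local Notation ipP := (L2ip P (@measurableT _ Omega)).

Let fscore (g : L2I) (x : seqS S) : R := ip (f x) (val g).

Let measurable_fscore g : measurable_fun setT (fscore g).
Proof.
apply: (measurable_Rint_section mu measurableT mI01
  (F := fun z : seqS S * RR => f z.1 z.2 * val g z.2)).
apply: measurable_funM; first exact: measurable_funS measurable_f.
apply: (measurable_comp (F := I)); first exact: mI01.
- by move=> _ [z [_ Iz] <-].
- by case: (L2P g).
- exact: measurable_funS measurable_snd.
Qed.

Definition score (g : L2I) i (w : Omega) : R := ipI (epsL i w) g.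

Let scoreE g i w : score g i w = fscore g (past delta i w). Proof. by []. Qed.

Lemma measurable_score g i : measurable_fun setT (score g i).
Proof. exact: (measurableT_comp (measurable_fscore g) (measurable_past iidd i)). Qed.

Lemma measurable_nrm_eps_sq i : measurable_fun setT (fun w => (nrm (epsL i w)) ^+ 2).
Proof.
apply/measurable_EFinP; rewrite (_ : EFin \o _ = fsq \o past delta i).
  exact: (measurableT_comp measurable_fsq (measurable_past iidd i)).
by apply/funext => w /=; rewrite fsqE.
Qed.

Lemma score_L2 g i : L2in P setT (score g i).
Proof.
split; first exact: measurable_score.
have mn : measurable_fun setT (EFin \o (fun w => (nrm (epsL i w)) ^+ 2)).
  by apply/measurable_EFinP; exact: measurable_nrm_eps_sq.
apply: (@le_lt_trans _ _ ((nrm g ^+ 2)%:E * eps_sq)%E); last first.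
  by apply: lte_mul_pinfty => //; rewrite ?lee_fin ?sqr_ge0// eps_sq_lty.
rewrite -(eps_sq_moment i) -ge0_integralZl//; last 2 first.
- by move=> w _; rewrite lee_fin sqr_ge0.
- by rewrite lee_fin sqr_ge0.
- apply: ge0_le_integral => //.
  + by move=> w _; rewrite lee_fin sqr_ge0.
  + apply/measurable_EFinP; apply: measurable_funX; exact: measurable_score.
  + by apply: emeasurable_funM.
  + move=> w _; rewrite -EFinM lee_fin !sqr_nrm mulrC; exact: sip_CS.
Qed.

Definition scoreL g i : L2P' := mkL2 measurableT (score_L2 g i).

Lemma score_stationary g (i n : nat) :
  ipP (scoreL g i%:Z) (scoreL g (i + n)%:Z) = ipP (scoreL g 0) (scoreL g n%:Z).
Proof.
pose h (x : seqS S) := fscore g (seqshift n x) * fscore g x.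
have mh : measurable_fun setT h.
  apply: measurable_funM => //.
  exact: (measurableT_comp (measurable_fscore g) (measurable_seqshift n)).
have E (j : nat) : ipP (scoreL g j%:Z) (scoreL g (j + n)%:Z) =
    Rintegral P setT (fun w => h (past delta (j + n)%:Z w)).
  rewrite L2ipE /ipin; apply: eq_Rintegral => w _.
  rewrite /h -past_shift /= !scoreE; congr (fscore g (past delta _ w) * _).
  by rewrite PoszD addrK.
have := E 0%N; rewrite add0n => ->; rewrite E.
by rewrite (past_Rintegral iidd (i + n)%:Z mh) (past_Rintegral iidd n%:Z mh).
Qed.

Lemma score_autocov g h :
  ipP (scoreL g 0) (scoreL g h%:Z) = kform (autocov P f delta h) (val g) (val g).
Proof.
have Lac := L2kernel_autocov h.
have Lact := L2kernel_tr Lac.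
(* The first exchange of integrals puts outside the variable [s] of the later error, which
   corresponds to the transposed kernel. *)
rewrite -(kform_tr g g Lac).
have mg : measurable_fun I (val g) by case: (L2P g).
have Lt1 := L2in_prod_tensor measurableT mI01 (score_L2 g 0) (L2P g).
have [mF1 iF1] := L2in_prod_integrable measurableT mI01 Lt1 (eps_L2prod h%:Z).
have E1 := Rintegral_fubini measurableT mI01 mF1 iF1.
transitivity (Rintegral P setT (fun w => Rintegral mu I (fun s =>
    score g 0 w * val g s * eps h%:Z w s))).
  apply: eq_Rintegral => w _; rewrite /= /score L2ipE /ipin.
  rewrite -RintegralZl.
  - by apply: eq_Rintegral => s _; rewrite -!mulrA; congr (_ * _); rewrite mulrC.
  - exact: mI01.
  - exact: (L2in_integrable mI01 (L2P _) (L2P g)).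
rewrite E1 /=; apply: Rintegral_ae.
- exact: mI01.
- exact: (measurable_Rint_section2 P measurableT mI01 mF1).
- by apply: measurable_funM => //; exact: (measurable_kop Lact).
apply: ae_mono (ae_vareps h%:Z) => s H Is; have vs := H Is.
have Ls := eps_section_L2 vs.
transitivity (val g s * Rintegral P setT (fun w => eps h%:Z w s * score g 0 w)).
  rewrite -RintegralZl//.
  - by apply: eq_Rintegral => w _; rewrite mulrAC mulrC [X in _ * X]mulrC.
  - exact: (L2in_integrable measurableT Ls (score_L2 g 0)).
rewrite mulrC; congr (_ * _).
have Lt2 := L2in_prod_tensor measurableT mI01 Ls (L2P g).
have [mF2 iF2] := L2in_prod_integrable measurableT mI01 Lt2 (eps_L2prod 0).
have E2 := Rintegral_fubini measurableT mI01 mF2 iF2.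
transitivity (Rintegral P setT (fun w => Rintegral mu I (fun t =>
    eps h%:Z w s * val g t * eps 0 w t))).
  apply: eq_Rintegral => w _; rewrite /score L2ipE /ipin -RintegralZl.
  - by apply: eq_Rintegral => t _; rewrite -!mulrA; congr (_ * _); rewrite mulrC.
  - exact: mI01.
  - exact: (L2in_integrable mI01 (L2P _) (L2P g)).
rewrite E2 /=; apply: Rintegral_ae.
- exact: mI01.
- exact: (measurable_Rint_section2 P measurableT mI01 mF2).
- apply: measurable_funM => //.
  exact: (measurable_section1 mI01 mI01 (proj1 Lact) Is).
apply: ae_mono (ae_vareps 0) => t H' It; have vt := H' It.
rewrite mulrC /autocov -RintegralZl//.
- by apply: eq_Rintegral => w _; ring.
- exact: (L2in_integrable measurableT (eps_section_L2 vt) Ls).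
Qed.

End Sample.

(** * Long-run covariance and sample means *)

(** Grouping the pairs by their larger index instead of their lag replaces the Fejer weights by a
    plain sum: adding the next vector contributes its square and twice its products with all earlier
    ones. Divided by [N], this is a Cesaro mean of partial sums. *)
Lemma fejer_sum (R : realType) (V : lmodType R) (ip : semi_inner V) (z : nat -> V)
    (gam : nat -> R) : (forall i n, ip (z i) (z (i + n)%N) = gam n) ->
  forall N, ip (\sum_(1 <= i < N.+1) z i) (\sum_(1 <= i < N.+1) z i) =
    \sum_(0 <= n < N) (gam 0%N + 2 * \sum_(1 <= h < n.+1) gam h).
Proof.
move=> zg; elim=> [|N IH]; first by rewrite !big_nil sip0l.
rewrite [in RHS]big_nat_recr//= -IH !(big_nat_recr N.+1)//=.
set s := \sum_(1 <= i < N.+1) z i.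
have cross : ip s (z N.+1) = \sum_(1 <= h < N.+1) gam h.
  rewrite /s sip_suml [RHS]big_nat_rev/=; apply: eq_big_nat => i /andP[i1 iN].
  by rewrite add1n subSS -(zg i) subnKC// ltnW.
have last : ip (z N.+1) (z N.+1) = gam 0%N by rewrite -(zg N.+1) addn0.
by rewrite sipDl !sipDr (sipC _ (z N.+1) s) cross last; ring.
Qed.

Section LongRun.
Context {R : realType} {d dS : measure_display} {Omega : measurableType d}.
Context (P : probability Omega R) {S : measurableType dS}.
Context (f : (nat -> S) -> R -> R) (delta : int -> Omega -> S).
Context (iidd : iid P delta).
Context (mf : measurable_fun setT (fun p : seqS S * R => f p.1 p.2)).
Context (Lf : forall x, L2fun (f x)).
Context (f2 : (\int[lebesgue_measure]_(t in I01)
   \int[P]_w ((bshift f delta 0 w t) ^+ 2)%:E < +oo)%E).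

Local Notation mu := (@lebesgue_measure R).
Local Notation L2I := (L2 mu (@mI01 R)).
Local Notation ipI := (L2ip mu (@mI01 R)).
Local Notation nrm := (nrm ipI).
Local Notation ipP := (L2ip P (@measurableT _ Omega)).
Local Notation epsL := (epsL delta Lf).
Local Notation scoreL := (scoreL iidd mf Lf f2).
Local Notation ac := (autocov P f delta).

Definition acsum n t s : R :=
  ac 0 t s + \sum_(1 <= h < n.+1) (ac h t s + ac h s t).

Let Lac h : L2kernel (ac h) := L2kernel_autocov iidd mf Lf f2 h.

Let acsumS n : acsum n.+1 = (fun t s => 1 * acsum n t s +
  1 * (1 * ac n.+1 t s + 1 * (fun t s => ac n.+1 s t) t s)).
Proof.
apply/funext => t; apply/funext => s.
by rewrite /acsum big_nat_recr//= addrA !mul1r.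
Qed.

Let acsum0 : acsum 0 = ac 0.
Proof. by apply/funext => t; apply/funext => s; rewrite /acsum big_nil addr0. Qed.

Lemma L2kernel_acsum n : L2kernel (acsum n).
Proof.
elim: n => [|n IH]; first by rewrite acsum0.
rewrite acsumS; apply: (L2kernel_comb 1 1 IH).
exact: (L2kernel_comb 1 1 (Lac n.+1) (L2kernel_tr (Lac n.+1))).
Qed.

Lemma acsumC n t s : acsum n t s = acsum n s t.
Proof.
rewrite /acsum; congr (_ + _); last by apply: eq_bigr => h _; rewrite addrC.
by apply: eq_Rintegral => w _; rewrite mulrC.
Qed.

Lemma kform_acsumC n (g g' : L2I) :
  kform (acsum n) (val g) (val g') = kform (acsum n) (val g') (val g).
Proof.
rewrite -(kform_tr g g' (L2kernel_acsum n)).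
by rewrite (_ : (fun t s => acsum n s t) = acsum n)//;
  apply/funext => t; apply/funext => s; exact: acsumC.
Qed.

(** A kernel and its transpose agree on the diagonal of the form, hence the factor 2. *)
Lemma kform_acsum n (g : L2I) : kform (acsum n) (val g) (val g) =
  ipP (scoreL g 0) (scoreL g 0) +
  2 * \sum_(1 <= h < n.+1) ipP (scoreL g 0) (scoreL g h%:Z).
Proof.
elim: n => [|n IH].
  by rewrite acsum0 big_nil mulr0 addr0 (score_autocov iidd mf Lf f2 g 0).
have L1 := L2kernel_comb 1 1 (Lac n.+1) (L2kernel_tr (Lac n.+1)).
rewrite acsumS (kform_comb 1 1 g g (L2kernel_acsum n) L1).
rewrite (kform_comb 1 1 g g (Lac n.+1) (L2kernel_tr (Lac n.+1))).
rewrite (kform_tr g g (Lac n.+1)) -(score_autocov iidd mf Lf f2 g n.+1) IH.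
rewrite !mul1r [in RHS]big_nat_recr; last by [].
rewrite [in RHS]mulrDr [RHS]addrA; congr (_ + _).
by rewrite mulr_natl mulr2n.
Qed.

Definition ebar N w : L2I := N%:R^-1 *: \sum_(1 <= i < N.+1) epsL i%:Z w.

Lemma val_ebar N w t :
  val (ebar N w) t = N%:R^-1 * \sum_(1 <= i < N.+1) bshift f delta i%:Z w t.
Proof. by rewrite valL2Z valL2_sum. Qed.

Definition ebar_score (g : L2I) N := N%:R^-1 *: \sum_(1 <= i < N.+1) scoreL g i%:Z.

Lemma val_ebar_score g N w : val (ebar_score g N) w = ipI (ebar N w) g.
Proof.
rewrite /ebar_score valL2Z valL2_sum /ebar sipZl sip_suml; congr (_ * _).
Qed.

Lemma ebar_score_sq g N : ipP (ebar_score g N) (ebar_score g N) =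
  N%:R^-1 * (N%:R^-1 * \sum_(0 <= n < N) kform (acsum n) (val g) (val g)).
Proof.
rewrite sipZl sipZr; congr (_ * (_ * _)).
rewrite (fejer_sum (gam := fun h => ipP (scoreL g 0) (scoreL g h%:Z))).
  by apply: eq_bigr => n _; rewrite kform_acsum.
by move=> i n; exact: score_stationary.
Qed.

Context (c : R -> R -> R) (lrc : is_lrcov P f delta c).

Lemma acsum_cvg (g g' : L2I) :
  kform (acsum n) (val g) (val g') @[n --> \oo] --> kform c (val g) (val g').
Proof.
have [Lc cv] := lrc.
exact: (@kform_cvg R acsum c g g' L2kernel_acsum Lc cv).
Qed.

Lemma lrcov_sym (g g' : L2I) : kform c (val g) (val g') = kform c (val g') (val g).
Proof.
have h := @acsum_cvg g g'; have h' := @acsum_cvg g' g.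
have E : (fun n => kform (acsum n) (val g) (val g')) =
    (fun n => kform (acsum n) (val g') (val g)).
  by apply/funext => n; exact: kform_acsumC.
by rewrite E in h; exact: (cvg_unique _ h h').
Qed.

Let mean_cvg (g : L2I) :
  (n%:R^-1 * \sum_(0 <= m < n) kform (acsum m) (val g) (val g)) @[n --> \oo] -->
  kform c (val g) (val g).
Proof.
rewrite -(cvg_shiftS (fun n => n%:R^-1 *
  \sum_(0 <= m < n) kform (acsum m) (val g) (val g) : R)).
exact: cesaro (@acsum_cvg g g).
Qed.

(** The value is the limit of [n^-1] times the second moment of the sum of [n] scores. *)
Lemma lrcov_psd (g : L2I) : 0 <= kform c (val g) (val g).
Proof.
have h := @mean_cvg g.
rewrite -(cvg_lim _ h)//; apply: limr_ge; first by apply/cvg_ex; eexists; exact: h.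
near=> n.
have := sip_ge0 ipP (\sum_(1 <= i < n.+1) scoreL g i%:Z).
rewrite (fejer_sum (gam := fun h => ipP (scoreL g 0) (scoreL g h%:Z))); last first.
  by move=> i m; exact: score_stationary.
move=> H; rewrite mulr_ge0 ?invr_ge0//.
by under eq_bigr do rewrite kform_acsum.
Unshelve. all: by end_near. Qed.

(** The second moment is [N^-1] times a Cesaro mean with a finite limit. *)
Lemma ebar_score_cvg (g : L2I) :
  ipP (ebar_score g N) (ebar_score g N) @[N --> \oo] --> (0 : R).
Proof.
rewrite (_ : (fun N => _) = (fun N => N%:R^-1 * (N%:R^-1 *
    \sum_(0 <= n < N) kform (acsum n) (val g) (val g)))); last first.
  by apply/funext => N; exact: ebar_score_sq.
rewrite -[X in _ --> X](mul0r (kform c (val g) (val g))).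
apply: cvgM; last exact: mean_cvg.
by rewrite -(cvg_shiftS (fun n => n%:R^-1 : R)); exact: cvg_harmonic.
Qed.

(** A bound for the norm of [ebar], from [a <= 1 + a^2]. It involves only squared norms, whose
    measurability and common expectation are already known, so its mean is bounded uniformly in
    [N]. *)
Definition ebar_dom N w : R :=
  N%:R^-1 * \sum_(1 <= i < N.+1) (1 + nrm (epsL i%:Z w) ^+ 2).

Lemma nrm_ebar_le N w : nrm (ebar N w) <= ebar_dom N w.
Proof.
rewrite /ebar nrmZ ger0_norm ?invr_ge0// ler_wpM2l ?invr_ge0//.
apply: le_trans (nrm_sum _ _ _ _) _; apply: ler_sum => i _.
have := sqr_ge0 (nrm (epsL i%:Z w) - 1); set a := nrm _; nra.
Qed.

Lemma measurable_ebar_dom N : measurable_fun setT (ebar_dom N).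
Proof.
apply: measurable_funM => //; apply: measurable_sum => i.
by apply: measurable_funD => //; exact: (measurable_nrm_eps_sq iidd mf Lf).
Qed.

Lemma ebar_dom_ge0 N w : 0 <= ebar_dom N w.
Proof. exact: le_trans (nrm_ge0 _ _) (nrm_ebar_le N w). Qed.

Lemma ebar_dom_moment N : (\int[P]_w (ebar_dom N w)%:E <= 1 + eps_sq P f delta)%E.
Proof.
have es0 : (0 <= 1 + eps_sq P f delta)%E.
  rewrite adde_ge0// -(eps_sq_moment iidd mf Lf 0).
  by apply: integral_ge0 => w _; rewrite lee_fin sqr_ge0.
have E i : (\int[P]_w (1 + nrm (epsL i w) ^+ 2)%:E = 1 + eps_sq P f delta)%E.
  under eq_integral do rewrite EFinD.
  rewrite ge0_integralD//.
  - rewrite integral_cst//; congr (_ + _)%E; last exact: (eps_sq_moment iidd mf Lf).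
    by rewrite -[RHS]mule1; congr (_ * _)%E; exact: probability_setT.
  - by move=> w _; rewrite lee_fin sqr_ge0.
  - by apply/measurable_EFinP; exact: (measurable_nrm_eps_sq iidd mf Lf).
under eq_integral do rewrite EFinM -sumEFin.
have mt i : measurable_fun setT (EFin \o (fun w => 1 + nrm (epsL i w) ^+ 2)).
  apply/measurable_EFinP; apply: measurable_funD => //.
  exact: (measurable_nrm_eps_sq iidd mf Lf).
have t0 i w : (0 <= (1 + nrm (epsL i w) ^+ 2)%:E)%E.
  by rewrite lee_fin addr_ge0// sqr_ge0.
rewrite ge0_integralZl//; last 2 first.
- by apply: emeasurable_sum => i; exact: mt.
- by move=> w _; apply: sume_ge0.
rewrite ge0_integral_sum//; last by move=> i; exact: mt.
rewrite (eq_bigr (fun=> (1 + eps_sq P f delta)%E)); last by move=> i _; rewrite E.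
have Kfin : (1 + eps_sq P f delta)%E = (fine (1 + eps_sq P f delta))%:E.
  rewrite fineK// ge0_fin_numE//; apply: lte_add_pinfty; first exact: ltry.
  exact: (eps_sq_lty iidd mf f2).
rewrite Kfin in es0 *; rewrite sumEFin -EFinM lee_fin sumr_const_nat subn1 /=.
case: N => [|N]; first by rewrite invr0 mul0r -lee_fin.
by rewrite -[fine _ *+ _]mulr_natl mulrA mulVf ?pnatr_eq0// mul1r.
Qed.

End LongRun.

(** * Convergence in probability as convergence along a filter *)

Section HighProbability.
Context {R : realType} {d : measure_display} {Omega : measurableType d}.
Context (P : probability Omega R).

(* Sets of pairs (k, w) whose k-th section has inner probability tending to 1:
   convergence along this filter is convergence in probability. *)
Definition whp : set_system (nat * Omega) := fun A =>
  forall dl : R, 0 < dl -> \forall k \near \oo, exists B : set Omega,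
    [/\ measurable B, (P (~` B) <= dl%:E)%E & forall w, B w -> A (k, w)].

Global Instance whp_filter : Filter whp.
Proof.
split.
- move=> dl dl0; near=> k; exists setT; split => //.
  by rewrite setCT measure0 lee_fin ltW.
- move=> A B hA hB dl dl0; have dl2 : 0 < dl / 2 by rewrite divr_gt0.
  have := hA _ dl2; have := hB _ dl2; apply: filterS2 => k.
  move=> [C [mC PC CA]] [C' [mC' PC' CA']]; exists (C `&` C'); split.
  + exact: measurableI.
  + rewrite setCI; apply: le_trans (measureU2 _ _ _) _; try exact: measurableC.
    by rewrite [dl]splitr EFinD leeD.
  + by move=> w [Cw Cw']; split; [exact: CA' | exact: CA].
- move=> A B AB hA dl dl0; have := hA _ dl0; apply: filterS => k [C [mC PC CA]].
  by exists C; split => // w /CA; exact: AB.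
Unshelve. all: by end_near. Qed.

Lemma whp_near (A : nat -> Prop) : (\forall k \near \oo, A k) ->
  whp (fun z => A z.1).
Proof.
move=> hA dl dl0; apply: filterS hA => k Ak; exists setT; split => //.
by rewrite setCT measure0 lee_fin ltW.
Qed.

Lemma whp_measurable (A : nat -> set Omega) : (forall k, measurable (A k)) ->
  (Pr P (~` A k) @[k --> \oo] --> (0 : R)) -> whp (fun z => A z.1 z.2).
Proof.
move=> mA cv dl dl0; have /cvgr0Pnorm_lt/(_ _ dl0) := cv; apply: filterS => k h.
exists (A k); split => //; have mC := measurableC (mA k).
rewrite -[P _]fineK ?fin_num_measure// lee_fin ltW//.
by apply: le_lt_trans h; exact: ler_norm.
Qed.

Lemma whp_Pr (A : nat -> set Omega) : (forall k, measurable (A k)) ->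
  whp (fun z => A z.1 z.2) -> Pr P (~` A k) @[k --> \oo] --> (0 : R).
Proof.
move=> mA hA; apply/cvgr0Pnorm_le => dl dl0.
have := hA _ dl0; apply: filterS => k [B [mB PB BA]].
have mC := measurableC (mA k).
rewrite ger0_norm ?fine_ge0// -lee_fin /Pr fineK ?fin_num_measure//.
apply: le_trans PB; apply: le_measure; rewrite ?inE//; first exact: measurableC.
by apply: subsetC => w Bw; exact: BA.
Qed.

Lemma cvg_in_prob_whp (Y : nat -> Omega -> R) (y : R) :
  (forall k, measurable_fun setT (Y k)) ->
  Y z.1 z.2 @[z --> whp] --> y -> cvg_in_prob P Y y.
Proof.
move=> mY cv e e0.
have mA k : measurable [set w | `|Y k w - y| < e].
  have m : measurable_fun setT (fun w => `|Y k w - y|).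
    by apply: measurableT_comp => //; exact: measurable_funB.
  have := m measurableT _ (measurable_itv `]-oo, e[); rewrite setTI.
  by congr measurable; apply/seteqP; split => w /=; rewrite in_itv/=.
have hA : whp (fun z => [set w | `|Y z.1 w - y| < e] z.2).
  have /cvgrPdist_lt/(_ _ e0) := cv; apply: (@filterS _ _ whp_filter) => z /=.
  by rewrite distrC.
have := whp_Pr mA hA.
rewrite (_ : (fun k => Pr P (~` _)) = (fun k => Pr P [set w | e <= `|Y k w - y|]))//.
apply/funext => k; congr (Pr P _); apply/seteqP; split => w /=.
  by move/negP; rewrite -leNgt.
by move=> h; apply/negP; rewrite -leNgt.
Qed.

Lemma cvg_in_prob_pinfty_whp (Y : nat -> Omega -> R) :
  (forall k, measurable_fun setT (Y k)) ->
  (forall C : R, whp (fun z => C < Y z.1 z.2)) -> cvg_in_prob_pinfty P Y.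
Proof.
move=> mY hY C.
have mA k : measurable [set w | C < Y k w].
  have := mY k measurableT _ (measurable_itv `]C, +oo[); rewrite setTI.
  by congr measurable; apply/seteqP; split => w /=; rewrite in_itv/= andbT.
have cv := whp_Pr mA (hY C).
have E k : Pr P [set w | C < Y k w] = 1 - Pr P (~` [set w | C < Y k w]).
  rewrite /Pr probability_setC// fineB ?fin_num_measure//.
  by rewrite opprB addrC subrK.
rewrite (_ : (fun k => _) = (fun k => 1 - Pr P (~` [set w | C < Y k w]))).
  by rewrite -[X in _ --> X]subr0; apply: cvgB => //; exact: cvg_cst.
by apply/funext.
Qed.

Lemma integralD_le (X Y : Omega -> R) (a b : R) :
  measurable_fun setT X -> measurable_fun setT Y ->
  (forall w, 0 <= X w) -> (forall w, 0 <= Y w) ->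
  (\int[P]_w (X w)%:E <= a%:E)%E -> (\int[P]_w (Y w)%:E <= b%:E)%E ->
  (\int[P]_w (X w + Y w)%:E <= (a + b)%:E)%E.
Proof.
move=> mX mY X0 Y0 Xa Yb; have mXE : measurable_fun setT (EFin \o X).
  exact/measurable_EFinP.
have mYE : measurable_fun setT (EFin \o Y) by exact/measurable_EFinP.
have := @ge0_integralD _ _ _ P setT measurableT (EFin \o X) (EFin \o Y).
move=> -> //; first by rewrite EFinD leeD.
- by move=> w _; rewrite lee_fin.
- by move=> w _; rewrite lee_fin.
Qed.

Lemma markov_ineq (X : Omega -> R) (a : R) : 0 < a -> measurable_fun setT X ->
  (forall w, 0 <= X w) ->
  (P [set w | (a <= X w)%R] <= (a^-1)%:E * \int[P]_w (X w)%:E)%E.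
Proof.
move=> a0 mX X0.
have mA : measurable [set w | a <= X w].
  have := mX measurableT _ (measurable_itv `[a, +oo[); rewrite setTI.
  by congr measurable; apply/seteqP; split => w /=; rewrite in_itv/= andbT.
have mXE : measurable_fun setT (EFin \o X) by exact/measurable_EFinP.
rewrite -ge0_integralZl//; last 2 first.
- by move=> w _; rewrite lee_fin.
- by rewrite lee_fin invr_ge0 ltW.
rewrite -[P _]mul1e -(integral_cst P mA).
apply: (@le_trans _ _ (\int[P]_(w in [set w | (a <= X w)%R]) (a^-1 * X w)%:E)%E).
  apply: ge0_le_integral => //.
  - apply/measurable_EFinP; apply: measurable_funM => //.
    exact: measurable_funS mX.
  - by move=> w /= aX; rewrite -[1%E]/(1%:E) lee_fin mulrC ler_pdivlMr// mul1r.
apply: ge0_subset_integral => //.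
- by apply/measurable_EFinP; exact: measurable_funM.
- by move=> w _; rewrite lee_fin mulr_ge0// invr_ge0 ltW.
Qed.

Lemma whp_cvg0_moment (X : nat -> Omega -> R) (a : nat -> R) :
  (forall k, measurable_fun setT (X k)) -> (forall k w, 0 <= X k w) ->
  (forall k, (\int[P]_w (X k w)%:E <= (a k)%:E)%E) ->
  a k @[k --> \oo] --> (0 : R) ->
  X z.1 z.2 @[z --> whp] --> (0 : R).
Proof.
move=> mX X0 Xa acv; apply/cvgr0Pnorm_lt => e e0 dl dl0.
have ed : 0 < e * dl by rewrite mulr_gt0.
have /cvgr0Pnorm_lt/(_ _ ed) := acv; apply: filterS => k ak.
exists [set w | X k w < e]; split.
- have := mX k measurableT _ (measurable_itv `]-oo, e[); rewrite setTI.
  by congr measurable; apply/seteqP; split => w /=; rewrite in_itv/=.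
- rewrite (_ : ~` _ = [set w | e <= X k w]); last first.
    apply/seteqP; split => w /=; first by move/negP; rewrite -leNgt.
    by move=> h; apply/negP; rewrite -leNgt.
  apply: le_trans (markov_ineq e0 (mX k) (X0 k)) _.
  apply: (@le_trans _ _ ((e^-1)%:E * (a k)%:E)%E).
    by rewrite lee_pmul2l// lte_fin invr_gt0.
  rewrite -EFinM lee_fin mulrC ler_pdivrMr// mulrC; apply: ltW.
  by apply: le_lt_trans ak; exact: ler_norm.
- by move=> w /= h; rewrite ger0_norm.
Qed.

Lemma whp_cvg0_tight (H : nat -> Omega -> R) (C : R) (r : nat -> Omega -> R) :
  (forall k, measurable_fun setT (H k)) -> (forall k w, 0 <= H k w) ->
  (forall k, (\int[P]_w (H k w)%:E <= C%:E)%E) ->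
  r z.1 z.2 @[z --> whp] --> (0 : R) ->
  (H z.1 z.2 * r z.1 z.2) @[z --> whp] --> (0 : R).
Proof.
move=> mH H0 HC rcv; apply/cvgr0Pnorm_lt => e e0 dl dl0.
have C0 : 0 <= C.
  rewrite -lee_fin; apply: le_trans (HC 0%N).
  by apply: integral_ge0 => w _; rewrite lee_fin.
(* Markov's inequality at level [K] gives a probability at most [C / K <= dl / 2]; the added 1 keeps
   [K] positive when [C = 0]. *)
pose K := 2 * C / dl + 1.
have K0 : 0 < K by rewrite ltr_wpDl// divr_ge0 ?mulr_ge0// ltW.
have eK : 0 < e / K by rewrite divr_gt0.
have dl2 : 0 < dl / 2 by rewrite divr_gt0.
have /cvgr0Pnorm_lt/(_ _ eK)/(_ _ dl2) := rcv; apply: filterS => k [B [mB PB Br]].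
have mHK : measurable [set w | H k w < K].
  have := mH k measurableT _ (measurable_itv `]-oo, K[); rewrite setTI.
  by congr measurable; apply/seteqP; split => w /=; rewrite in_itv/=.
exists (B `&` [set w | H k w < K]); split; first exact: measurableI.
- rewrite setCI; apply: le_trans (measureU2 _ _ _) _; try exact: measurableC.
  rewrite [dl]splitr EFinD leeD//.
  rewrite (_ : ~` _ = [set w | K <= H k w]); last first.
    apply/seteqP; split => w /=; first by move/negP; rewrite -leNgt.
    by move=> h; apply/negP; rewrite -leNgt.
  apply: le_trans (markov_ineq K0 (mH k) (H0 k)) _.
  apply: (@le_trans _ _ ((K^-1)%:E * C%:E)%E).
    by rewrite lee_pmul2l// lte_fin invr_gt0.
  rewrite -EFinM lee_fin mulrC ler_pdivrMr//.
  have -> : dl / 2 * K = C + dl / 2 by rewrite /K; field; rewrite gt_eqF.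
  lra.
- move=> w [Bw /= HK]; have /= hr := Br w Bw.
  rewrite normrM (ger0_norm (H0 k w)).
  apply: (@le_lt_trans _ _ (K * `|r k w|)); first by rewrite ler_wpM2r// ltW.
  by rewrite mulrC -ltr_pdivlMr.
Qed.

End HighProbability.

(** * Estimated scores *)

(** The inverse is continuous away from 0, and the point 0 is split off as a measurable set. *)
Lemma measurable_invr (R : realType) : measurable_fun setT (fun x : R => x^-1).
Proof.
rewrite -(setUv [set 0]); apply/measurable_funU => //.
  exact: measurableC.
split; first exact: measurable_fun_set1.
apply: open_continuous_measurable_fun.
  by apply: closed_openC; exact: closed_eq.
move=> x; rewrite inE/= => /eqP x0; exact: inv_continuous.
Qed.

Section OneSample.
Context {R : realType} {d dS : measure_display} {Omega : measurableType d}.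
Context (P : probability Omega R) {S : measurableType dS}.
Context (f : (nat -> S) -> R -> R) (delta : int -> Omega -> S).
Context (iidd : iid P delta).
Context (mf : measurable_fun setT (fun p : seqS S * R => f p.1 p.2)).
Context (Lf : forall x, L2fun (f x)).
Context (f2 : (\int[lebesgue_measure]_(t in I01)
   \int[P]_w ((bshift f delta 0 w t) ^+ 2)%:E < +oo)%E).
Context (c : R -> R -> R) (lrc : is_lrcov P f delta c).
Context (N : nat -> nat) (Noo : forall n0 : nat, \forall k \near \oo, (n0 <= N k)%N).

Local Notation mu := (@lebesgue_measure R).
Local Notation RR := (measurableTypeR R).
Local Notation I := (@I01 R : set RR).
Local Notation L2I := (L2 mu (@mI01 R)).
Local Notation L2ip := (L2ip mu (@mI01 R)).
Local Notation nrm := (nrm L2ip).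
Local Notation ebar := (ebar delta Lf).

Lemma smeanE (mu0 : R -> R) n w t : (0 < n)%N ->
  smean mu0 f delta n w t = mu0 t + val (ebar n w) t.
Proof.
move=> n0; rewrite /smean val_ebar big_split/= mulrDr.
congr (_ + _); rewrite sumr_const_nat subn1 /=.
by rewrite -[mu0 t *+ n]mulr_natl mulrA mulVf ?mul1r// pnatr_eq0 -lt0n.
Qed.

Lemma measurable_smean (mu0 : R -> R) n : L2fun mu0 ->
  measurable_fun (setT `*` I) (fun z : Omega * RR => smean mu0 f delta n z.1 z.2).
Proof.
move=> [mmu _]; apply: measurable_funM => //; apply: measurable_sum => i.
apply: measurable_funD.
  apply: (@measurable_comp _ _ _ _ _ _ I mu0 _ (fun z : Omega * RR => z.2)).
  - exact: mI01.
  - by move=> _ [z [_ Iz] <-].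
  - exact: mmu.
  - exact: measurable_funS measurable_snd.
exact: measurable_funS (measurable_eps iidd mf i%:Z).
Qed.

Lemma ebar_score_whp (g : L2I) :
  L2ip (ebar (N z.1) z.2) g @[z --> whp P] --> (0 : R).
Proof.
pose es := ebar_score iidd mf Lf f2 g.
have Ncv : N k @[k --> \oo] --> \oo.
  by move=> A [n0 _ An0]; apply: filterS (Noo n0) => k; exact: An0.
have acv := cvg_comp _ _ Ncv (ebar_score_cvg iidd mf Lf f2 lrc g).
have sq : (L2ip (ebar (N z.1) z.2) g) ^+ 2 @[z --> whp P] --> (0 : R).
  apply: (@whp_cvg0_moment _ _ _ P
    (fun k w => (L2ip (ebar (N k) w) g) ^+ 2) _ _ _ _ acv).
  - move=> k; apply: measurable_funX.
    rewrite (_ : (fun w => _) = val (es (N k))); first by case: (L2P (es (N k))).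
    by apply/funext => w; rewrite val_ebar_score.
  - by move=> k w; rewrite sqr_ge0.
  - move=> k; rewrite L2ip_sqrE le_eqVlt; apply/orP; left; apply/eqP.
    by apply: eq_integral => w _; rewrite val_ebar_score.
apply/cvgr0Pnorm_lt => e e0.
have e2 : 0 < e ^+ 2 by rewrite exprn_gt0.
have /cvgr0Pnorm_lt/(_ _ e2) := sq; apply: (@filterS _ _ (whp_filter P)) => z.
rewrite ger0_norm ?sqr_ge0// -[X in X < _]real_normK ?num_real//.
by rewrite ltr_pXn2r// ?nnegrE// ltW.
Qed.

Lemma ebar_dom_bounded : exists C : R, forall n,
  (\int[P]_w (ebar_dom delta Lf n w)%:E <= C%:E)%E.
Proof.
exists (fine (1 + eps_sq P f delta)) => n.
have h := ebar_dom_moment iidd mf Lf f2 n.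
rewrite fineK// ge0_fin_numE.
  by apply: lte_add_pinfty; [exact: ltry | exact: (eps_sq_lty iidd mf f2)].
by apply: le_trans h; apply: integral_ge0 => w _; rewrite lee_fin ebar_dom_ge0.
Qed.

End OneSample.

Section KsqMeasurable.
Context {R : realType} {d : measure_display} {Omega : measurableType d}.
Local Notation mu := (@lebesgue_measure R).
Local Notation RR := (measurableTypeR R).
Local Notation I := (@I01 R : set RR).

(** Makes the event that the two kernels are close measurable, so that a bound on its [Pr] can be
    turned into a [whp] statement. *)
Lemma measurable_ksqB (k : Omega -> R -> R -> R) (dk : R -> R -> R) :
  measurable_fun setT (fun x : Omega * (R * R) => k x.1 x.2.1 x.2.2) ->
  L2kernel dk ->
  measurable_fun setT (fun w => ksq (fun t s => k w t s - dk t s)).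
Proof.
move=> mk [mdk _].
have mk' : measurable_fun setT (fun z : Omega * (RR * RR) => k z.1 z.2.1 z.2.2).
  exact: mk.
have massoc : measurable_fun setT
    (fun z : (Omega * RR) * RR => (z.1.1, (z.1.2, z.2))).
  apply: measurable_fun_pair.
    exact: (measurableT_comp measurable_fst measurable_fst).
  apply: measurable_fun_pair; last exact: measurable_snd.
  exact: (measurableT_comp measurable_snd measurable_fst).
have mts : measurable_fun setT (fun z : (Omega * RR) * RR => (z.1.2, z.2)).
  apply: measurable_fun_pair; last exact: measurable_snd.
  exact: (measurableT_comp measurable_snd measurable_fst).
have mF : measurable_fun ((setT `*` I) `*` I)
    (fun z : (Omega * RR) * RR => k z.1.1 z.1.2 z.2 - dk z.1.2 z.2).
  apply: measurable_funB.
    exact: (measurable_funS measurableT _ (measurableT_comp mk' massoc)).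
  apply: (@measurable_comp _ _ _ _ _ _ (I `*` I) (fun z : RR * RR => dk z.1 z.2) _
    (fun z : (Omega * RR) * RR => (z.1.2, z.2))).
  - by apply: measurableX; exact: mI01.
  - by move=> _ [z [[_ I1] I2] <-].
  - exact: mdk.
  - exact: measurable_funS mts.
have mTI : measurable (setT `*` I : set (Omega * RR)).
  by apply: measurableX => //; exact: mI01.
have m1 := @measurable_int_section _ _ _ _ _ mu _ _ mTI mI01
  (fun z : (Omega * RR) * RR => ((k z.1.1 z.1.2 z.2 - dk z.1.2 z.2) ^+ 2)%:E) _ _.
apply: (@measurable_int_section _ _ _ Omega _ mu _ _ measurableT mI01
  (fun z : Omega * RR => (\int[mu]_(s in I)
    ((k z.1 z.2 s - dk z.2 s) ^+ 2)%:E)%E)).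
- apply: m1.
    by apply/measurable_EFinP; exact: measurable_funX.
  by move=> z _; rewrite lee_fin sqr_ge0.
- by move=> z _; apply: integral_ge0 => s _; rewrite lee_fin sqr_ge0.
Qed.

End KsqMeasurable.

Lemma cvg_sumr (R : realType) (T I : Type) (F : set_system T) {FF : Filter F}
    (r : seq I) (f : I -> T -> R) (a : I -> R) :
  (forall i, f i x @[x --> F] --> a i) ->
  (\sum_(i <- r) f i x) @[x --> F] --> \sum_(i <- r) a i.
Proof.
move=> fa; elim: r => [|i r IH].
  rewrite big_nil (_ : (fun x => _) = (fun=> 0)); first exact: cvg_cst.
  by apply/funext => x; rewrite big_nil.
rewrite big_cons (_ : (fun x => _) = (fun x => f i x + \sum_(j <- r) f j x)).
  exact: cvgD.
by apply/funext => x; rewrite big_cons.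
Qed.

Section Conclusion.
Context {R : realType} {d : measure_display} {Omega : measurableType d}.
Context (P : probability Omega R).

(** The ratio is at least half of the smaller of [a] and [b], so the normalisation diverges with the
    sample sizes. *)
Lemma prod_over_sum_ge (a b n0 : nat) : (0 < n0)%N -> (n0 <= a)%N -> (n0 <= b)%N ->
  n0%:R / 2 <= (a * b)%:R / (a + b)%:R :> R.
Proof.
move=> n00 na nb; have ab : 0 < (a + b)%:R :> R.
  by rewrite ltr0n addn_gt0 (leq_trans n00 na).
rewrite ler_pdivlMr// mulrAC ler_pdivrMr// -!natrM ler_nat mulnDr.
by rewrite muln2 -addnn; apply: leq_add; [rewrite mulnC|]; exact: leq_mul.
Qed.

Lemma scaled_lower_bound (A y n c v : R) : 0 < y -> 4 * `|A| / y < n ->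
  n / 2 <= c -> `|y - v| < y / 2 -> A < c * v.
Proof.
move=> y0 nA nc; rewrite ltr_norml => /andP[_ yv].
have v2 : y / 2 < v by lra.
apply: (@le_lt_trans _ _ `|A|); first exact: ler_norm.
move: nA; rewrite ltr_pdivrMr// => nA.
have n0 : 0 < n by rewrite -(pmulr_lgt0 n y0); apply: le_lt_trans nA; rewrite mulr_ge0.
apply: (@lt_le_trans _ _ (n / 2 * (y / 2))); first lra.
by apply: ler_pM => //; lra.
Qed.

(* With [u] close to one of [v], [-v], the squares of [<h,u>] and [<h,v>] are
   close, whatever the sign. *)
Lemma sqr_sip_dist (V : lmodType R) (ip : semi_inner V) (h u v : V) (r : R) :
  r = Num.min (nrm ip (u - v)) (nrm ip (u + v)) ->
  `|ip h u ^+ 2 - ip h v ^+ 2| <=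
    (nrm ip h * r) * (2 * `|ip h v| + nrm ip h * r).
Proof.
move=> rE.
have [s s1 hs] : exists2 s : R, s = 1 \/ s = -1 &
    `|ip h u - s * ip h v| <= nrm ip h * r.
  rewrite rE; case: leP => _; [exists 1; first by left | exists (-1); first by right].
    by rewrite mul1r -sipBr; exact: sip_le.
  by rewrite mulN1r opprK -sipDr; exact: sip_le.
have -> : ip h u ^+ 2 - ip h v ^+ 2 =
    (ip h u - s * ip h v) * ((ip h u - s * ip h v) + 2 * s * ip h v).
  by case: s1 => ->; ring.
rewrite normrM ler_pM//; apply: le_trans (ler_normD _ _) _.
rewrite addrC lerD// !normrM ger0_norm//.
by case: s1 => ->; rewrite ?normrN normr1 mulr1.
Qed.

End Conclusion.

(** * Limits of the two test statistics *)

Theorem theorem6 (R : realType) (d : measure_display) (Omega : measurableType d)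
  (P : probability Omega R)
  (* first sample: eps_i = f(delta_i, delta_{i-1}, ...) *)
  (dS : measure_display) (S : measurableType dS)
  (f : (nat -> S) -> R -> R) (delta : int -> Omega -> S)
  (dcopy : nat -> int -> int -> Omega -> S)
  (* second sample: eps*_j = fs(deltas_j, deltas_{j-1}, ...) *)
  (dSs : measure_display) (Ss : measurableType dSs)
  (fs : (nat -> Ss) -> R -> R) (deltas : int -> Omega -> Ss)
  (dcopys : nat -> int -> int -> Omega -> Ss)
  (* means, long-run covariance kernels, limit of N/(N+M) *)
  (mu mus : R -> R) (c cs : R -> R -> R) (theta : R)
  (* sample sizes along the asymptotic regime *)
  (N M : nat -> nat)
  (* eigenvalues / orthonormal_fam eigenfunctions of D (index i stands for i+1) *)
  (lam : nat -> R) (phi : nat -> R -> R) (p : nat)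
  (* estimated kernel, its eigenvalues and unit-norm eigenfunctions *)
  (dhat : nat -> Omega -> R -> R -> R)
  (lamhat : nat -> nat -> Omega -> R) (phihat : nat -> nat -> Omega -> R -> R) :
  L2_m_approximable P f delta dcopy ->
  L2_m_approximable P fs deltas dcopys ->
  indep_L2seq P (bshift f delta) (bshift fs deltas) ->
  L2fun mu -> L2fun mus ->
  0 < ip (fun t => mu t - mus t) (fun t => mu t - mus t) ->
  (forall n0 : nat, \forall k \near \oo, (n0 <= N k)%N) ->
  (forall n0 : nat, \forall k \near \oo, (n0 <= M k)%N) ->
  (fun k => (N k)%:R / (N k + M k)%:R : R) @ \oo --> theta ->
  is_lrcov P f delta c ->
  is_lrcov P fs deltas cs ->
  let dk := fun t s => (1 - theta) * c t s + theta * cs t s in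
  (0 < p)%N ->
  leading_eigs dk p.+1 lam phi ->
  orthonormal_fam p.+1 phi ->
  (forall i, (i < p)%N -> lam i.+1 < lam i) ->
  (forall k w, L2kernel (dhat k w)) ->
  (forall k, measurable_fun setT
                (fun x : Omega * (R * R) => dhat k x.1 x.2.1 x.2.2)) ->
  (forall e : R, 0 < e ->
     (fun k => Pr P [set w | (e%:E <= ksq (fun t s => (dhat k w t s - dk t s)%R))%E])
       @ \oo --> 0) ->
  (forall k w, leading_eigs (dhat k w) p (fun i => lamhat k i w)
                                         (fun i => phihat k i w)) ->
  (forall k i, measurable_fun setT (lamhat k i)) ->
  (forall k i, measurable_fun setT (fun x : Omega * R => phihat k i x.1 x.2)) ->
  let ahat := fun k i w =>
    ip (fun t => smean mu f delta (N k) w t - smean mus fs deltas (M k) w t)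
       (phihat k i w) in
  let U1 := fun k w =>
    ((N k * M k)%:R / (N k + M k)%:R) * \sum_(i < p) ahat k i w ^+ 2 in
  let U2 := fun k w =>
    ((N k * M k)%:R / (N k + M k)%:R) * \sum_(i < p) ahat k i w ^+ 2 / lamhat k i w in
  [/\ cvg_in_prob P (fun k w => ((N k + M k)%:R / (N k * M k)%:R) * U1 k w)
        (\sum_(i < p) ip (fun t => mu t - mus t) (phi i) ^+ 2),
      cvg_in_prob P (fun k w => ((N k + M k)%:R / (N k * M k)%:R) * U2 k w)
        (\sum_(i < p) ip (fun t => mu t - mus t) (phi i) ^+ 2 / lam i) &
      (0 < theta < 1 ->
       (exists i, (i < p)%N /\ ip (fun t => mu t - mus t) (phi i) != 0) ->
       cvg_in_prob_pinfty P U1 /\ cvg_in_prob_pinfty P U2)].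
Proof.
move=> [iidd [_ [mf [Lf [_ [_ f2]]]]]] [iidds [_ [mfs [Lfs [_ [_ fs2]]]]]] _.
move=> Lmu Lmus _ Noo Moo thcv lrc lrcs dk p0 lead on dec Ldh mdh dhcv leadh.
move=> mlh mph ahat U1 U2.
pose leb := @lebesgue_measure R; pose RR := measurableTypeR R.
pose ipL := L2ip leb (@mI01 R).
have Lc := proj1 lrc; have Lcs := proj1 lrcs.
have Ldk : L2kernel dk := L2kernel_comb (1 - theta) theta Lc Lcs.
(* As a limit of proportions [theta] lies in [0,1], so [dk] is a convex combination of two positive
   kernels. *)
have th0 : 0 <= theta.
  rewrite -(cvg_lim _ thcv)//; apply: limr_ge; first by apply/cvg_ex; exists theta.
  by near=> k; rewrite divr_ge0.
have th1 : theta <= 1.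
  rewrite -(cvg_lim _ thcv)//; apply: limr_le; first by apply/cvg_ex; exists theta.
  near=> k; have N1 : (1 <= N k)%N by near: k; exact: Noo.
  by rewrite ler_pdivrMr ?mul1r ?ler_nat ?leq_addr// ltr0n addn_gt0 N1.
have dk_sym (g g' : L2 leb (@mI01 R)) :
    kform dk (val g) (val g') = kform dk (val g') (val g).
  rewrite !(kform_comb _ _ _ _ Lc Lcs).
  by rewrite (lrcov_sym iidd mf Lf f2 lrc g g') (lrcov_sym iidds mfs Lfs fs2 lrcs g g').
have dk_psd (g : L2 leb (@mI01 R)) : 0 <= kform dk (val g) (val g).
  rewrite (kform_comb _ _ _ _ Lc Lcs) addr_ge0// mulr_ge0 ?subr_ge0//.
    exact: (lrcov_psd iidd mf Lf f2 lrc).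
  exact: (lrcov_psd iidds mfs Lfs fs2 lrcs).
have lam0 := lam_pos Ldk dk_psd lead on dec.
have stable := leading_eigs_stable Ldk dk_sym dk_psd lead on dec.
pose phiL i := toL2 (phi i).
have phiE i : (i < p)%N -> val (phiL i) = phi i.
  by move=> ip0; have [/(_ i (ltnW ip0))[+ _ _] _ _ _] := lead; exact: toL2E.
pose uL k i w := toL2 (phihat k i w).
have uE k i w : (i < p)%N -> val (uL k i w) = phihat k i w.
  by move=> ip0; have [/(_ i ip0)[+ _ _] _ _ _] := leadh k w; exact: toL2E.
have whp_ksq (e : R) : 0 < e -> whp P (fun z =>
    (ksq (fun t s => (dhat z.1 z.2 t s - dk t s)%R) < e%:E)%E).
  move=> e0.
  have mk k := measurable_ksqB (mdh k) Ldk.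
  apply: (@whp_measurable _ _ _ P (fun k => [set w |
    (ksq (fun t s => (dhat k w t s - dk t s)%R) < e%:E)%E])).
    move=> k; have := emeasurable_fun_infty_o measurableT (mk k) e%:E.
    by rewrite setTI.
  have := dhcv e e0.
  rewrite (_ : (fun k => Pr P (~` _)) = (fun k => Pr P [set w |
    (e%:E <= ksq (fun t s => (dhat k w t s - dk t s)%R))%E]))//.
  apply/funext => k; congr (Pr P _); apply/seteqP; split => w /=.
    by move/negP; rewrite -leNgt.
  by move=> h; apply/negP; rewrite -leNgt.
have lamcv i : (i < p)%N -> lamhat z.1 i z.2 @[z --> whp P] --> lam i.
  move=> ip0; apply/cvgrPdist_le => e e0.
  have [e' e'0 He] := stable _ p0 e0.
  apply: (@filterS _ _ (whp_filter P)) (whp_ksq e' e'0) => z small.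
  have [+ _] := He _ _ _ (Ldh z.1 z.2) small (leadh z.1 z.2) i ip0.
  by rewrite distrC.
pose r i k w := Num.min (nrm ipL (uL k i w - phiL i)) (nrm ipL (uL k i w + phiL i)).
have r0 i k w : 0 <= r i k w by rewrite le_min !nrm_ge0.
have rcv i : (i < p)%N -> r i z.1 z.2 @[z --> whp P] --> 0.
  move=> ip0; apply/cvgr0Pnorm_le => e e0.
  have [e' e'0 He] := stable _ p0 e0.
  apply: (@filterS _ _ (whp_filter P)) (whp_ksq e' e'0) => z small.
  have [_ +] := He _ _ _ (Ldh z.1 z.2) small (leadh z.1 z.2) i ip0.
  by rewrite ger0_norm.
pose dmu := toL2 (fun t => mu t - mus t).
have Ldmu : L2fun (fun t => mu t - mus t).
  have := L2inD (@mI01 R) Lmu (L2inZ (@mI01 R) (-1) Lmus).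
  by congr (L2fun _); apply/funext => t; rewrite mulN1r.
have dmuE : val dmu = (fun t => mu t - mus t) by exact: toL2E.
(* The difference of the sample means as a vector of L^2. It agrees with the functions in [ahat]
   once both sample sizes are positive, the inverse of 0 being 0. *)
pose h k w := dmu + ebar delta Lf (N k) w - ebar deltas Lfs (M k) w.
have ahatE : \forall k \near \oo, forall i w, (i < p)%N ->
    ahat k i w = ipL (h k w) (uL k i w).
  near=> k => i w ip0; have N1 : (1 <= N k)%N by near: k; exact: Noo.
  have M1 : (1 <= M k)%N by near: k; exact: Moo.
  rewrite /ahat /ipL L2ipE (uE _ _ _ ip0); apply: eq_Rintegral => t _; congr (_ * _).
  rewrite (smeanE delta Lf)// (smeanE deltas Lfs)// /h valL2B valL2D dmuE.
  by rewrite opprD addrACA addrA.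
(* A measurable bound for the norm of [h] with uniformly bounded mean: its product with the distance
   [r] tends to 0 at whatever rate [r] does. *)
pose T k w := nrm ipL dmu + ebar_dom delta Lf (N k) w + ebar_dom deltas Lfs (M k) w.
have hT k w : nrm ipL (h k w) <= T k w.
  apply: le_trans (nrmB _ _ _) _; apply: lerD; last exact: nrm_ebar_le.
  by apply: le_trans (nrmD _ _ _) _; apply: lerD => //; exact: nrm_ebar_le.
have T0 k w : 0 <= T k w by apply: le_trans (hT k w); exact: nrm_ge0.
have mT k : measurable_fun setT (T k).
  apply: measurable_funD; last exact: (measurable_ebar_dom iidds mfs Lfs).
  by apply: measurable_funD => //; exact: (measurable_ebar_dom iidd mf Lf).
have [C TC] : exists C : R, forall k, (\int[P]_w (T k w)%:E <= C%:E)%E.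
  have [C1 H1] := ebar_dom_bounded iidd mf Lf f2.
  have [C2 H2] := ebar_dom_bounded iidds mfs Lfs fs2.
  have m1 n := measurable_ebar_dom iidd mf Lf n.
  have m2 n := measurable_ebar_dom iidds mfs Lfs n.
  exists (nrm ipL dmu + C1 + C2) => k.
  have n0 := nrm_ge0 ipL dmu.
  apply: integralD_le => //.
  - exact: measurable_funD.
  - by move=> w; rewrite addr_ge0// ebar_dom_ge0.
  - by move=> w; exact: ebar_dom_ge0.
  - apply: integralD_le => //; first by move=> w; exact: ebar_dom_ge0.
    rewrite integral_cst// -[leRHS]mule1; apply: lee_wpmul2l.
      by rewrite lee_fin.
    exact: probability_le1.
have ycv i : (i < p)%N -> (T z.1 z.2 * r i z.1 z.2) @[z --> whp P] --> 0.
  by move=> ip0; exact: (whp_cvg0_tight mT T0 TC (rcv i ip0)).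
have Bcv i : (i < p)%N -> ipL (h z.1 z.2) (phiL i) @[z --> whp P] -->
    ip (fun t => mu t - mus t) (phi i).
  move=> ip0.
  have -> : ip (fun t => mu t - mus t) (phi i) = ipL dmu (phiL i) + 0 - 0.
    by rewrite addr0 subr0 /ipL L2ipE dmuE phiE.
  rewrite (_ : (fun z => _) = (fun z => ipL dmu (phiL i) +
    ipL (ebar delta Lf (N z.1) z.2) (phiL i) -
    ipL (ebar deltas Lfs (M z.1) z.2) (phiL i))); last first.
    by apply/funext => z; rewrite /h sipBl sipDl.
  apply: cvgB; last exact: (ebar_score_whp iidds mfs Lfs fs2 lrcs Moo).
  apply: cvgD; first exact: cvg_cst.
  exact: (ebar_score_whp iidd mf Lf f2 lrc Noo).
(* The squared score against the estimated eigenfunction is compared with the one against [phi i] by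
   [sqr_sip_dist]; this disposes of the unknown sign. *)
have acv i : (i < p)%N -> ahat z.1 i z.2 ^+ 2 @[z --> whp P] -->
    ip (fun t => mu t - mus t) (phi i) ^+ 2.
  move=> ip0; set a := ip _ (phi i).
  have B2 : ipL (h z.1 z.2) (phiL i) ^+ 2 @[z --> whp P] --> a ^+ 2.
    rewrite expr2 (_ : (fun z => _) = (fun z => ipL (h z.1 z.2) (phiL i) *
      ipL (h z.1 z.2) (phiL i))); last by apply/funext => z; rewrite expr2.
    by apply: cvgM; exact: Bcv.
  have bcv : (T z.1 z.2 * r i z.1 z.2 * (2 * `|ipL (h z.1 z.2) (phiL i)| +
      T z.1 z.2 * r i z.1 z.2)) @[z --> whp P] --> (0 : R).
    rewrite -[X in _ --> X](mul0r (2 * `|a| + 0)).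
    apply: cvgM; first exact: ycv.
    apply: cvgD; last exact: ycv.
    by apply: cvgMl_tmp; apply: cvg_norm; exact: Bcv.
  have D0 : (ahat z.1 i z.2 ^+ 2 - ipL (h z.1 z.2) (phiL i) ^+ 2)
      @[z --> whp P] --> (0 : R).
    apply/cvgr0Pnorm_lt => e e0.
    have /cvgr0Pnorm_lt/(_ _ e0) := bcv.
    apply: (filterS2 (whp_filter P) _ (whp_near P ahatE)) => z /= aE.
    apply: le_lt_trans; apply: le_trans (ler_norm _); rewrite aE//.
    apply: le_trans (sqr_sip_dist (h z.1 z.2) (erefl (r i z.1 z.2))) _.
    have hr : nrm ipL (h z.1 z.2) * r i z.1 z.2 <= T z.1 z.2 * r i z.1 z.2.
      by apply: ler_wpM2r.
    have n0 := nrm_ge0 ipL (h z.1 z.2).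
    apply: ler_pM => //.
    - exact: mulr_ge0.
    - by apply: addr_ge0; apply: mulr_ge0.
    - by apply: lerD.
  rewrite (_ : (fun z => ahat z.1 i z.2 ^+ 2) = (fun z =>
    (ahat z.1 i z.2 ^+ 2 - ipL (h z.1 z.2) (phiL i) ^+ 2) +
    ipL (h z.1 z.2) (phiL i) ^+ 2)); last by apply/funext => z; rewrite subrK.
  by rewrite -[a ^+ 2]add0r; exact: cvgD.
have mahat k i : measurable_fun setT (ahat k i).
  apply: (measurable_Rint_section leb measurableT (@mI01 R) (F := fun z : Omega * RR =>
    (smean mu f delta (N k) z.1 z.2 - smean mus fs deltas (M k) z.1 z.2) *
    phihat k i z.1 z.2)).
  apply: measurable_funM.
    apply: measurable_funB; first exact: (measurable_smean iidd mf).
    exact: (measurable_smean iidds mfs).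
  exact: (measurable_funS measurableT _ (mph k i)).
have S1cv : (\sum_(i < p) ahat z.1 i z.2 ^+ 2) @[z --> whp P] -->
    \sum_(i < p) ip (fun t => mu t - mus t) (phi i) ^+ 2.
  by apply: cvg_sumr => i; exact: acv.
have S2cv : (\sum_(i < p) ahat z.1 i z.2 ^+ 2 / lamhat z.1 i z.2) @[z --> whp P] -->
    \sum_(i < p) ip (fun t => mu t - mus t) (phi i) ^+ 2 / lam i.
  apply: cvg_sumr => i; apply: cvgM; first exact: acv.
  by apply: cvgV; [rewrite gt_eqF// lam0 | exact: lamcv].
have mS1 k : measurable_fun setT (fun w => \sum_(i < p) ahat k i w ^+ 2).
  by apply: measurable_sum => i; apply: measurable_funX.
have mS2 k : measurable_fun setT (fun w => \sum_(i < p) ahat k i w ^+ 2 / lamhat k i w).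
  apply: measurable_sum => i; apply: measurable_funM; first exact: measurable_funX.
  exact: (measurableT_comp (@measurable_invr R) (mlh k i)).
have scaled (Y : nat -> Omega -> R) (y : R) : Y z.1 z.2 @[z --> whp P] --> y ->
    (forall k, measurable_fun setT (Y k)) ->
    cvg_in_prob P (fun k w => (N k + M k)%:R / (N k * M k)%:R *
      ((N k * M k)%:R / (N k + M k)%:R * Y k w)) y.
  move=> Ycv mY; apply: cvg_in_prob_whp.
    by move=> k; do 2!apply: measurable_funM => //.
  (* The two normalising factors are inverse to each other only when both sample sizes are
     positive. *)
  have NM1 : \forall k \near \oo, (1 <= N k)%N /\ (1 <= M k)%N.
    exact: filterI (Noo 1%N) (Moo 1%N).
  apply/cvgrPdist_lt => e e0; have /cvgrPdist_lt/(_ _ e0) := Ycv.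
  apply: (filterS2 (whp_filter P) _ (whp_near P NM1)) => z /= [N1 M1].
  rewrite mulrA mulf_div [X in X / _]mulrC divff ?mul1r//.
  by rewrite mulf_neq0// pnatr_eq0 -lt0n ?muln_gt0 ?addn_gt0 N1.
have infty (Y : nat -> Omega -> R) (y : R) : Y z.1 z.2 @[z --> whp P] --> y ->
    (forall k, measurable_fun setT (Y k)) -> 0 < y ->
    cvg_in_prob_pinfty P (fun k w => (N k * M k)%:R / (N k + M k)%:R * Y k w).
  move=> Ycv mY y0; apply: cvg_in_prob_pinfty_whp.
    by move=> k; apply: measurable_funM.
  move=> A; pose n0 := (Num.bound (4 * `|A| / y)).+1.
  have n0A : 4 * `|A| / y < n0%:R.
    apply: lt_le_trans (archi_boundP _) _; last by rewrite ler_nat.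
    by rewrite divr_ge0 ?mulr_ge0// ltW.
  have y2 : 0 < y / 2 by rewrite divr_gt0.
  have NMn : \forall k \near \oo, (n0 <= N k)%N /\ (n0 <= M k)%N.
    exact: filterI (Noo n0) (Moo n0).
  have /cvgrPdist_lt/(_ _ y2) := Ycv.
  apply: (filterS2 (whp_filter P) _ (whp_near P NMn)) => z /= [N1 M1] hY.
  exact: (scaled_lower_bound y0 n0A (prod_over_sum_ge (ltn0Sn _) N1 M1) hY).
split; [exact: scaled|exact: scaled|].
move=> _ [i0 [i0p ai0]]; split.
- apply: (infty _ _ S1cv mS1).
  rewrite (bigD1 (Ordinal i0p))//= ltr_pwDl//.
    by rewrite exprn_even_gt0.
  by apply: sumr_ge0 => i _; rewrite sqr_ge0.
- apply: (infty _ _ S2cv mS2).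
  rewrite (bigD1 (Ordinal i0p))//= ltr_pwDl//.
    by rewrite divr_gt0 ?lam0// exprn_even_gt0.
  by apply: sumr_ge0 => i _; rewrite divr_ge0 ?sqr_ge0// ltW ?lam0.
Unshelve. all: by end_near. Qed.
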